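(* Suppose Assumptions 1, 2 and 3 hold and that $E(U_t^2)<\infty$. If $\xi=\xi_n=O(n^{-1/4})$, then the least squares estimator $\hat\beta$ of the integrated volatility (defined in the context) satisfies $$\hat\beta-\int_0^T\sigma_t^2\,dt=O_p(n^{-1/4}).$$
   Context: Setting. $T>0$ is fixed. For each $n$ there is a deterministic grid $\mathcal G=\{t_0,\dots,t_n\}$ with $0=t_0<t_1<\dots<t_n=T$ (depending on $n$), $\Delta t_j=t_j-t_{j-1}$, and $\max_{1\le j\le n}\Delta t_j\to0$ as $n\to\infty$. The data are $Y_{t_j}=X_{t_j}+U_{t_j}$, $j=0,\dots,n$. The process $(X_t)_{t\in[0,T]}$ satisfies $dX_t=\mu_t\,dt+\sigma_t\,dB_t$, where $\mu_t$ is a locally bounded, progressively measurable process, $\sigma_t$ is a positive, locally bounded It\^o semimartingale, and $B_t$ is a standard Brownian motion. Assumption 1: the errors $U_{t_0},\dots,U_{t_n}$ are independent and identically distributed with unknown density $f_U$, and are independent of the process $(X_t)_{t\in[0,T]}$. Assumption 2: as $n\to\infty$, $\min_{1\le j\le n}\Delta t_j/\max_{1\le j\le n}\Delta t_j$ is uniformly bounded away from zero and infinity. Assumption 3: the characteristic function $f_U^{\mathrm{Ft}}(s)=\int e^{isx}f_U(x)\,dx$ is real-valued and does not vanish at any point of the real line. Estimated error characteristic function. For $\xi>0$ let $S_j=\{t_\ell\in\mathcal G:|t_\ell-t_j|\le\xi,\ \ell\ne j\}$ for $j=0,\dots,n$, let $N_j$ be the number of points of $S_j$, and $N(\xi)=\sum_{j=0}^nN_j$.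 It is understood throughout that $\xi=\xi_n$ is such that $\max_{1\le j\le n}N_j\asymp\min_{1\le j\le n}N_j\asymp n\xi$, where $a_n\asymp b_n$ means $c_1\le a_n/b_n\le c_2$ for all $n\ge1$ for some positive constants $c_1,c_2$. Put $$\hat f_{\tilde U}^{\mathrm{Ft}}(s;\xi)=\Big|\frac1{N(\xi)}\sum_{j=0}^n\sum_{t_\ell\in S_j}\cos\{s(Y_{t_\ell}-Y_{t_j})\}\Big|.$$ The function $G$. Let $N=\lfloor(n+1)^{1/2}\rfloor$, $K_m=m$, $a_m=12K_m(m-N/2-1/2)/\{N(N^2-1)\}$ for $m=1,\dots,N$, $\zeta=K_1K_2/\{(n+1)(K_2-K_1)\}$ and, with $i^2=-1$, $$\hat\phi^{K_m}(s)=K_m^{-1}\sum_{\ell=K_m}^n\exp\{is(Y_{t_\ell}-Y_{t_{\ell-K_m}})\},\qquad G(s)=\sum_{m=1}^Na_m\hat\phi^{K_m}(s)+\zeta\{\hat\phi^{K_1}(s)-\hat\phi^{K_2}(s)\}.$$ The estimator $\hat\beta$. Let $s_1,\dots,s_m$ be a fixed finite collection of nonzero real numbers (chosen so that $\hat f_{\tilde U}^{\mathrm{Ft}}(s_j;\xi)$ is close to one; no quantitative requirement is imposed). $\hat\beta$ is the least squares estimator of $\beta$ in the no-intercept linear regression $$\mathrm{Re}\{G(s_j)\}=-\frac{s_j^2}{2}\hat f_{\tilde U}^{\mathrm{Ft}}(s_j;\xi)\,\beta+\epsilon_j\quad(j=1,\dots,m),$$ that is, with $x_j=-s_j^2\hat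 f_{\tilde U}^{\mathrm{Ft}}(s_j;\xi)/2$, $\hat\beta=\sum_{j=1}^mx_j\mathrm{Re}\{G(s_j)\}/\sum_{j=1}^mx_j^2$. *)

(* Defs.v *)
From HB Require Import structures.
From mathcomp Require Import all_boot all_order all_algebra.
From mathcomp Require Import all_classical all_reals all_analysis
  measurable_realfun.
From mathcomp Require Import complex.

Set Implicit Arguments.
Unset Strict Implicit.
Unset Printing Implicit Defensive.

Import Order.TTheory GRing.Theory Num.Theory.
Import numFieldNormedType.Exports.

Local Open Scope classical_set_scope.
Local Open Scope ring_scope.

Local Notation leb := lebesgue_measure.

(* A process is a function R -> Omega -> V of which only the values at times in
   [0, T] are ever used. The filtration is not assumed to be complete or
   right-continuous. *)

Definition is_filtration (R : realType) d (Omega : measurableType d) (T : R)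
    (F : R -> set_system Omega) : Prop :=
  (forall t, 0 <= t <= T ->
     sigma_algebra setT (F t) /\ F t `<=` (measurable : set_system Omega)) /\
  (forall s t, 0 <= s -> s <= t -> t <= T -> F s `<=` F t).

Definition adapted (R : realType) d (Omega : measurableType d) (T : R)
    (F : R -> set_system Omega) (Z : R -> Omega -> R) : Prop :=
  forall t, 0 <= t <= T -> forall A : set R, measurable A -> F t (Z t @^-1` A).

(* For every t, joint measurability of (s, w) |-> H s w on [0, t] x Omega with
   respect to the product of the Borel sets and F t. *)
Definition progressive (R : realType) d (Omega : measurableType d)
    d' (V : measurableType d') (T : R)
    (F : R -> set_system Omega) (H : R -> Omega -> V) : Prop :=
  forall t, 0 <= t <= T -> forall A : set V, measurable A ->
    <<s [set C `*` E | C in (measurable : set_system R) & E in F t] >>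
      [set p : R * Omega | 0 <= p.1 <= t /\ A (H p.1 p.2)].

Definition stopping_time (R : realType) d (Omega : measurableType d) (T : R)
    (F : R -> set_system Omega) (tau : Omega -> R) : Prop :=
  (forall w, 0 <= tau w <= T) /\
  (forall t, 0 <= t <= T -> F t [set w | tau w <= t]).

(* On the compact interval [0, T] a localizing sequence reaches T itself. *)
Definition localizing (R : realType) d (Omega : measurableType d)
    (P : probability Omega R) (T : R) (F : R -> set_system Omega)
    (tau : nat -> Omega -> R) : Prop :=
  [/\ forall k, stopping_time T F (tau k),
      forall k w, tau k w <= tau k.+1 w
    & {ae P, forall w, \forall k \near \oo, tau k w = T}].

(* Time 0 is left out, so that the initial value need not be bounded. *)
Definition locally_bounded (R : realType) d (Omega : measurableType d)
    (P : probability Omega R) (T : R) (F : R -> set_system Omega)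
    (H : R -> Omega -> R) : Prop :=
  exists tau : nat -> Omega -> R, localizing P T F tau /\
  exists C : nat -> R, forall k w t, 0 < t <= tau k w -> `|H t w| <= C k.

Definition cadlag (R : realType) (T : R) (f : R -> R) : Prop :=
  (forall t, 0 <= t < T -> f x @[x --> t^'+] --> f t) /\
  (forall t, 0 < t <= T -> cvg (f x @[x --> t^'-])).

Definition stopped (R : realType) (Omega : Type) (tau : Omega -> R)
    (M : R -> Omega -> R) : R -> Omega -> R :=
  fun t w => M (Num.min t (tau w)) w.

Definition martingale (R : realType) d (Omega : measurableType d)
    (P : probability Omega R) (T : R) (F : R -> set_system Omega)
    (M : R -> Omega -> R) : Prop :=
  [/\ adapted T F M,
      forall t, 0 <= t <= T -> P.-integrable setT (EFin \o M t)
    & forall s t, 0 <= s -> s <= t -> t <= T -> forall E, F s E ->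
        (\int[P]_(w in E) (M t w)%:E = \int[P]_(w in E) (M s w)%:E)%E].

Definition local_martingale (R : realType) d (Omega : measurableType d)
    (P : probability Omega R) (T : R) (F : R -> set_system Omega)
    (M : R -> Omega -> R) : Prop :=
  [/\ adapted T F M,
      {ae P, forall w, cadlag T (M ^~ w)}
    & exists2 tau : nat -> Omega -> R, localizing P T F tau &
        forall k, martingale P T F (stopped (tau k) M)].

Definition continuous_local_martingale (R : realType) d
    (Omega : measurableType d) (P : probability Omega R) (T : R)
    (F : R -> set_system Omega) (M : R -> Omega -> R) : Prop :=
  local_martingale P T F M /\
  {ae P, forall w, {within `[0, T], continuous (M ^~ w)}}.

(* Null at 0 and orthogonal to every continuous local martingale. *)
Definition purely_discontinuous_local_martingale (R : realType) d
    (Omega : measurableType d) (P : probability Omega R) (T : R)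
    (F : R -> set_system Omega) (M : R -> Omega -> R) : Prop :=
  [/\ local_martingale P T F M,
      {ae P, forall w, M 0 w = 0}
    & forall N, continuous_local_martingale P T F N ->
        local_martingale P T F (fun t w => M t w * N t w)].

Definition jump (R : realType) (f : R -> R) (t : R) : R :=
  f t - lim (f x @[x --> t^'-]).

(* The sum of g over the jumps of f in ]0, t]. For f cadlag and g vanishing in
   a neighbourhood of 0 only finitely many terms are nonzero, so that the
   finite-support sum is the actual sum. *)
Definition jump_sum (R : realType) (g : R -> R) (f : R -> R) (t : R) : R :=
  \sum_(u \in `]0, t]) g (jump f u).

Definition large (R : realType) (x : R) : R := if 1 < `|x| then x else 0.

(* Semimartingale whose characteristics (B, C, nu), relative to the truncation
   x 1_{|x| <= 1}, are absolutely continuous in time: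
     B_t = int_0^t b_s ds,  C_t = int_0^t c_s ds,  nu(ds, dx) = K_s(dx) ds.
   B is the drift of the process deprived of its jumps larger than 1, C the
   quadratic variation of its continuous martingale part Mc, and nu the
   compensator of its jump measure. *)
Definition ito_semimartingale (R : realType) d (Omega : measurableType d)
    (P : probability Omega R) (T : R) (F : R -> set_system Omega)
    (Z : R -> Omega -> R) : Prop :=
  adapted T F Z /\ (forall w, cadlag T (Z ^~ w)) /\
  exists (b c : R -> Omega -> R) (K : R -> Omega -> {measure set R -> \bar R})
         (Mc Md : R -> Omega -> R),
    [/\ progressive T F b, progressive T F c,
        forall s w, 0 <= c s w
      & {ae P, forall w,
          (\int[leb]_(s in `[0%R, T]) (`|b s w| + c s w)%:E < +oo)%E}] /\
    [/\ forall A : set R, measurable A ->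
          @progressive R d Omega _ (\bar R) T F (fun s w => K s w A),
        forall s w, K s w [set 0] = 0%E
      & {ae P, forall w,
          (\int[leb]_(s in `[0%R, T])
             \int[K s w]_x (Num.min (x ^+ 2) 1)%:E < +oo)%E}] /\
    [/\ continuous_local_martingale P T F Mc,
        {ae P, forall w, Mc 0 w = 0}
      & local_martingale P T F
          (fun t w => Mc t w ^+ 2 - \int[leb]_(s in `[0, t]) c s w)] /\
    purely_discontinuous_local_martingale P T F Md /\
    {ae P, forall w, forall t, 0 <= t <= T ->
      Z t w = Z 0 w + \int[leb]_(s in `[0, t]) b s w
              + Mc t w + Md t w + jump_sum (@large R) (Z ^~ w) t} /\
    (forall (A : set R) (e : R), measurable A -> 0 < e ->
       A `<=` [set x | e < `|x|] ->
       local_martingale P T F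
         (fun t w => jump_sum \1_A (Z ^~ w) t
                     - \int[leb]_(s in `[0, t]) fine (K s w A))).

Definition brownian_motion (R : realType) d (Omega : measurableType d)
    (P : probability Omega R) (T : R) (F : R -> set_system Omega)
    (B : R -> Omega -> R) : Prop :=
  [/\ adapted T F B,
      {ae P, forall w, B 0 w = 0},
      {ae P, forall w, {within `[0, T], continuous (B ^~ w)}},
      forall s t, 0 <= s -> s < t -> t <= T ->
        forall A : set R, measurable A ->
        P [set w | A (B t w - B s w)] = normal_prob 0 (Num.sqrt (t - s)) A
    & forall s t, 0 <= s -> s < t -> t <= T ->
        forall (A : set R) (E : set Omega), measurable A -> F s E ->
        P ([set w | A (B t w - B s w)] `&` E) =
        (P [set w | A (B t w - B s w)%R] * P E)%E].

(* Stands for the integrand  sum_(i < m) h_i 1_{ ]r_i, r_(i+1)] }. *)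
Record simple_integrand (R : realType) (Omega : Type) := SimpleIntegrand {
  si_size : nat;
  si_time : nat -> R;
  si_coef : nat -> Omega -> R }.

Definition si_valid (R : realType) d (Omega : measurableType d) (T : R)
    (F : R -> set_system Omega) (H : simple_integrand R Omega) : Prop :=
  [/\ forall i, (i <= si_size H)%N -> 0 <= si_time H i <= T,
      forall i, (i < si_size H)%N -> si_time H i <= si_time H i.+1,
      forall i, (i < si_size H)%N -> forall A : set R, measurable A ->
        F (si_time H i) (si_coef H i @^-1` A)
    & exists C : R, forall i w, (i < si_size H)%N -> `|si_coef H i w| <= C].

Definition si_eval (R : realType) (Omega : Type) (H : simple_integrand R Omega)
    (s : R) (w : Omega) : R :=
  \sum_(i < si_size H)
    si_coef H i w * \1_(`]si_time H i, si_time H i.+1]) s.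

Definition si_integral (R : realType) (Omega : Type)
    (B : R -> Omega -> R) (H : simple_integrand R Omega)
    (t : R) (w : Omega) : R :=
  \sum_(i < si_size H) si_coef H i w *
    (B (Num.min t (si_time H i.+1)) w - B (Num.min t (si_time H i)) w).

(* [I] is (a version with continuous paths of) t |-> int_0^t H_s dB_s: the limit
   in probability of the integrals of simple integrands Hk such that
   int_0^T (Hk - H)^2 ds tends to 0 in probability. *)
Definition is_ito_integral (R : realType) d (Omega : measurableType d)
    (P : probability Omega R) (T : R) (F : R -> set_system Omega)
    (B H I : R -> Omega -> R) : Prop :=
  [/\ progressive T F H,
      {ae P, forall w, (\int[leb]_(s in `[0%R, T]) (H s w ^+ 2)%:E < +oo)%E},
      adapted T F I,
      {ae P, forall w, {within `[0, T], continuous (I ^~ w)}}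
    & exists Hk : nat -> simple_integrand R Omega,
      [/\ forall k, si_valid T F (Hk k),
          forall e : R, 0 < e ->
            P [set w | (e%:E < \int[leb]_(s in `[0%R, T])
                          ((si_eval (Hk k) s w - H s w) ^+ 2)%:E)%E]
              @[k --> \oo] --> 0%E
        & forall t, 0 <= t <= T -> forall e : R, 0 < e ->
            P [set w | e < `|si_integral B (Hk k) t w - I t w|]
              @[k --> \oo] --> 0%E]].

(* dX = mu dt + sigma dB on [0, T] *)
Definition ito_process (R : realType) d (Omega : measurableType d)
    (P : probability Omega R) (T : R) (F : R -> set_system Omega)
    (B mu sigma X : R -> Omega -> R) : Prop :=
  adapted T F X /\
  exists2 I : R -> Omega -> R, is_ito_integral P T F B sigma I &
    {ae P, forall w, forall t, 0 <= t <= T ->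
      X t w = X 0 w + \int[leb]_(s in `[0, t]) mu s w + I t w}.

Definition sigma_generated (R : realType) (Omega I : Type) (D : set I)
    (Z : I -> Omega -> R) : set_system Omega :=
  <<s [set Z i @^-1` A | i in D & A in (measurable : set_system R)] >>.

Definition independent_systems (R : realType) d (Omega : measurableType d)
    (P : probability Omega R) (G1 G2 : set_system Omega) : Prop :=
  forall E1 E2, G1 E1 -> G2 E2 -> P (E1 `&` E2) = (P E1 * P E2)%E.

(* Mutual independence of V_0, ..., V_n; subfamilies are covered by taking some
   of the A_j equal to setT. *)
Definition mutually_independent (R : realType) d (Omega : measurableType d)
    (P : probability Omega R) (n : nat) (V : nat -> Omega -> R) : Prop :=
  forall A : nat -> set R, (forall j, measurable (A j)) ->
    P (\bigcap_(j in [set j | (j <= n)%N]) (V j @^-1` A j)) =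
    (\prod_(j < n.+1) P (V j @^-1` A j))%E.

Definition is_density (R : realType) (f : R -> R) : Prop :=
  [/\ measurable_fun setT f, forall x, 0 <= f x
    & (\int[leb]_x (f x)%:E = 1)%E].

Definition has_density (R : realType) d (Omega : measurableType d)
    (P : probability Omega R) (V : Omega -> R) (f : R -> R) : Prop :=
  forall A : set R, measurable A ->
    P (V @^-1` A) = (\int[leb]_(x in A) (f x)%:E)%E.

Definition cexpi (R : realType) (x : R) : R[i] :=
  Complex (cos x) (sin x).

(* int e^{isx} f(x) dx for a real function f, taken componentwise. *)
Definition fourier (R : realType) (f : R -> R) (s : R) : R[i] :=
  Complex (\int[leb]_x (complex.Re (cexpi (s * x)) * f x))
                  (\int[leb]_x (complex.Im (cexpi (s * x)) * f x)).

Definition asymp (R : realType) (a b : nat -> R) : Prop :=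
  exists c1 c2 : R, [/\ 0 < c1, 0 < c2 &
    forall n, (0 < n)%N -> c1 <= a n / b n <= c2].

Definition bigOp (R : realType) d (Omega : measurableType d)
    (P : probability Omega R) (Z : nat -> Omega -> R) (a : nat -> R) : Prop :=
  forall e : R, 0 < e -> exists2 M : R, 0 < M &
    \forall n \near \oo, (P [set w | (M * a n < `|Z n w|)%R] <= e%:E)%E.

Definition rate (R : realType) (n : nat) : R := n%:R `^ (- 4^-1).

(* Grid times and observations are indexed by nat; only the indices 0, ..., n
   are used. *)

Definition is_grid (R : realType) (T : R) (n : nat) (t : nat -> R) : Prop :=
  [/\ t 0%N = 0, t n = T & forall j, (j < n)%N -> t j < t j.+1].

Definition max_step (R : realType) (n : nat) (t : nat -> R) : R :=
  \big[Num.max/0]_(1 <= j < n.+1) (t j - t j.-1).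

(* The starting value t n = T of the minimum is harmless: no step exceeds it. *)
Definition min_step (R : realType) (n : nat) (t : nat -> R) : R :=
  \big[Num.min/t n]_(1 <= j < n.+1) (t j - t j.-1).

Definition neighbours (R : realType) (n : nat) (t : nat -> R) (xi : R)
    (j : 'I_n.+1) : {set 'I_n.+1} :=
  [set l : 'I_n.+1 | (`|t l - t j| <= xi) && (l != j)]%SET.

Definition max_nb (R : realType) (n : nat) (t : nat -> R) (xi : R) : nat :=
  \max_(j < n.+1) #|neighbours t xi j|.

(* The starting value n is harmless: each grid point has at most n neighbours. *)
Definition min_nb (R : realType) (n : nat) (t : nat -> R) (xi : R) : nat :=
  \big[minn/n]_(j < n.+1) #|neighbours t xi j|.

Definition total_nb (R : realType) (n : nat) (t : nat -> R) (xi : R) : nat :=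
  \sum_(j < n.+1) #|neighbours t xi j|.

(* Estimates |f_U^Ft(s)|^2, the characteristic function of the difference of two
   independent errors. *)
Definition f_hat (R : realType) (n : nat) (t Y : nat -> R) (xi s : R) : R :=
  `| (total_nb n t xi)%:R^-1 *
     \sum_(j < n.+1) \sum_(l in neighbours t xi j) cos (s * (Y l - Y j)) |.

Definition phi_hat (R : realType) (n : nat) (Y : nat -> R) (K : nat) (s : R) :
    R[i] :=
  K%:R^-1 * \sum_(K <= l < n.+1) cexpi (s * (Y l - Y (l - K)%N)).

Definition nscales (R : realType) (n : nat) : nat :=
  Num.truncn (Num.sqrt (n.+1%:R : R)).

Definition scale (m : nat) : nat := m.

(* For N >= 2 the weights a_m satisfy sum_m a_m = 1 and sum_m a_m / K_m = 0; for
   N = 1 (that is, n <= 2) the denominator vanishes and a_1 is the junk value 0. *)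
Definition weight (R : realType) (n m : nat) : R :=
  let N : R := (nscales R n)%:R in
  12 * (scale m)%:R * (m%:R - N / 2 - 1 / 2) / (N * (N ^+ 2 - 1)).

Definition zeta (R : realType) (n : nat) : R :=
  (scale 1)%:R * (scale 2)%:R / (n.+1%:R * ((scale 2)%:R - (scale 1)%:R)).

Definition G (R : realType) (n : nat) (Y : nat -> R) (s : R) :
    R[i] :=
  \sum_(1 <= m < (nscales R n).+1)
     Complex (weight R n m) 0 * phi_hat n Y (scale m) s
  + Complex (zeta R n) 0 *
     (phi_hat n Y (scale 1) s - phi_hat n Y (scale 2) s).

(* Least squares slope of the regression of y on x without intercept. *)
Definition least_squares (R : realType) (m : nat) (x y : 'I_m -> R) : R :=
  (\sum_j x j * y j) / \sum_j x j ^+ 2.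

Definition beta_hat (R : realType) (n : nat) (t Y : nat -> R) (xi : R)
    (m : nat) (s : 'I_m -> R) : R :=
  least_squares (fun j => - (s j ^+ 2 / 2) * f_hat n t Y xi (s j))
                (fun j => complex.Re (G n Y (s j))).

(* Main.v *)
(* Outside an event of small probability the price X differs from an Ito
   integral J with bounded integrand by terms of order dt, so that
   second and fourth moments of increments of J are available.

   With beta_m = a_m / m, corrected by zeta for m = 1, 2, the real part of G(s) is
   the sum of beta_m cos(s (Y_l - Y_(l-m))) over all lags m <= N and all l. The
   beta_m are O(N^-2), the total weight of all pairs (m, l) vanishes, and
   sum m beta_m = 1. Expanding cos(s (dX + dU)) and writing theta = (E cos(s U))^2,
   the terms are
   - theta (cos(s dX) - 1), which is - theta s^2 dX^2 / 2 up to O(dX^4). The weighted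
     sum of the dX^2 is a quadratic form in the elementary increments whose
     diagonal coefficients equal sum m beta_m = 1 except for O(N) indices at the edges,
     whence the integrated volatility up to martingale terms;
   - a form in the errors alone, where vanishing total weight removes the mean and
     orthogonality of products of independent centred variables bounds the variance;
   - products of functions of dX and centred functions of U, bounded conditionally on X.
   All remainders are O_p(n^(-1/4)) since N is of order n^(1/2). The same expansion
   over neighbouring pairs, where E dX^2 = O(xi) = O(n^(-1/4)), shows that the estimate
   of theta has an error O_p(n^(-1/4)), and the least squares quotient is then a
   perturbation of the integrated volatility itself. *)
Require Import Defs.
From mathcomp Require Import all_boot all_order all_algebra.
From mathcomp Require Import all_classical all_reals all_analysis
  measurable_realfun.
From mathcomp Require Import complex.
From mathcomp Require Import ring lra zify.
Import Order.TTheory GRing.Theory Num.Theory.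
Import numFieldNormedType.Exports.
Local Open Scope classical_set_scope.
Local Open Scope ring_scope.

Set Implicit Arguments.
Unset Strict Implicit.
Unset Printing Implicit Defensive.
Import HBNNSimple.

(** * Expectation and independence *)

(** Two obstacles shape the argument. The definition of the Ito integral provides simple integrands
    close to [sigma] in energy, but without a common bound. Clipping them at a level [C] that bounds
    [sigma] on a large event gives a bounded integrand; the discarded part has small energy, hence a
    small integral by a Lenglart inequality. Since [C] depends only on the probability given up,
    while the simple integrand may vary with [n], all moments are those of finite sums of Gaussian
    increments with bounded coefficients.

    Conditional expectations do not occur. A martingale identity is tested against every weight
    known at the initial time, and a variance given the price is controlled after multiplication by
    the indicator that it is at most [M].

    Orders are counted in powers of r = n^(-1/4): the mesh is r^4, N is r^(-2), there are about
    r^(-6) pairs with weights O(r^4), and an increment over a lag is of order r. The role of [zeta]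
    is to make the sum of the beta_m equal to 1/(n+1) instead of 0: lag m has only n+1-m pairs, and
    the total weight becomes (n+1)/(n+1) - 1 = 0. *)

Lemma integral_density_comp (R : realType) d1 d2 (T1 : measurableType d1)
    (T2 : measurableType d2) (mu : {measure set T1 -> \bar R})
    (nu : {measure set T2 -> \bar R}) (V : T1 -> T2) (W : T1 -> R) :
  measurable_fun setT V -> measurable_fun setT W -> (forall x, 0 <= W x) ->
  (forall A, measurable A ->
     nu A = (\int[mu]_(x in V @^-1` A) (W x)%:E)%E) ->
  forall g : T2 -> \bar R, (forall y, 0 <= g y)%E -> measurable_fun setT g ->
  (\int[nu]_y g y = \int[mu]_x (g (V x) * (W x)%:E))%E.
Proof.
move=> mV mW W0 nuE g g0 mg.
(* Monotone approximation on both sides reduces the identity to simple functions, and linearity to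
   the indicators of the hypothesis on [nu]. *)
pose h := nnsfun_approx measurableT mg.
have gE y : g y = lim ((h n y)%:E @[n --> \oo]).
  by apply/esym/cvg_lim => //; exact: cvg_nnsfun_approx.
have -> : (\int[nu]_y g y = lim (\int[nu]_y (h n y)%:E @[n --> \oo]))%E.
  under eq_integral do rewrite gE.
  apply: monotone_convergence => //.
  - by move=> n; apply/measurable_EFinP.
  - by move=> n x _; rewrite lee_fin.
  - by move=> x _ m n mn; rewrite lee_fin; exact/lefP/nd_nnsfun_approx.
have -> : (\int[mu]_x (g (V x) * (W x)%:E) =
    lim (\int[mu]_x ((h n (V x))%:E * (W x)%:E) @[n --> \oo]))%E.
  have gWE x : (g (V x) * (W x)%:E =
      lim ((h n (V x))%:E * (W x)%:E @[n --> \oo]))%E.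
    apply/esym/cvg_lim => //; apply: cvgeZr => //.
    exact: cvg_nnsfun_approx.
  under eq_integral do rewrite gWE.
  apply: monotone_convergence => //.
  - move=> n; apply: emeasurable_funM; apply/measurable_EFinP => //.
    exact: measurableT_comp.
  - by move=> n x _; rewrite mule_ge0// lee_fin.
  - move=> x _ m n mn; rewrite lee_wpmul2r ?lee_fin//.
    exact/lefP/nd_nnsfun_approx.
suff hE n : (\int[nu]_y (h n y)%:E =
    \int[mu]_x ((h n (V x))%:E * (W x)%:E))%E.
  by under eq_fun do rewrite hE.
transitivity (\int[nu]_y
   (\sum_(r \in range (h n)) (r * \1_(h n @^-1` [set r]) y)%:E))%E.
  by apply: eq_integral => t tE; rewrite /= fimfunE -fsumEFin.
rewrite ge0_integral_fsum//; last 2 first.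
  - by move=> r; apply/measurable_EFinP; exact: measurable_funM.
  - by move=> r y _; exact: nnfun_muleindic_ge0.
transitivity (\int[mu]_x (\sum_(r \in range (h n))
    (r * \1_(h n @^-1` [set r]) (V x))%:E * (W x)%:E))%E; last first.
  apply: eq_integral => x _.
  rewrite -ge0_mule_fsuml => [|y]; last exact: nnfun_muleindic_ge0.
  by rewrite fsumEFin // -(fimfunE _ (V x)).
rewrite ge0_integral_fsum//; last 2 first.
  - move=> r; apply: emeasurable_funM; apply/measurable_EFinP => //.
    apply: measurable_funM => //.
    have : measurable (V @^-1` (h n @^-1` [set r])).
      by rewrite -[X in measurable X]setTI; apply: mV => //.
    by move/(@measurable_indic _ _ R setT).
  - by move=> r y _; apply: mule_ge0; [rewrite EFinM; exact: nnfun_muleindic_ge0|rewrite lee_fin].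
apply: eq_fsbigr => r; rewrite inE => -[y _ <-].
set A := _ @^-1` _.
have mA : measurable A by exact: measurable_funPTI.
have mVA : measurable (V @^-1` A) by rewrite -[X in measurable X]setTI; exact: mV.
have hy0 : 0 <= h n y by [].
have -> : (\int[nu]_x (h n y * \1_A x)%:E = (h n y)%:E * nu A)%E.
  under eq_integral do rewrite EFinM.
  rewrite ge0_integralZl//; last by apply/measurable_EFinP.
  by rewrite integral_indic// setIT.
under eq_integral do rewrite EFinM -muleA.
rewrite ge0_integralZl//; last 2 first.
- apply: emeasurable_funM; apply/measurable_EFinP => //.
  exact: (@measurable_indic _ _ R setT _ mVA).
- by move=> x _; rewrite mule_ge0 ?lee_fin.
rewrite nuE// integral_mkcond; congr (_ * _)%E.
apply: eq_integral => x _; rewrite patchE indicE.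
have -> : (V x \in A) = (x \in V @^-1` A) by [].
by case: ifPn => _; rewrite ?mul1e ?mul0e.
Qed.

Section expectation.
Context (R : realType) d (Omega : measurableType d) (P : probability Omega R).
Implicit Types (f g : Omega -> R) (A : set Omega).

Definition itg f := P.-integrable setT (EFin \o f).
(** Real-valued, so that moment bounds are plain inequalities in [R]. A function that is not
    integrable only gets a default value, which is why the moment lemmas carry an [itg] clause. *)
Definition Ex f : R := \int[P]_w f w.

Lemma itg_meas f : itg f -> measurable_fun setT f.
Proof. by move/measurable_int/measurable_EFinP. Qed.

Lemma ExE f : itg f -> (Ex f)%:E = (\int[P]_w (f w)%:E)%E.
Proof. by move=> fi; rewrite /Ex /Rintegral fineK// integrable_fin_num. Qed.

Lemma itg_le g f : measurable_fun setT f -> itg g ->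
  (forall w, `|f w| <= g w) -> itg f.
Proof.
move=> mf gi fg; apply: le_integrable gi => //; first exact/measurable_EFinP.
by move=> w _ /=; rewrite lee_fin (le_trans (fg w))// ler_norm.
Qed.

Lemma itg_cst (c : R) : itg (fun=> c).
Proof.
by apply/(@finite_measure_integrable_cst _ _ _ P setT c).
Qed.

Lemma itg_bounded (C : R) f : measurable_fun setT f ->
  (forall w, `|f w| <= C) -> itg f.
Proof. by move=> mf fC; apply: itg_le fC => //; exact: itg_cst. Qed.

Lemma itgD f g : itg f -> itg g -> itg (fun w => f w + g w).
Proof. by move=> fi gi; exact: (integrableD measurableT fi gi). Qed.

Lemma itgZ (c : R) f : itg f -> itg (fun w => c * f w).
Proof. by move=> fi; exact: (integrableZl measurableT c fi). Qed.

Lemma itgB f g : itg f -> itg g -> itg (fun w => f w - g w).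
Proof. by move=> fi gi; exact: (integrableB measurableT fi gi). Qed.

Lemma itg_sum I (r : seq I) (Q : pred I) (F : I -> Omega -> R) :
  (forall i, itg (F i)) -> itg (fun w => \sum_(i <- r | Q i) F i w).
Proof.
move=> Fi; elim: r => [|i r ih].
  by under eq_fun do rewrite big_nil; exact: itg_cst.
under eq_fun do rewrite big_cons.
by case: (Q i) => //; apply: itgD.
Qed.

Lemma itg_abs f : itg f -> itg (fun w => `|f w|).
Proof. by move=> fi; exact: (integrable_norm fi). Qed.

Lemma itg_mulb (C : R) f g : itg f -> measurable_fun setT g ->
  (forall w, `|g w| <= C) -> itg (fun w => f w * g w).
Proof.
move=> fi mg gC; apply: (@itg_le (fun w => C * `|f w|)).
- by apply: measurable_funM => //; exact: itg_meas.
- by apply: itgZ; exact: itg_abs.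
- by move=> w; rewrite normrM mulrC ler_wpM2r.
Qed.

Lemma itg_mul_sq f g : measurable_fun setT f -> measurable_fun setT g ->
  itg (fun w => f w ^+ 2) -> itg (fun w => g w ^+ 2) -> itg (fun w => f w * g w).
Proof.
move=> mf mg fi gi; apply: (itg_le _ (itgD fi gi)).
  exact: measurable_funM.
move=> w; rewrite normrM -[f w ^+ 2]real_normK ?num_real//.
rewrite -[g w ^+ 2]real_normK ?num_real//.
have := sqr_ge0 (`|f w| - `|g w|); have := normr_ge0 (f w).
by have := normr_ge0 (g w); nra.
Qed.

Lemma ExD f g : itg f -> itg g -> Ex (fun w => f w + g w) = Ex f + Ex g.
Proof. by move=> fi gi; rewrite /Ex RintegralD. Qed.

Lemma ExB f g : itg f -> itg g -> Ex (fun w => f w - g w) = Ex f - Ex g.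
Proof. by move=> fi gi; rewrite /Ex RintegralB. Qed.

Lemma ExZ (c : R) f : itg f -> Ex (fun w => c * f w) = c * Ex f.
Proof. by move=> fi; rewrite /Ex RintegralZl. Qed.

Lemma Ex_cst (c : R) : Ex (fun=> c) = c.
Proof. by rewrite /Ex Rintegral_cst//= (@probability_setT _ _ _ P)/= mulr1. Qed.

Lemma Ex_sum I (r : seq I) (Q : pred I) (F : I -> Omega -> R) :
  (forall i, itg (F i)) ->
  Ex (fun w => \sum_(i <- r | Q i) F i w) = \sum_(i <- r | Q i) Ex (F i).
Proof.
move=> Fi; elim: r => [|i r ih].
  by under eq_fun do rewrite big_nil; rewrite big_nil Ex_cst.
under eq_fun do rewrite big_cons; rewrite big_cons.
by case: (Q i) => //; rewrite ExD ?ih//; exact: itg_sum.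
Qed.

Lemma Ex_le f g : itg f -> itg g -> (forall w, f w <= g w) -> Ex f <= Ex g.
Proof. by move=> fi gi fg; exact: le_Rintegral. Qed.

Lemma Ex_ge0 f : (forall w, 0 <= f w) -> 0 <= Ex f.
Proof. by move=> f0; apply: Rintegral_ge0. Qed.

Lemma Ex_indic A : measurable A -> Ex \1_A = fine (P A).
Proof. by move=> mA; rewrite /Ex /Rintegral integral_indic// setIT. Qed.

Lemma itg_indic A : measurable A -> itg \1_A.
Proof.
move=> mA; apply: (@itg_bounded 1); first exact: measurable_indic.
by move=> w; rewrite indicE; case: (w \in A); rewrite ?normr1 ?normr0.
Qed.

Lemma eq_Ex f g : f =1 g -> Ex f = Ex g.
Proof. by move=> /funext ->. Qed.

Lemma eq_itg f g : f =1 g -> itg f -> itg g.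
Proof. by move=> /funext ->. Qed.

(* A set that may fail to be measurable has no meaningful probability, so that
   smallness is expressed through a measurable superset. *)
Definition Pout A (e : R) := exists B, [/\ measurable B, A `<=` B & (P B <= e%:E)%E].

Lemma Pout_sub A B (e : R) : B `<=` A -> Pout A e -> Pout B e.
Proof. by move=> BA [C [mC sAC PC]]; exists C; split => //; exact: subset_trans sAC. Qed.

Lemma Pout_le A (e e' : R) : e <= e' -> Pout A e -> Pout A e'.
Proof. by move=> ee' [C [mC sAC PC]]; exists C; split => //; apply: (le_trans PC); rewrite lee_fin. Qed.

Lemma PoutU A B (e e' : R) : Pout A e -> Pout B e' -> Pout (A `|` B) (e + e').
Proof.
move=> [C [mC sAC PC]] [D [mD sBD PD]]; exists (C `|` D); split.
- exact: measurableU.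
- exact: setUSS.
- by apply: (le_trans (measureU2 _ _ _)) => //; rewrite EFinD leeD.
Qed.

Lemma Pout_bigU (I : finType) (A : I -> set Omega) (e : I -> R) :
  (forall i, Pout (A i) (e i)) -> Pout [set w | exists i, A i w] (\sum_i e i).
Proof.
move=> Ae.
suff H (r : seq I) : Pout [set w | exists2 i, i \in r & A i w] (\sum_(i <- r) e i).
  apply: Pout_sub (H (index_enum I)) => w [i Aiw].
  by exists i => //; rewrite mem_index_enum.
elim: r => [|i r ih].
  by rewrite big_nil; exists set0; split; [| move=> w [] | rewrite measure0].
rewrite big_cons; apply: Pout_sub (PoutU (Ae i) ih) => w [j].
by rewrite inE => /predU1P[-> ?|jr ?]; [left|right; exists j].
Qed.

Lemma Pout_meas A (e : R) : measurable A -> Pout A e -> (P A <= e%:E)%E.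
Proof.
move=> mA [B [mB sAB PB]]; apply: le_trans PB.
by apply: le_measure => //; rewrite inE.
Qed.

Lemma ae_Pout (Q : set Omega) : {ae P, forall w, Q w} -> Pout (~` Q) 0.
Proof. by move=> [B [mB PB0 QB]]; exists B; split => //; rewrite PB0. Qed.

Lemma Pout_markov f (M c : R) : itg f -> (forall w, 0 <= f w) -> Ex f <= c -> 0 < M ->
  Pout [set w | M < f w] (c / M).
Proof.
move=> fi f0 fc M0; exists [set w | M < f w]; split => //.
  by rewrite -[X in measurable X]setTI; apply: measurable_fun_ltr => //; exact: itg_meas.
set A := [set w | _].
have mA : measurable A.
  by rewrite -[X in measurable X]setTI; apply: measurable_fun_ltr => //; exact: itg_meas.
rewrite -[P A]fineK ?fin_num_measure// lee_fin -Ex_indic// ler_pdivlMr// mulrC.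
apply: le_trans fc; rewrite -ExZ; last exact: itg_indic.
apply: Ex_le => //; first by apply: itgZ; exact: itg_indic.
move=> w; rewrite indicE; case: (boolP (w \in A)) => [|_]; last by rewrite mulr0.
by rewrite inE /A/= mulr1 => /ltW.
Qed.

Implicit Types (W V : Omega -> R).

(** Weaker than independence: only the mean of [W] has to ignore the events of [V]. This is what an
    induction on the factors of a product delivers, and it already implies that E(WV) = E(W)
    E(V). *)
Definition uncorrelated_with_events W V := forall A : set R, measurable A ->
  Ex (fun w => W w * \1_A (V w)) = Ex W * Ex (fun w => \1_A (V w)).

Lemma measurable_indic_comp V (A : set R) : measurable_fun setT V -> measurable A ->
  measurable_fun setT (fun w => \1_A (V w) : R).
Proof. by move=> mV mA; apply: measurableT_comp mV; exact: measurable_indic. Qed.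

Lemma indic_norm_le1 T (A : set T) x : `|\1_A x : R| <= 1.
Proof. by rewrite indicE; case: (x \in A); rewrite ?normr1 ?normr0. Qed.

Lemma itg_indic_comp V (A : set R) : measurable_fun setT V -> measurable A ->
  itg (fun w => \1_A (V w)).
Proof.
move=> mV mA; apply: (@itg_bounded 1); first exact: measurable_indic_comp.
by move=> w; exact: indic_norm_le1.
Qed.

Lemma uncorrelated_comp W V (g : R -> R) : measurable_fun setT g ->
  uncorrelated_with_events W V -> uncorrelated_with_events W (g \o V).
Proof.
move=> mg uWV A mA; have := uWV (g @^-1` A); apply.
by rewrite -[X in measurable X]setTI; exact: mg.
Qed.

(** The measure sending [A] to the integral of [W] over the event that [V] lies in [A] is, by
    hypothesis, E(W) times the law of [V]. Integrating |y| against it in both descriptions gives the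
    product rule, and integrability of the product at the same time. *)
Lemma uncorrelated_ge0 W V : itg W -> itg V ->
    (forall w, 0 <= W w) -> (forall w, 0 <= V w) -> uncorrelated_with_events W V ->
  itg (fun w => W w * V w) /\ Ex (fun w => W w * V w) = Ex W * Ex V.
Proof.
move=> Wi Vi W0 V0 uWV.
have mV := itg_meas Vi; have mW := itg_meas Wi.
pose k : {nonneg R} := NngNum (Ex_ge0 W0).
have nuE (A : set R) : measurable A ->
    mscale k (pushforward P V) A = (\int[P]_(x in V @^-1` A) (W x)%:E)%E.
  move=> mA; rewrite /mscale /= /pushforward integral_mkcond.
  have mVA : measurable (V @^-1` A) by rewrite -[X in measurable X]setTI; exact: mV.
  rewrite -[P _]fineK ?fin_num_measure// -Ex_indic// -EFinM -(uWV A)//.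
  rewrite ExE; last by apply: (@itg_mulb 1) => //; [exact: measurable_indic_comp|
    move=> w; exact: indic_norm_le1].
  apply: eq_integral => x _; rewrite patchE indicE.
  have -> : (V x \in A) = (x \in V @^-1` A) by [].
  by case: ifP => _; rewrite ?mulr1 ?mulr0.
have := integral_density_comp mV mW W0 (nuE mV) (g := fun y => `|y|%:E).
have m1 : measurable_fun [set: R] (fun y : R => `|y|%:E).
  by apply/measurable_EFinP; exact: normr_measurable.
have p1 (y : R) : (0 <= `|y|%:E)%E by rewrite lee_fin.
move=> /(_ p1 m1).
rewrite ge0_integral_mscale//.
rewrite ge0_integral_pushforward//=.
rewrite preimage_setT.
under eq_integral do rewrite ger0_norm//.
rewrite -ExE// -EFinM.
under eq_integral => w _ do rewrite ger0_norm// -EFinM mulrC.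
move=> e.
have i : itg (fun w => W w * V w).
  apply/integrableP; split; first by apply/measurable_EFinP; exact: measurable_funM.
  under eq_integral do rewrite /= ger0_norm ?mulr_ge0//.
  by rewrite -e ltry.
by split => //; apply: EFin_inj; rewrite e ExE.
Qed.

Lemma Ex_posneg V : itg V -> 
  [/\ itg (fun w => Num.max (V w) 0), itg (fun w => Num.max (- V w) 0) &
  Ex V = Ex (fun w => Num.max (V w) 0) - Ex (fun w => Num.max (- V w) 0)].
Proof.
move=> Vi.
have i1 : itg (fun w => Num.max (V w) 0).
  apply: itg_le (itg_abs Vi) _.
    by apply: measurable_maxr => //; exact: itg_meas.
  by move=> w; rewrite ger0_norm ?le_max ?lexx ?orbT// ge_max ler_norm normr_ge0.
have i2 : itg (fun w => Num.max (- V w) 0).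
  apply: itg_le (itg_abs Vi) _.
    apply: measurable_maxr => //; apply: measurableT_comp => //; exact: itg_meas.
  by move=> w; rewrite ger0_norm ?le_max ?lexx ?orbT// ge_max normr_ge0 -normrN ler_norm.
split => //; rewrite -ExB//; apply: eq_Ex => w.
by case: (lerP 0 (V w)) => h; [rewrite [Num.max (- _) _]max_r ?subr0 ?oppr_le0|
  rewrite [Num.max (- _) _]max_l ?oppr_ge0 1?ltW// sub0r opprK].
Qed.

Lemma uncorrelated_itg_ge0 W V : itg W -> itg V -> (forall w, 0 <= W w) ->
  uncorrelated_with_events W V ->
  itg (fun w => W w * V w) /\ Ex (fun w => W w * V w) = Ex W * Ex V.
Proof.
move=> Wi Vi W0 uWV; have [Vpi Vni VE] := Ex_posneg Vi.
have mp : measurable_fun setT (fun x : R => Num.max x 0) by exact: measurable_maxr.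
have mn : measurable_fun setT (fun x : R => Num.max (- x) 0).
  by apply: measurable_maxr => //; exact: oppr_measurable.
have ge0max (x : R) : 0 <= Num.max x 0 by rewrite le_max lexx orbT.
have [ip ep] := uncorrelated_ge0 Wi Vpi W0 (fun w => ge0max _) (uncorrelated_comp mp uWV).
have [im em] := uncorrelated_ge0 Wi Vni W0 (fun w => ge0max _) (uncorrelated_comp mn uWV).
have E w : W w * V w = W w * Num.max (V w) 0 - W w * Num.max (- V w) 0.
  rewrite -mulrBr; congr (_ * _); case: (lerP 0 (V w)) => h.
    by rewrite max_r ?subr0 ?oppr_le0.
  by rewrite max_l ?oppr_ge0 1?ltW// sub0r opprK.
split; first by under eq_fun do rewrite E; exact: itgB.
by under eq_Ex do rewrite E; rewrite ExB// ep em VE mulrBr.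
Qed.

(** Adding [C] makes [W] nonnegative, and the hypothesis is stable under the addition of
    constants. *)
Lemma uncorrelated_bounded (C : R) W V : measurable_fun setT W -> (forall w, `|W w| <= C) ->
  itg V -> uncorrelated_with_events W V -> Ex (fun w => W w * V w) = Ex W * Ex V.
Proof.
move=> mW WC Vi uWV.
have Wi : itg W by exact: itg_bounded WC.
have W0 w : 0 <= W w + C by have := WC w; rewrite ler_norml => /andP[]; lra.
have WCi : itg (fun w => W w + C) by apply: itgD => //; exact: itg_cst.
have WVi : itg (fun w => W w * V w).
  by under eq_fun do rewrite mulrC; apply: (itg_mulb (C := C)).
have := uncorrelated_itg_ge0 WCi Vi W0.
have -> : (fun w => (W w + C) * V w) = (fun w => W w * V w + C * V w).
  by apply/funext => w; rewrite mulrDl.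
rewrite ExD ?ExD//; last 2 first.
- exact: itgZ.
- exact: itg_cst.
rewrite ExZ// Ex_cst mulrDl => H; apply: (addIr (C * Ex V)).
suff /H[] : uncorrelated_with_events (fun w => W w + C) V by [].
move=> A mA.
have iA := itg_indic_comp (itg_meas Vi) mA.
rewrite [in RHS]ExD//; last exact: itg_cst.
under eq_fun do rewrite mulrDl.
rewrite ExD; last 2 first.
- by under eq_fun do rewrite mulrC; apply: (itg_mulb (C := C)).
- exact: itgZ.
by rewrite ExZ// uWV// Ex_cst mulrDl.
Qed.

Definition indep2 W V := forall A B : set R, measurable A -> measurable B ->
  P (W @^-1` A `&` V @^-1` B) = (P (W @^-1` A) * P (V @^-1` B))%E.

(** The product rule is applied with exchanged roles: the nonnegative factor is the indicator of an
    event of [V], and the events are those of [W]. *)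
Lemma indep2_uncorrelated W V : measurable_fun setT V -> itg W -> indep2 W V ->
  uncorrelated_with_events W V.
Proof.
move=> mV Wi iWV A mA.
have mW := itg_meas Wi.
under eq_Ex do rewrite mulrC; rewrite mulrC.
apply: (uncorrelated_itg_ge0 _ Wi _ _).2 => //.
- exact: itg_indic_comp.
- move=> B mB.
  have mVA : measurable (V @^-1` A) by rewrite -[X in measurable X]setTI; exact: mV.
  have mWB : measurable (W @^-1` B) by rewrite -[X in measurable X]setTI; exact: mW.
  have -> : (fun w => \1_A (V w) * \1_B (W w)) = \1_(W @^-1` B `&` V @^-1` A) :> (Omega -> R).
    by apply/funext => w; rewrite setIC indicI.
  rewrite (_ : (fun w => \1_A (V w)) = \1_(V @^-1` A) :> (Omega -> R))//.
  rewrite (_ : (fun w => \1_B (W w)) = \1_(W @^-1` B) :> (Omega -> R))//.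
  rewrite !Ex_indic//; last exact: measurableI.
  by rewrite iWV// fineM ?fin_num_measure// mulrC.
Qed.

Lemma indep2_comp W V (f g : R -> R) : measurable_fun setT f -> measurable_fun setT g ->
  indep2 W V -> indep2 (f \o W) (g \o V).
Proof.
move=> mf mg iWV A B mA mB; apply: (iWV (f @^-1` A) (g @^-1` B)).
  by rewrite -[X in measurable X]setTI; exact: mf.
by rewrite -[X in measurable X]setTI; exact: mg.
Qed.

Lemma indep2_Ex W V : itg W -> itg V -> indep2 W V ->
  itg (fun w => W w * V w) /\ Ex (fun w => W w * V w) = Ex W * Ex V.
Proof.
move=> Wi Vi iWV; have [Wpi Wni WE] := Ex_posneg Wi.
have mp : measurable_fun setT (fun x : R => Num.max x 0) by exact: measurable_maxr.
have mn : measurable_fun setT (fun x : R => Num.max (- x) 0).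
  by apply: measurable_maxr => //; exact: oppr_measurable.
have ge0max (x : R) : 0 <= Num.max x 0 by rewrite le_max lexx orbT.
have mi : measurable_fun setT (@idfun R) by exact: measurable_id.
have up : uncorrelated_with_events (fun w => Num.max (W w) 0) V.
  by apply: indep2_uncorrelated; [exact: itg_meas|by []|exact: (indep2_comp mp mi iWV)].
have un : uncorrelated_with_events (fun w => Num.max (- W w) 0) V.
  by apply: indep2_uncorrelated; [exact: itg_meas|by []|exact: (indep2_comp mn mi iWV)].
have [ip ep] := uncorrelated_itg_ge0 Wpi Vi (fun w => ge0max _) up.
have [im em] := uncorrelated_itg_ge0 Wni Vi (fun w => ge0max _) un.
have E w : W w * V w = Num.max (W w) 0 * V w - Num.max (- W w) 0 * V w.
  rewrite -mulrBl; congr (_ * _); case: (lerP 0 (W w)) => h.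
    by rewrite max_r ?subr0 ?oppr_le0.
  by rewrite max_l ?oppr_ge0 1?ltW// sub0r opprK.
split; first by under eq_fun do rewrite E; exact: itgB.
by under eq_Ex do rewrite E; rewrite ExB// ep em WE mulrBl.
Qed.

Definition bounded_measurable (g : R -> R) :=
  measurable_fun setT g /\ exists C, forall x, `|g x| <= C.

Lemma bounded_measurable_cst (c : R) : bounded_measurable (fun=> c).
Proof. by split => //; exists `|c|. Qed.

Lemma bounded_measurable_indic (A : set R) : measurable A -> bounded_measurable \1_A.
Proof.
move=> mA; split; first exact: measurable_indic.
by exists 1 => x; exact: indic_norm_le1.
Qed.

Lemma bounded_measurableM (f g : R -> R) :
  bounded_measurable f -> bounded_measurable g -> bounded_measurable (fun x => f x * g x).
Proof.
move=> [mf [C fC]] [mg [D gD]]; split; first exact: measurable_funM.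
by exists (C * D) => x; rewrite normrM ler_pM.
Qed.

Lemma itg_bounded_comp V (g : R -> R) : measurable_fun setT V -> bounded_measurable g ->
  itg (fun w => g (V w)).
Proof.
move=> mV [mg [C gC]]; apply: (@itg_bounded C) => //.
exact: measurableT_comp mg mV.
Qed.

Lemma bounded_prod (I : finType) (Q : pred I) (F : I -> Omega -> R) :
  (forall i, measurable_fun setT (F i)) -> (forall i, exists C, forall w, `|F i w| <= C) ->
  measurable_fun setT (fun w => \prod_(i | Q i) F i w) /\
  exists C, forall w, `|\prod_(i | Q i) F i w| <= C.
Proof.
move=> mF bF; elim: (index_enum I) => [|i r [mr [C rC]]].
  under eq_fun do rewrite big_nil; split => //.
  by exists 1 => w; rewrite big_nil normr1.
under eq_fun do rewrite big_cons; case: (boolP (Q i)) => Qi; last first.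
  by split => //; exists C => w; rewrite big_cons (negbTE Qi).
split; first by apply: measurable_funM.
have [D FD] := bF i; exists (D * C) => w.
by rewrite big_cons Qi normrM ler_pM.
Qed.

(** Independence is given for events only; the indicators are replaced by the functions [g j] one
    factor at a time. *)
Lemma Ex_prod_independent (n : nat) (U : nat -> Omega -> R) (g : nat -> R -> R) :
  (forall j, measurable_fun setT (U j)) -> mutually_independent P n U ->
  (forall j, bounded_measurable (g j)) ->
  Ex (fun w => \prod_(j < n.+1) g j (U j w)) = \prod_(j < n.+1) Ex (fun w => g j (U j w)).
Proof.
move=> mU iU bg.
(* The first [k] factors are already functions, the others still indicators; [k = 0] is the
   definition of independence, [k = n.+1] the claim. *)
pose f (A : nat -> set R) k j := if (j < k)%N then g j else \1_(A j) : R -> R.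
have bf (A : nat -> set R) k j : (forall j, measurable (A j)) -> bounded_measurable (f A k j).
  by rewrite /f => mA; case: ifP => // _; exact: bounded_measurable_indic.
suff H k (A : nat -> set R) : (k <= n.+1)%N -> (forall j, measurable (A j)) ->
    Ex (fun w => \prod_(j < n.+1) f A k j (U j w)) =
    \prod_(j < n.+1) Ex (fun w => f A k j (U j w)).
  have := H n.+1 (fun=> setT) (leqnn _) (fun=> measurableT).
  rewrite (eq_Ex (g := fun w => \prod_(j < n.+1) g j (U j w))); last first.
    by move=> w; apply: eq_bigr => j _; rewrite /f ltn_ord.
  by move=> ->; apply: eq_bigr => j _; rewrite /f ltn_ord.
elim: k A => [|k ih] A kn mA.
  rewrite /f /=.
  have mUA j : measurable (U j @^-1` A j).
    by rewrite -[X in measurable X]setTI; exact: mU.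
  have indE (B : set R) (V : Omega -> R) : (fun w => \1_B (V w)) = \1_(V @^-1` B) :> (Omega -> R) by [].
  under [RHS]eq_bigr => j _ do rewrite indE Ex_indic//.
  have -> : (fun w => \prod_(j < n.+1) \1_(A j) (U j w)) =
      \1_(\bigcap_(j in [set j | (j <= n)%N]) (U j @^-1` A j)) :> (Omega -> R).
    apply/funext => w; rewrite indicE; case: (boolP (w \in _)) => /=.
      rewrite inE => wA; apply: big1 => j _; rewrite indicE mem_set//.
      by apply: (wA j) => /=; rewrite -ltnS.
    move=> wA; apply/eqP; rewrite prodf_seq_eq0; apply: contraNT wA => /hasPn wA.
    rewrite inE => j /= jn; have := wA (inord j) (mem_index_enum _).
    by rewrite inordK ?ltnS// indicE; case: (boolP (U j w \in A j)); rewrite ?eqxx// inE.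
  rewrite Ex_indic; last by apply: bigcap_measurableType => j _.
  have := iU A mA => ->.
  apply: EFin_inj; rewrite (big_morph EFin EFinM erefl) fineK.
    by apply: eq_bigr => j _; rewrite fineK ?fin_num_measure.
  by apply: prode_fin_num => j _; rewrite fin_num_measure.
pose o : 'I_n.+1 := Ordinal kn.
have foE B j : j != o -> f (fun i => if i == k then B else A i) k j = f A k.+1 j.
  rewrite -val_eqE/= /f ltnS [(j <= k)%N]leq_eqVlt => /negbTE jk.
  by rewrite jk/=.
have foo B : f (fun i => if i == k then B else A i) k o = \1_B.
  by rewrite /f/= ltnn eqxx.
have fo : f A k.+1 o = g k by rewrite /f/= ltnSn.
pose W w := \prod_(j < n.+1 | j != o) f A k.+1 j (U j w).
have [mW [C WC]] : measurable_fun setT W /\ exists C, forall w, `|W w| <= C.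
  apply: bounded_prod => i; have [mf [C fC]] := bf A k.+1 i mA.
    exact: measurableT_comp mf (mU i).
  by exists C => w.
(* Since [A] is arbitrary in the induction hypothesis, its [k]-th entry may be any [B]: the product
   [W] of the other factors is uncorrelated with the events of [U k]. *)
have ihB B : measurable B -> Ex (fun w => W w * \1_B (U k w)) =
    \prod_(j < n.+1 | j != o) Ex (fun w => f A k.+1 j (U j w)) * Ex (fun w => \1_B (U k w)).
  move=> mB; have := ih (fun i => if i == k then B else A i) (ltnW kn).
  have mB' j : measurable (if j == k then B else A j) by case: ifP.
  move=> /(_ mB'); rewrite [RHS](bigD1 o)//= foo.
  rewrite (eq_Ex (g := fun w => W w * \1_B (U k w))); last first.
    move=> w; rewrite (bigD1 o)//= foo mulrC; congr (_ * _).
    by apply: eq_bigr => j /foE ->.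
  move=> ->; rewrite mulrC; congr (_ * _).
  by apply: eq_bigr => j /foE ->.
have EW : Ex W = \prod_(j < n.+1 | j != o) Ex (fun w => f A k.+1 j (U j w)).
  have := ihB setT measurableT.
  rewrite (eq_Ex (g := W)); last by move=> w; rewrite indicT mulr1.
  by move=> ->; under eq_Ex do rewrite indicT/=; rewrite Ex_cst mulr1.
rewrite [RHS](bigD1 o)//= fo mulrC -EW.
rewrite (eq_Ex (g := fun w => W w * g k (U k w))); last first.
  by move=> w; rewrite (bigD1 o)//= fo mulrC.
apply: (uncorrelated_bounded mW WC); first exact: itg_bounded_comp.
have [mgk _] := bg k; apply: (@uncorrelated_comp W (U k)) => //.
by move=> B mB; rewrite ihB// EW.
Qed.

(** The indices [k1], [k2], [k3] may coincide with each other. Each function is padded by 1 to a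
    family over all indices, so that coinciding ones multiply at their index, while [l] carries [g]
    alone. *)
Lemma Ex_isolated_factor (n : nat) (U : nat -> Omega -> R) (l k1 k2 k3 : nat)
    (g h1 h2 h3 : R -> R) :
  (forall j, measurable_fun setT (U j)) -> mutually_independent P n U ->
  (l <= n)%N -> (k1 <= n)%N -> (k2 <= n)%N -> (k3 <= n)%N ->
  bounded_measurable g -> bounded_measurable h1 -> bounded_measurable h2 ->
  bounded_measurable h3 -> l != k1 -> l != k2 -> l != k3 ->
  Ex (fun w => g (U l w)) = 0 ->
  Ex (fun w => g (U l w) * h1 (U k1 w) * h2 (U k2 w) * h3 (U k3 w)) = 0.
Proof.
move=> mU iU ln k1n k2n k3n bg bh1 bh2 bh3 lk1 lk2 lk3 g0.
pose at_ (k : nat) (h : R -> R) j : R -> R := fun x => if j == k then h x else 1.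
have bat k h j : bounded_measurable h -> bounded_measurable (at_ k h j).
  by rewrite /at_ => bh; case: (j == k) => //; exact: bounded_measurable_cst.
have prod_at k h w : (k <= n)%N -> \prod_(j < n.+1) at_ k h j (U j w) = h (U k w).
  move=> kn; have kn1 : (k < n.+1)%N by [].
  rewrite (bigD1 (Ordinal kn1))//= /at_/= eqxx big1 ?mulr1// => j.
  by rewrite -val_eqE/= => /negbTE ->.
pose f j x := at_ l g j x * at_ k1 h1 j x * at_ k2 h2 j x * at_ k3 h3 j x.
rewrite (eq_Ex (g := fun w => \prod_(j < n.+1) f j (U j w))); last first.
  by move=> w; rewrite !big_split/= !prod_at.
rewrite Ex_prod_independent//; last first.
  by move=> j; do 3 (apply: bounded_measurableM; last exact: bat); exact: bat.
have ln1 : (l < n.+1)%N by [].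
rewrite (bigD1 (Ordinal ln1))//= (eq_Ex (g := fun w => g (U l w))) ?g0 ?mul0r// => w.
by rewrite /f /at_ eqxx (negbTE lk1) (negbTE lk2) (negbTE lk3) !mulr1.
Qed.

End expectation.

(** * Densities and Gaussian increments *)

Section density.
Context (R : realType) d (Omega : measurableType d) (P : probability Omega R).
Variables (V : Omega -> R) (f : R -> R).
Hypotheses (mV : measurable_fun setT V) (mf : measurable_fun setT f)
  (f0 : forall x, 0 <= f x)
  (lawV : forall A, measurable A ->
     P (V @^-1` A) = (\int[lebesgue_measure]_(x in A) (f x)%:E)%E).

Lemma ge0_integral_density (g : R -> R) : measurable_fun setT g -> (forall x, 0 <= g x) ->
  (\int[P]_w (g (V w))%:E = \int[lebesgue_measure]_x (g x * f x)%:E)%E.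
Proof.
move=> mg g0.
pose nu := measure_function_pushforward__canonical__measure_function_Measure P mV.
have nuE (A : set R) : measurable A -> nu A = (\int[lebesgue_measure]_(x in @idfun R @^-1` A) (f x)%:E)%E.
  by move=> mA; rewrite /nu/= /pushforward lawV.
have mi : measurable_fun setT (idfun : measurableTypeR R -> R) by exact: measurable_id.
have := integral_density_comp (T1 := measurableTypeR R) (mu := lebesgue_measure) (nu := nu) mi mf f0 nuE (g := fun y => (g y)%:E).
have p (y : R) : (0 <= (g y)%:E)%E by rewrite lee_fin.
have m1 : measurable_fun setT (fun y => (g y)%:E) by exact/measurable_EFinP.
move=> /(_ p m1).
by rewrite /nu ge0_integral_pushforward.
Qed.

End density.

Section normal_moments.
Context (R : realType) d (Omega : measurableType d) (P : probability Omega R).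
Variables (V : Omega -> R) (s : R).
Hypotheses (mV : measurable_fun setT V) (s0 : 0 < s)
  (lawV : forall A, measurable A -> P (V @^-1` A) = normal_prob 0 s A).

Let lambda := @lebesgue_measure R.

Let sn0 : s != 0. Proof. by rewrite gt_eqF. Qed.

Let normal_integral (g : R -> R) : measurable_fun setT g -> (forall x, 0 <= g x) ->
  (\int[P]_w (g (V w))%:E = \int[lambda]_x (g x * normal_pdf 0 s x)%:E)%E.
Proof.
move=> mg g0; apply: ge0_integral_density => //; first exact: measurable_normal_pdf.
by move=> x; exact: normal_pdf_ge0.
Qed.

(** Multiplied by this exponential, the density with standard deviation [s] becomes [r] times the
    one with standard deviation [r * s]. For [r] above 1 the exponent is positive, which yields
    integrability of the powers. *)
Lemma normal_prob_sqr_mgf (r : R) : 0 < r ->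
  (\int[P]_w (expR (- ((r ^- 2 - 1) * (V w ^+ 2 / (s ^+ 2 *+ 2)))))%:E = r%:E)%E.
Proof.
move=> r0.
pose g x := expR (- ((r ^- 2 - 1) * (x ^+ 2 / (s ^+ 2 *+ 2)))).
rewrite (normal_integral (g := g)); last 2 first.
- apply: measurableT_comp => //; apply: measurableT_comp => //.
  by apply: measurable_funM => //; apply: measurable_funM => //; exact: measurable_funX.
- by move=> x; exact: expR_ge0.
have rs0 : r * s != 0 by rewrite mulf_neq0 ?gt_eqF.
have pkE : normal_peak s = r * normal_peak (r * s).
  rewrite /normal_peak (_ : (r * s) ^+ 2 * pi *+ 2 = r ^+ 2 * (s ^+ 2 * pi *+ 2)); last first.
    by rewrite exprMn mulrnAr mulrA.
  by rewrite sqrtrM ?sqr_ge0// sqrtr_sqr gtr0_norm// invfM mulVKf ?gt_eqF.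
have gE x : g x * normal_pdf 0 s x = r * normal_pdf 0 (r * s) x.
  rewrite !normal_pdfE// pkE mulrCA -!mulrA; congr (_ * (_ * _)).
  rewrite /normal_fun /g !subr0 -expRD; congr expR.
  by field; rewrite ?gt_eqF.
under eq_integral do rewrite gE EFinM.
rewrite ge0_integralZl//; last 3 first.
- by apply/measurable_EFinP; exact: measurable_normal_pdf.
- by move=> x _; rewrite lee_fin normal_pdf_ge0.
- by rewrite lee_fin ltW.
by rewrite integral_normal_pdf mule1.
Qed.

Let w2 w : R := V w ^+ 2 / (s ^+ 2 *+ 2).

Let w2_ge0 w : 0 <= w2 w.
Proof. by rewrite divr_ge0 ?sqr_ge0// mulrn_wge0// sqr_ge0. Qed.

Let mw2 : measurable_fun setT w2.
Proof. by apply: measurable_funM => //; exact: measurable_funX. Qed.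

Lemma itg_normal_mgf (r : R) : 0 < r ->
  itg P (fun w => expR (- ((r ^- 2 - 1) * w2 w))) /\
  Ex P (fun w => expR (- ((r ^- 2 - 1) * w2 w))) = r.
Proof.
move=> r0; have i : itg P (fun w => expR (- ((r ^- 2 - 1) * w2 w))).
  apply/integrableP; split.
    apply/measurable_EFinP; apply: measurableT_comp => //.
    by apply: measurableT_comp => //; exact: measurable_funM.
  under eq_integral do rewrite /= ger0_norm ?expR_ge0//.
  by rewrite normal_prob_sqr_mgf// ltry.
by split => //; apply: EFin_inj; rewrite ExE// normal_prob_sqr_mgf.
Qed.

Lemma itg_normal4 : itg P (fun w => V w ^+ 4) /\ Ex P (fun w => V w ^+ 4) <= 32 * s ^+ 4.
Proof.
(* With [r = 2] the exponential of 3/4 [w2] has mean 2 and, by its quadratic lower bound, dominates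
   [V ^+ 4 / (15 s ^+ 4)]. This gives 30 instead of the exact constant 3, and only the order
   matters. *)
have [i e] := itg_normal_mgf (ltr0n R 2).
have b w : V w ^+ 4 <= 15 * s ^+ 4 * expR (- ((2 ^- 2 - 1) * w2 w)).
  have y0 : 0 <= 3 / 4 * w2 w by rewrite mulr_ge0.
  have -> : - ((2 ^- 2 - 1) * w2 w) = 3 / 4 * w2 w by field.
  have := expR_ge1Dxn 1 y0; set E := expR _.
  have -> : V w ^+ 4 = 4 * s ^+ 4 * (w2 w) ^+ 2.
    by rewrite /w2; field.
  have : 0 < s ^+ 4 by rewrite exprn_gt0.
  set S := s ^+ 4; set y := w2 w; rewrite (_ : 2`!%:R = 2 :> R)// => S0 H.
  rewrite -subr_ge0 (_ : _ - _ = S * (15 * E - 4 * y ^+ 2)); last by ring.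
  by apply: mulr_ge0; [exact: ltW|nra].
have i4 : itg P (fun w => V w ^+ 4).
  apply: itg_le (itgZ (15 * s ^+ 4) i) _; first exact: measurable_funX.
  by move=> w; rewrite ger0_norm// exprn_even_ge0.
split => //; apply: le_trans (Ex_le i4 (itgZ (15 * s ^+ 4) i) b) _.
rewrite ExZ// e; have : 0 < s ^+ 4 by rewrite exprn_gt0.
by set S := s ^+ 4; lra.
Qed.

Lemma itg_normal2 : itg P (fun w => V w ^+ 2).
Proof.
have [i4 _] := itg_normal4.
apply: itg_le (itgD (itg_cst P 1) i4) _; first exact: measurable_funX.
move=> w; rewrite ger0_norm ?sqr_ge0// (_ : V w ^+ 4 = (V w ^+ 2) ^+ 2); last by rewrite -exprM.
by set y := V w ^+ 2; nra.
Qed.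

Lemma itg_normal1 : itg P V.
Proof.
apply: itg_le (itgD (itg_cst P 1) itg_normal2) _ => // w.
rewrite -[V w ^+ 2]real_normK ?num_real//.
by set y := `|V w|; nra.
Qed.

(* Since [exp (- y) >= 1 - y], the Gaussian integrals [E exp (- c V^2) = (1 + 2 c s^2)^(-1/2)]
   for [c] close to [0] of both signs determine [E V^2] *)
Lemma Ex_normal2 : Ex P (fun w => V w ^+ 2) = s ^+ 2.
Proof.
have s2 : 0 < s ^+ 2 by rewrite exprn_gt0.
have iw : itg P w2.
  by rewrite /w2; under eq_fun do rewrite mulrC; apply: itgZ; exact: itg_normal2.
have H r : 0 < r -> 1 - (r ^- 2 - 1) * Ex P w2 <= r.
  move=> r0; have [i e] := itg_normal_mgf r0.
  rewrite -[leRHS]e -ExZ// -[X in X - _](Ex_cst P 1) -ExB//; last 2 first.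
  - exact: itg_cst.
  - exact: itgZ.
  apply: Ex_le => //; first by apply: itgB; [exact: itg_cst|exact: itgZ].
  by move=> w; exact: expR_ge1Dx.
set y := Ex P w2 in H.
have yE : Ex P (fun w => V w ^+ 2) = s ^+ 2 *+ 2 * y.
  by rewrite -ExZ//; apply: eq_Ex => w; rewrite /w2; field.
rewrite yE; suff -> : y = 1 / 2 by field.
(* The last factor has the sign of [1 - r] and tends to [2 y - 1] as [r] tends to 1, so that a value
   of [y] other than 1/2 is refuted by an [r] slightly below or above 1. *)
have H' r : 0 < r -> 0 <= (1 - r) * ((1 + r) * y - r ^+ 2).
  move=> r0; have := H r r0; rewrite -(ler_pM2r (exprn_gt0 2 r0)).
  have -> : (1 - (r ^- 2 - 1) * y) * r ^+ 2 = r ^+ 2 - (1 - r ^+ 2) * y by field; rewrite gt_eqF.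
  by nra.
have y0 : 0 <= y by exact: Ex_ge0.
have [yl|yg|->//] := ltgtP y (1 / 2).
- pose t := (1 - 2 * y) / 4.
  have t0 : 0 < t by rewrite /t; lra.
  have t1 : t < 1 by rewrite /t; lra.
  have yE' : y = 1 / 2 - 2 * t by rewrite /t; field.
  have : 0 < 1 - t by lra.
  move/H'; rewrite opprB addrCA subrr addr0 pmulr_rge0// yE'.
  nra.
- pose t := (2 * y - 1) / 4.
  have t0 : 0 < t by rewrite /t; lra.
  have yE' : y = 1 / 2 + 2 * t by rewrite /t; field.
  have : 0 < 1 + t by lra.
  move/H'; rewrite opprD addrA subrr add0r nmulr_rge0 ?oppr_lt0// yE'.
  nra.
Qed.

(** The positive and the negative part have the same integral, because the density is even and
    Lebesgue measure is invariant under reflection. *)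
Lemma Ex_normal1 : Ex P V = 0.
Proof.
have [_ _ ->] := Ex_posneg itg_normal1.
apply/eqP; rewrite subr_eq0; apply/eqP; congr fine.
have mp : measurable_fun setT (fun x : R => Num.max x 0) by exact: measurable_maxr.
have mn : measurable_fun setT (fun x : R => Num.max (- x) 0).
  by apply: measurable_maxr => //; exact: oppr_measurable.
have ge0max (x : R) : 0 <= Num.max x 0 by rewrite le_max lexx orbT.
rewrite (normal_integral mp)// (normal_integral mn)//.
have mN : measurable_fun [set: measurableTypeR R] (-%R : measurableTypeR R -> measurableTypeR R).
  exact: oppr_measurable.
pose nu := measure_function_pushforward__canonical__measure_function_Measure lambda mN.
transitivity (\int[nu]_x (Num.max x 0 * normal_pdf 0 s x)%:E)%E.
  by apply: eq_measure_integral => //= A mA _; exact/esym/lebesgue_measureN.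
have mh : measurable_fun setT (fun x : measurableTypeR R => (Num.max (x : R) 0 * normal_pdf 0 s x)%:E).
  by apply/measurable_EFinP; apply: measurable_funM => //; exact: measurable_normal_pdf.
have h0 : {in [set: measurableTypeR R], forall x, (0 <= (Num.max (x : R) 0 * normal_pdf 0 s x)%:E)%E}.
  by move=> x _; rewrite lee_fin mulr_ge0// normal_pdf_ge0.
rewrite (@ge0_integral_pushforward _ _ (measurableTypeR R) (measurableTypeR R) R _ mN lebesgue_measure setT _ measurableT mh h0).
apply: eq_integral => x _ /=.
by rewrite !normal_pdfE// /normal_fun !subr0 sqrrN.
Qed.

End normal_moments.

(** * Brownian increments weighted by past information *)

Section brownian.
Context (R : realType) d (Omega : measurableType d) (P : probability Omega R) (T : R)
  (F : R -> set_system Omega) (B : R -> Omega -> R).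
Hypotheses (Ffilt : is_filtration T F) (BB : brownian_motion P T F B).

(** Measurability with respect to a sub-sigma-algebra that is only a set system. Closure properties
    are obtained by passing to [g_sigma_algebraType], as in [adm_g_sigma]. *)
Definition adm (G : set_system Omega) (f : Omega -> R) :=
  forall A : set R, measurable A -> G (f @^-1` A).

Lemma adm_measurable t f : 0 <= t <= T -> adm (F t) f -> measurable_fun setT f.
Proof.
move=> tT af _ A mA; rewrite setTI.
by have [/(_ t tT)[_ FO] _] := Ffilt; apply: FO; exact: af.
Qed.

Lemma adm_le s t f : 0 <= s -> s <= t -> t <= T -> adm (F s) f -> adm (F t) f.
Proof.
move=> s0 st tT af A mA; have [_ Fm] := Ffilt.
by apply: (Fm _ _ s0 st tT); exact: af.
Qed.

Lemma adm_g_sigma t f : 0 <= t <= T ->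
  adm (F t) f <-> measurable_fun setT (f : g_sigma_algebraType (F t) -> R).
Proof.
move=> tT; have [/(_ t tT)[sF _] _] := Ffilt; split => [af _ A mA|mf A mA].
  by rewrite setTI; apply: sub_sigma_algebra; exact: af.
have := mf measurableT A mA; rewrite setTI /measurable/= sigma_algebra_id//.
Qed.

Lemma itg_adm_increment s t (xi : Omega -> R) : 0 <= s -> s <= t -> t <= T ->
  adm (F s) xi -> itg P xi ->
  [/\ itg P (fun w => xi w * (B t w - B s w)),
      Ex P (fun w => xi w * (B t w - B s w)) = 0,
      itg P (fun w => xi w * (B t w - B s w) ^+ 2) &
      Ex P (fun w => xi w * (B t w - B s w) ^+ 2) = (t - s) * Ex P xi] /\
  [/\ itg P (fun w => xi w * (B t w - B s w) ^+ 4) &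
   ((forall w, 0 <= xi w) ->
      Ex P (fun w => xi w * (B t w - B s w) ^+ 4) <= 32 * (t - s) ^+ 2 * Ex P xi)].
Proof.
(* The law of an increment is given for distinct times only, but partitions clamped to an interval
   repeat points; for equal times everything vanishes. *)
move=> s0; rewrite le_eqVlt => /predU1P[<- sT|st tT] axi ixi.
  have z k : (fun w => xi w * (B s w - B s w) ^+ k.+1) = (fun=> 0).
    by apply/funext => w; rewrite subrr expr0n/= mulr0.
  have z0 := z 0%N; rewrite /= in z0.
  rewrite z0 !z !subrr !Ex_cst expr0n !mulr0 !mul0r; split; split => //;
  exact: itg_cst.
have [_ _ _ lawB indB] := BB.
have [aB _ _ _ _] := BB.
have mB u : 0 <= u <= T -> measurable_fun setT (B u).
  by move=> uT; apply: (adm_measurable uT); exact: aB.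
pose V w := B t w - B s w.
have mV : measurable_fun setT V.
  apply: measurable_funB; apply: mB; rewrite ?s0 ?tT ?(ltW (lt_le_trans st tT))//.
  by rewrite (le_trans s0 (ltW st)).
have d0 : 0 < Num.sqrt (t - s) by rewrite sqrtr_gt0 subr_gt0.
have lV A : measurable A -> P (V @^-1` A) = normal_prob 0 (Num.sqrt (t - s)) A.
  by move=> mA; apply: lawB.
have iV : indep2 P xi V.
  move=> A A' mA mA'; rewrite setIC muleC.
  by apply: indB => //; exact: axi.
have mi : measurable_fun setT (@idfun R) by exact: measurable_id.
have mX k : measurable_fun setT (fun x : R => x ^+ k) by exact: measurable_funX.
have iVk k := indep2_comp mi (mX k) iV.
have sqE : Num.sqrt (t - s) ^+ 2 = t - s by rewrite sqr_sqrtr// subr_ge0 ltW.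
have [i4 e4] := itg_normal4 mV d0 lV.
have i2 := itg_normal2 mV d0 lV; have e2 := Ex_normal2 mV d0 lV.
have i1 := itg_normal1 mV d0 lV; have e1 := Ex_normal1 mV d0 lV.
have [j1 f1] := indep2_Ex ixi i1 iV.
have [j2 f2] := indep2_Ex ixi i2 (iVk 2).
have [j4 f4] := indep2_Ex ixi i4 (iVk 4).
split; split => //.
- by rewrite f1 e1 mulr0.
- by rewrite f2 e2 sqE mulrC.
- move=> xi0; rewrite f4 mulrC ler_wpM2r//; first exact: Ex_ge0.
  by rewrite -sqE -exprM.
Qed.

End brownian.

(** * Ito integrals with bounded integrands *)

Section adm_closure.
Context (R : realType) d (Omega : measurableType d) (T : R) (F : R -> set_system Omega).
Hypothesis (Ffilt : is_filtration T F).
Variable (t : R).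
Hypothesis tT : 0 <= t <= T.
Implicit Types f g : Omega -> R.

Lemma adm_cst (a : R) : adm (F t) (fun=> a).
Proof. by apply/(adm_g_sigma Ffilt _ tT); exact: measurable_cst. Qed.

Lemma admD f g : adm (F t) f -> adm (F t) g -> adm (F t) (fun w => f w + g w).
Proof.
move=> /(adm_g_sigma Ffilt _ tT) mf /(adm_g_sigma Ffilt _ tT) mg.
by apply/(adm_g_sigma Ffilt _ tT); exact: measurable_funD.
Qed.

Lemma admM f g : adm (F t) f -> adm (F t) g -> adm (F t) (fun w => f w * g w).
Proof.
move=> /(adm_g_sigma Ffilt _ tT) mf /(adm_g_sigma Ffilt _ tT) mg.
by apply/(adm_g_sigma Ffilt _ tT); exact: measurable_funM.
Qed.

Lemma admZ (a : R) f : adm (F t) f -> adm (F t) (fun w => a * f w).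
Proof. by move=> af; apply: admM => //; exact: adm_cst. Qed.

Lemma admB f g : adm (F t) f -> adm (F t) g -> adm (F t) (fun w => f w - g w).
Proof.
move=> /(adm_g_sigma Ffilt _ tT) mf /(adm_g_sigma Ffilt _ tT) mg.
by apply/(adm_g_sigma Ffilt _ tT); exact: measurable_funB.
Qed.

Lemma admX k f : adm (F t) f -> adm (F t) (fun w => f w ^+ k).
Proof.
move=> /(adm_g_sigma Ffilt _ tT) mf.
by apply/(adm_g_sigma Ffilt _ tT); exact: measurable_funX.
Qed.

Lemma adm_sum I (r : seq I) (Q : pred I) (f : I -> Omega -> R) :
  (forall i, Q i -> adm (F t) (f i)) -> adm (F t) (fun w => \sum_(i <- r | Q i) f i w).
Proof.
move=> af; elim: r => [|i r ih].
  by under eq_fun do rewrite big_nil; exact: adm_cst.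
under eq_fun do rewrite big_cons.
by case: (boolP (Q i)) => Qi //; apply: admD => //; exact: af.
Qed.

Lemma adm_comp (g : R -> R) f : measurable_fun setT g -> adm (F t) f -> adm (F t) (g \o f).
Proof.
move=> mg af A mA; apply: (af (g @^-1` A)).
by rewrite -[X in measurable X]setTI; exact: mg.
Qed.

End adm_closure.

(** * Moments of integrals of step processes *)

Section chain.
Context (R : realType) d (Omega : measurableType d) (P : probability Omega R) (T : R)
  (F : R -> set_system Omega) (B : R -> Omega -> R).
Hypotheses (Ffilt : is_filtration T F) (BB : brownian_motion P T F B).
Variables (c : nat -> R) (h : nat -> Omega -> R) (C : R).
Hypotheses (cT : forall k, 0 <= c k <= T) (cS : forall k, c k <= c k.+1)
  (ah : forall k, adm (F (c k)) (h k)) (hC : forall k w, `|h k w| <= C).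

Definition chain_int i w := \sum_(k < i) h k w * (B (c k.+1) w - B (c k) w).
Definition chain_var i w := \sum_(k < i) h k w ^+ 2 * (c k.+1 - c k).

Let cm i j : (i <= j)%N -> c i <= c j.
Proof. by move/subnK => <-; elim: (j - i)%N => //= k ih; exact: le_trans (cS _). Qed.

Let c_ge0 k : 0 <= c k. Proof. by case/andP: (cT k). Qed.
Let c_leT k : c k <= T. Proof. by case/andP: (cT k). Qed.

Lemma adm_chain_int i : adm (F (c i)) (chain_int i).
Proof.
apply: (adm_sum Ffilt (cT i)) => k _; have ki := ltn_ord k.
have [aB _ _ _ _] := BB.
apply: (admM Ffilt (cT i)); first by apply: (adm_le Ffilt _ _ _ (ah k)) => //; exact/cm/ltnW.
apply: (admB Ffilt (cT i)).
  by apply: (adm_le Ffilt _ _ _ (aB _ (cT k.+1))) => //; exact: cm.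
by apply: (adm_le Ffilt _ _ _ (aB _ (cT k))) => //; exact/cm/ltnW.
Qed.

Lemma adm_chain_var i : adm (F (c i)) (chain_var i).
Proof.
apply: (adm_sum Ffilt (cT i)) => k _; have ki := ltn_ord k.
apply: (admM Ffilt (cT i)); last exact: (adm_cst Ffilt).
by apply: (admX Ffilt (cT i)); apply: (adm_le Ffilt _ _ _ (ah k)) => //; exact/cm/ltnW.
Qed.

Lemma chain_var_bounds i w : 0 <= chain_var i w <= C ^+ 2 * (c i - c 0).
Proof.
rewrite /chain_var; elim: i => [|i /andP[ih1 ih2]].
  by rewrite big_ord0 subrr mulr0 lexx.
have C0 : 0 <= C := le_trans (normr_ge0 _) (hC i w).
have d0 : 0 <= c i.+1 - c i by rewrite subr_ge0.
have hC2 : h i w ^+ 2 <= C ^+ 2.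
  by rewrite -[h i w ^+ 2]real_normK ?num_real// lerXn2r ?nnegrE.
rewrite big_ord_recr/= (addr_ge0 ih1 (mulr_ge0 (sqr_ge0 _) d0))/=.
rewrite (_ : C ^+ 2 * _ = C ^+ 2 * (c i - c 0) + C ^+ 2 * (c i.+1 - c i)); last by ring.
by rewrite lerD// ler_wpM2r.
Qed.

Lemma chain_intS i w :
  chain_int i.+1 w = chain_int i w + h i w * (B (c i.+1) w - B (c i) w).
Proof. by rewrite /chain_int big_ord_recr. Qed.

Let mt i (f : Omega -> R) : adm (F (c i)) f -> measurable_fun setT f.
Proof. by move=> af; exact: (adm_measurable Ffilt (cT i) af). Qed.

(** Martingale property and Ito isometry conditionally on the initial time, expressed by an
    arbitrary integrable weight [xi] known at that time. The weight is carried through the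
    induction, each new increment being independent of all that multiplies it. *)
Lemma chain_moments (xi : Omega -> R) : adm (F (c 0)) xi -> itg P xi -> forall i,
  [/\ itg P (fun w => xi w * chain_int i w), Ex P (fun w => xi w * chain_int i w) = 0,
      itg P (fun w => xi w * chain_int i w ^+ 2) &
      Ex P (fun w => xi w * chain_int i w ^+ 2) = Ex P (fun w => xi w * chain_var i w)].
Proof.
move=> axi ixi; elim=> [|i [i1 e1 i2 e2]].
  have z0 : chain_int 0 = fun=> 0 by apply/funext => w; rewrite /chain_int big_ord0.
  have y0 : chain_var 0 = fun=> 0 by apply/funext => w; rewrite /chain_var big_ord0.
  have x0 : (fun w => xi w * 0) = fun=> 0 by apply/funext => w; rewrite mulr0.
  have x1 : (fun w => xi w * 0 ^+ 2) = fun=> 0 by apply/funext => w; rewrite expr0n mulr0.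
  rewrite z0 y0 x0 x1.
  by split => //; rewrite ?Ex_cst//; exact: itg_cst.
have aM := adm_chain_int i.
have axi' : adm (F (c i)) xi by apply: (adm_le Ffilt _ _ _ axi) => //; exact: cm.
have C0 : 0 <= C by apply: le_trans (hC 0%N point); exact: normr_ge0.
have ixh : itg P (fun w => xi w * h i w) by apply: (itg_mulb (C := C)) => //; exact: mt.
have axh : adm (F (c i)) (fun w => xi w * h i w) by exact: (admM Ffilt (cT i)).
have ixMh : itg P (fun w => xi w * chain_int i w * h i w).
  by apply: (itg_mulb (C := C)) => //; exact: mt.
have axMh : adm (F (c i)) (fun w => xi w * chain_int i w * h i w).
  by do 2 apply: (admM Ffilt (cT i)) => //.
have ixhh : itg P (fun w => xi w * h i w * h i w).
  by apply: (itg_mulb (C := C)) => //; exact: mt.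
have axhh : adm (F (c i)) (fun w => xi w * h i w * h i w) by exact: (admM Ffilt (cT i)).
have [[j1 f1 _ _] _] := itg_adm_increment Ffilt BB (c_ge0 i) (cS i) (c_leT i.+1) axh ixh.
have [[j2 f2 _ _] _] := itg_adm_increment Ffilt BB (c_ge0 i) (cS i) (c_leT i.+1) axMh ixMh.
have [[_ _ j3 f3] _] := itg_adm_increment Ffilt BB (c_ge0 i) (cS i) (c_leT i.+1) axhh ixhh.
set D := fun w => B (c i.+1) w - B (c i) w.
have E1 : (fun w => xi w * chain_int i.+1 w) =
    (fun w => xi w * chain_int i w + xi w * h i w * D w).
  by apply/funext => w; rewrite chain_intS /D; ring.
have E2 : (fun w => xi w * chain_int i.+1 w ^+ 2) =
    (fun w => xi w * chain_int i w ^+ 2 + (2 * (xi w * chain_int i w * h i w * D w)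
               + xi w * h i w * h i w * D w ^+ 2)).
  by apply/funext => w; rewrite chain_intS /D; ring.
have ixV : itg P (fun w => xi w * chain_var i w).
  apply: (itg_mulb (C := C ^+ 2 * (c i - c 0))) => //; first exact/mt/adm_chain_var.
  by move=> w; have /andP[v0 v1] := chain_var_bounds i w; rewrite ger0_norm.
have E3 : (fun w => xi w * chain_var i.+1 w) =
    (fun w => xi w * chain_var i w + (c i.+1 - c i) * (xi w * h i w * h i w)).
  by apply/funext => w; rewrite /chain_var big_ord_recr/=; ring.
rewrite E1 E2 E3; split.
- exact: itgD.
- by rewrite ExD// e1 f1 addr0.
- by apply: itgD => //; apply: itgD => //; exact: itgZ.
- rewrite ExD//; last by apply: itgD => //; exact: itgZ.
  rewrite ExD//; last exact: itgZ.
  rewrite ExZ// f2 mulr0 add0r f3 e2 ExD//; last exact: itgZ.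
  by rewrite ExZ.
Qed.

(** With [a] the new step, [b] the time elapsed and [K = C ^+ 4], one step adds at most 8 K a b + 96
    K a^2, which is below the growth 192 K a b + 96 K a^2 of the bound. The constant is 3 * 32,
    where 32 is the fourth-moment constant of a Brownian increment. *)
Lemma chain_moment4 i : itg P (fun w => chain_int i w ^+ 4) /\
  Ex P (fun w => chain_int i w ^+ 4) <= 96 * C ^+ 4 * (c i - c 0) ^+ 2.
Proof.
have ac a : adm (F (c 0)) (fun=> a : R) by exact: (adm_cst Ffilt).
elim: i => [|i [i4 e4]].
  have z0 : chain_int 0 = fun=> 0 by apply/funext => w; rewrite /chain_int big_ord0.
  under eq_fun do rewrite z0 expr0n/=.
  by rewrite Ex_cst subrr expr0n mulr0; split => //; exact: itg_cst.
have C0 : 0 <= C by apply: le_trans (hC 0%N point); exact: normr_ge0.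
have aM := adm_chain_int i.
have mM : measurable_fun setT (chain_int i) by exact: mt aM.
have mh : measurable_fun setT (h i) by exact: mt (ah i).
have [_ _ i2' e2'] := chain_moments (ac 1) (itg_cst P 1) i.
have i2 : itg P (fun w => chain_int i w ^+ 2).
  by apply: eq_itg i2' => w; rewrite mul1r.
have e2 : Ex P (fun w => chain_int i w ^+ 2) <= C ^+ 2 * (c i - c 0).
  rewrite (eq_Ex _ (g := fun w => 1 * chain_int i w ^+ 2)); last by move=> w; rewrite mul1r.
  rewrite e2' -[leRHS](Ex_cst P); apply: Ex_le => //.
  - apply: (@itg_bounded _ _ _ P (C ^+ 2 * (c i - c 0))).
      by apply: measurable_funM => //; exact/mt/adm_chain_var.
    by move=> w; have /andP[v0 v1] := chain_var_bounds i w; rewrite mul1r ger0_norm.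
  - exact: itg_cst.
  - by move=> w; have /andP[v0 v1] := chain_var_bounds i w; rewrite mul1r.
pose D w := B (c i.+1) w - B (c i) w.
have iM3 : itg P (fun w => chain_int i w ^+ 3).
  apply: itg_le (itgD i4 i2) _; first exact: measurable_funX.
  move=> w; rewrite normrX -[chain_int i w ^+ 2]real_normK ?num_real//.
  have -> : chain_int i w ^+ 4 = `|chain_int i w| ^+ 4.
    by rewrite -normrX ger0_norm// exprn_even_ge0.
  have := normr_ge0 (chain_int i w); set y := `|_| => y0.
  have := sqr_ge0 y; have := sqr_ge0 (y - 1); have := sqr_ge0 (y * (y - 1)).
  by nra.
have iM3h : itg P (fun w => chain_int i w ^+ 3 * h i w) by apply: (itg_mulb (C := C)).
have hk k w : `|h i w ^+ k| <= C ^+ k by rewrite normrX lerXn2r ?nnegrE.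
have iM2h2 : itg P (fun w => chain_int i w ^+ 2 * h i w ^+ 2).
  apply: (itg_mulb (C := C ^+ 2)) => //; exact: measurable_funX.
have ih4 : itg P (fun w => h i w ^+ 4).
  by apply: (@itg_bounded _ _ _ P (C ^+ 4)) => //; exact: measurable_funX.
have [[j1 f1 _ _] _] := itg_adm_increment Ffilt BB (c_ge0 i) (cS i) (c_leT i.+1)
  (admM Ffilt (cT i) (admX Ffilt (cT i) 3 aM) (ah i)) iM3h.
have [[_ _ j2 f2] _] := itg_adm_increment Ffilt BB (c_ge0 i) (cS i) (c_leT i.+1)
  (admM Ffilt (cT i) (admX Ffilt (cT i) 2 aM) (admX Ffilt (cT i) 2 (ah i))) iM2h2.
have [_ [j4 f4]] := itg_adm_increment Ffilt BB (c_ge0 i) (cS i) (c_leT i.+1)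
  (admX Ffilt (cT i) 4 (ah i)) ih4.
have even4 (x : R) : 0 <= x ^+ 4 by rewrite exprn_even_ge0.
have {}f4 := f4 (fun w => even4 _).
set d1 := fun w => _ in j1 f1; set d2 := fun w => _ in j2 f2; set d4 := fun w => _ in j4 f4.
(* The cubic term of the binomial expansion is absorbed by its neighbours: with z the new summand,
   the two sides differ by 2 z^2 (M - z)^2. The term [d1], linear in the increment, has mean
   zero. *)
have bnd w : chain_int i.+1 w ^+ 4 <= chain_int i w ^+ 4 + 4 * d1 w + 8 * d2 w + 3 * d4 w.
  rewrite chain_intS /d1 /d2 /d4 -/(D w).
  set M := chain_int i w; set x := h i w; set y := D w.
  rewrite -subr_ge0 (_ : _ - _ = 2 * ((x * y) * (M - x * y)) ^+ 2); last by ring.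
  by rewrite mulr_ge0// sqr_ge0.
have ib : itg P (fun w => chain_int i w ^+ 4 + 4 * d1 w + 8 * d2 w + 3 * d4 w).
  by do 3 (apply: itgD; last exact: itgZ).
have i4' : itg P (fun w => chain_int i.+1 w ^+ 4).
  apply: itg_le ib _; first by apply: measurable_funX; exact/mt/adm_chain_int.
  by move=> w; rewrite ger0_norm.
split => //; apply: le_trans (Ex_le i4' ib bnd) _.
rewrite !ExD// ?ExZ//; try (by do ?(apply: itgD; last exact: itgZ)); try exact: itgZ.
rewrite f1 mulr0 addr0 f2.
have g2 : Ex P (fun w => chain_int i w ^+ 2 * h i w ^+ 2) <= C ^+ 4 * (c i - c 0).
  apply: (@le_trans _ _ (C ^+ 2 * Ex P (fun w => chain_int i w ^+ 2))).
    rewrite -ExZ//; apply: Ex_le => //; first exact: itgZ.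
    move=> w; rewrite mulrC ler_wpM2r ?sqr_ge0//.
    by apply: le_trans (hk 2 w); exact: ler_norm.
  rewrite (_ : C ^+ 4 * _ = C ^+ 2 * (C ^+ 2 * (c i - c 0))); last by ring.
  by rewrite ler_wpM2l ?sqr_ge0.
have g4 : Ex P (fun w => h i w ^+ 4) <= C ^+ 4.
  rewrite -[leRHS](Ex_cst P); apply: Ex_le => //; first exact: itg_cst.
  by move=> w; apply: le_trans (hk 4 w); exact: ler_norm.
have di : 0 <= c i.+1 - c i by rewrite subr_ge0.
have d0 : 0 <= c i - c 0 by rewrite subr_ge0 cm.
have {}g2 : 8 * ((c i.+1 - c i) * Ex P (fun w => chain_int i w ^+ 2 * h i w ^+ 2))
    <= 8 * ((c i.+1 - c i) * (C ^+ 4 * (c i - c 0))).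
  by rewrite ler_pM2l// ler_wpM2l.
have {}f4 : 3 * Ex P d4 <= 96 * (c i.+1 - c i) ^+ 2 * C ^+ 4.
  apply: le_trans (ler_wpM2l _ f4) _ => //.
  rewrite (_ : forall a b : R, 3 * (32 * a * b) = 96 * a * b); last by move=> a b; ring.
  by apply: ler_wpM2l g4; rewrite mulr_ge0// sqr_ge0.
have K0 : 0 <= C ^+ 4 * ((c i.+1 - c i) * (c i - c 0)) by rewrite !mulr_ge0// exprn_ge0.
rewrite -subr_ge0.
have -> : c i.+1 - c 0 = (c i.+1 - c i) + (c i - c 0) by ring.
move: g2 f4 e4 K0; set a := c i.+1 - c i; set b := c i - c 0; set K := C ^+ 4.
set e := Ex _ _; set e' := Ex _ _; set e'' := Ex _ _ => g2 f4 e4 K0.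
have : 96 * K * (a + b) ^+ 2 = 96 * K * b ^+ 2 + 192 * (K * (a * b)) + 96 * a ^+ 2 * K by ring.
lra.
Qed.

End chain.

(** * Joint measurability of progressive processes *)

Section progressive.
Context (R : realType) d (Omega : measurableType d) (T : R)
  (F : R -> set_system Omega).
Hypotheses (T0 : 0 < T) (Ffilt : is_filtration T F).
Variable H : R -> Omega -> R.
Hypothesis pH : progressive T F H.

(** Progressive measurability speaks about times in [0, T] only; the extension by zero is measurable
    on the whole product, where Tonelli applies. *)
Definition on_horizon (p : R * Omega) : R := if 0 <= p.1 <= T then H p.1 p.2 else 0.

Lemma measurable_on_horizon : measurable_fun setT on_horizon.
Proof.
have TT : 0 <= T <= T by rewrite lexx ltW.
have m0T : measurable [set p : R * Omega | 0 <= p.1 <= T].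
  rewrite (_ : [set p | _] = fst @^-1` `[0, T]%classic); last first.
    by apply/seteqP; split => p /=; rewrite in_itv/=.
  by rewrite -[X in measurable X]setTI; exact: measurable_fst.
move=> _ A mA; rewrite setTI.
have mHA : measurable [set p : R * Omega | 0 <= p.1 <= T /\ A (H p.1 p.2)].
  have := pH TT mA; apply: smallest_sub; first exact: sigma_algebra_measurable.
  move=> _ [C mC [E FE <-]]; apply: measurableX => //.
  by have [/(_ T TT)[_ FO] _] := Ffilt; exact: FO.
have -> : on_horizon @^-1` A = [set p : R * Omega | 0 <= p.1 <= T /\ A (H p.1 p.2)] `|`
    (~` [set p : R * Omega | 0 <= p.1 <= T] `&` [set p | A 0]).
  apply/seteqP; split => p /=; rewrite /on_horizon.
    by case: ifP => pT Ap; [left|right].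
  by case=> [[-> //]|[/negP/negbTE ->]].
apply: measurableU => //; apply: measurableI; first exact: measurableC.
have [A0|A0] := pselect (A 0).
  by rewrite (_ : [set p | A 0] = setT)//; apply/seteqP; split.
by rewrite (_ : [set p | A 0] = set0)//; apply/seteqP; split.
Qed.

Lemma measurable_horizon_section w : measurable_fun `[0, T] (H ^~ w).
Proof.
apply: (@eq_measurable_fun _ _ _ _ _ (fun s => on_horizon (s, w))).
  by move=> s; rewrite inE/= in_itv/= /on_horizon/= => ->.
apply: measurable_funTS.
exact: (measurable_fun_pair1 w measurable_on_horizon).
Qed.

End progressive.

Section joint.
Context (R : realType) d (Omega : measurableType d).

Lemma measurable_integral_section (g : R * Omega -> R) : measurable_fun setT g ->
  (forall p, 0 <= g p) ->
  measurable_fun setT (fun w => \int[lebesgue_measure]_s (g (s, w))%:E)%E.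
Proof.
move=> mg g0; have mg' : measurable_fun setT (EFin \o g) by exact/measurable_EFinP.
have g0' p : (0 <= (EFin \o g) p)%E by rewrite lee_fin.
exact: (@measurable_fun_fubini_tonelli_G _ _ (measurableTypeR R) Omega R
  lebesgue_measure (EFin \o g) mg' g0').
Qed.

End joint.

Section simple.
Context (R : realType) d (Omega : measurableType d) (P : probability Omega R) (T : R)
  (F : R -> set_system Omega) (B : R -> Omega -> R).
Hypotheses (T0 : 0 < T) (Ffilt : is_filtration T F) (BB : brownian_motion P T F B).
Implicit Types (H : simple_integrand R Omega) (J Q : R -> Omega -> R).

(* [J] behaves like an Ito integral whose integrand is bounded by [C], [Q] being
   its quadratic variation. *)
Record bounded_ito (C : R) J Q : Prop := BoundedIto {
  bi_adm : forall t, 0 <= t <= T -> adm (F t) (J t) /\ adm (F t) (Q t);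
  bi_var : forall s t w, 0 <= s -> s <= t -> t <= T ->
    0 <= Q t w - Q s w <= C ^+ 2 * (t - s);
  bi_mart : forall s t xi, 0 <= s -> s <= t -> t <= T -> adm (F s) xi -> itg P xi ->
    [/\ itg P (fun w => xi w * (J t w - J s w)),
        Ex P (fun w => xi w * (J t w - J s w)) = 0,
        itg P (fun w => xi w * (J t w - J s w) ^+ 2) &
        Ex P (fun w => xi w * (J t w - J s w) ^+ 2) =
        Ex P (fun w => xi w * (Q t w - Q s w))];
  bi_mom4 : forall s t, 0 <= s -> s <= t -> t <= T ->
    itg P (fun w => (J t w - J s w) ^+ 4) /\
    Ex P (fun w => (J t w - J s w) ^+ 4) <= 96 * C ^+ 4 * (t - s) ^+ 2 }.

Definition si_map (phi : R -> R) H := SimpleIntegrand (si_size H) (si_time H)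
  (fun i w => phi (si_coef H i w)).

(** Quadratic variation of the integral of [H]: the squared integrand is integrated against the
    clock u |-> u in place of [B]. *)
Definition si_var H (t : R) w := si_integral (fun u _ => u) (si_map (fun x => x ^+ 2) H) t w.

(** Turns the difference of two integrals stopped at [t] and at [s] into one sum over the partition
    clamped to [s, t]. *)
Lemma clamp_increment (f : R -> R) (s t r r' : R) : s <= t ->
  f (Num.max s (Num.min t r')) - f (Num.max s (Num.min t r)) =
  (f (Num.min t r') - f (Num.min t r)) - (f (Num.min s r') - f (Num.min s r)).
Proof.
move=> st.
have E u : f (Num.max s (Num.min t u)) - f s = f (Num.min t u) - f (Num.min s u).
  case: (lerP s u) => su; last first.
    rewrite [Num.min t u]min_r ?(le_trans (ltW su))// [Num.max _ _]max_l ?(ltW su)//.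
    by rewrite !subrr.
  by rewrite max_r// le_min st su.
have := E r; have := E r'; lra.
Qed.

Section bounded_simple.
Variables (H : simple_integrand R Omega) (C : R).
Hypotheses (vH : si_valid T F H) (C0 : 0 <= C)
  (HC : forall i w, (i < si_size H)%N -> `|si_coef H i w| <= C).
Variables (s t : R).
Hypotheses (s0 : 0 <= s) (st : s <= t) (tT : t <= T).

Let c i := Num.max s (Num.min t (si_time H (minn i (si_size H)))).
(** Coefficients of degenerate clamped intervals are set to zero: if the original left end point
    lies after [t], the coefficient need not be known at time [c i]. A nondegenerate interval has
    [c i < t], and then its original left end point is at most [c i]. *)
Let h i w := if (i < si_size H)%N && (c i < c i.+1) then si_coef H i w else 0.

Let c_bounds k : s <= c k <= t.
Proof. by rewrite /c le_max lexx ge_max st ge_min lexx. Qed.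

Let cT k : 0 <= c k <= T.
Proof. by have /andP[a b] := c_bounds k; rewrite (le_trans s0 a) (le_trans b tT). Qed.

Let cS k : c k <= c k.+1.
Proof.
have [_ rS _ _] := vH; rewrite /c.
have le : si_time H (minn k (si_size H)) <= si_time H (minn k.+1 (si_size H)).
  case: (ltnP k (si_size H)) => kn; last by rewrite (minn_idPr (ltnW _)).
  by rewrite (minn_idPl kn) rS.
by rewrite ge_max !le_max lexx/= le_min !ge_min lexx le !orbT.
Qed.

Let ah k : adm (F (c k)) (h k).
Proof.
rewrite /h; case: (boolP (_ && _)) => [/andP[kn ck]|_]; last exact: (adm_cst Ffilt).
have [rT _ aH _] := vH.
have rk : si_time H k <= c k.
  have cE : c k = Num.max s (Num.min t (si_time H k)) by rewrite /c (minn_idPl (ltnW kn)).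
  have : c k < t by apply: (lt_le_trans ck); case/andP: (c_bounds k.+1).
  by rewrite {1}cE gt_max gt_min ltxx/= cE => /andP[_ /ltW rt]; rewrite min_r// le_max lexx orbT.
have /andP[r0 _] := rT k (ltnW kn); have /andP[_ cTk] := cT k.
by apply: (adm_le Ffilt r0 rk cTk); exact: aH.
Qed.

Let hC k w : `|h k w| <= C.
Proof. by rewrite /h; case: ifP => [/andP[kn _]|]; rewrite ?normr0// HC. Qed.

Let si_chain w : si_integral B H t w - si_integral B H s w = chain_int B c h (si_size H) w.
Proof.
rewrite /si_integral -sumrB; apply: eq_bigr => i _; have iH := ltn_ord i.
rewrite -mulrBr /h iH/=.
have cE : c i = Num.max s (Num.min t (si_time H i)) by rewrite /c (minn_idPl (ltnW iH)).
have cE' : c i.+1 = Num.max s (Num.min t (si_time H i.+1)) by rewrite /c (minn_idPl iH).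
rewrite -(clamp_increment (B ^~ w) _ _ st) -cE -cE'.
case: ifPn => //; rewrite -leNgt => ge.
have -> : c i.+1 = c i by apply/le_anti; rewrite ge cS.
by rewrite subrr !mulr0.
Qed.

Let var_chain w : si_var H t w - si_var H s w = chain_var c h (si_size H) w.
Proof.
rewrite /si_var /si_integral -sumrB; apply: eq_bigr => i _; have iH := ltn_ord i.
rewrite -mulrBr /h iH/=.
have cE : c i = Num.max s (Num.min t (si_time H i)) by rewrite /c (minn_idPl (ltnW iH)).
have cE' : c i.+1 = Num.max s (Num.min t (si_time H i.+1)) by rewrite /c (minn_idPl iH).
rewrite -(clamp_increment id _ _ st) -cE -cE'.
case: ifPn => //; rewrite -leNgt => ge.
have -> : c i.+1 = c i by apply/le_anti; rewrite ge cS.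
by rewrite subrr !mulr0.
Qed.

Let c0E : s <= c 0. Proof. by case/andP: (c_bounds 0). Qed.
Let csE : c (si_size H) <= t. Proof. by case/andP: (c_bounds (si_size H)). Qed.

Lemma simple_adm : adm (F t) (fun w => si_integral B H t w - si_integral B H s w) /\
  adm (F t) (fun w => si_var H t w - si_var H s w).
Proof.
rewrite (funext si_chain) (funext var_chain).
have /andP[a _] := cT (si_size H).
split; apply: (adm_le Ffilt a csE tT).
  exact: (adm_chain_int Ffilt BB cT cS ah).
exact: (adm_chain_var Ffilt cT cS ah).
Qed.

Lemma simple_var w : 0 <= si_var H t w - si_var H s w <= C ^+ 2 * (t - s).
Proof.
rewrite var_chain; have /andP[-> /le_trans ->//] := chain_var_bounds cS hC (si_size H) w.
by rewrite ler_wpM2l ?sqr_ge0// lerB.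
Qed.

Lemma simple_moments xi : adm (F s) xi -> itg P xi ->
    [/\ itg P (fun w => xi w * (si_integral B H t w - si_integral B H s w)),
        Ex P (fun w => xi w * (si_integral B H t w - si_integral B H s w)) = 0,
        itg P (fun w => xi w * (si_integral B H t w - si_integral B H s w) ^+ 2) &
        Ex P (fun w => xi w * (si_integral B H t w - si_integral B H s w) ^+ 2) =
        Ex P (fun w => xi w * (si_var H t w - si_var H s w))].
Proof.
move=> axi ixi; have /andP[_ c0T] := cT 0.
have axi' : adm (F (c 0)) xi by exact: (adm_le Ffilt s0 c0E c0T).
have := chain_moments Ffilt BB cT cS ah hC axi' ixi (si_size H).
by rewrite -(funext si_chain) -(funext var_chain).
Qed.

Lemma simple_moment4 : itg P (fun w => (si_integral B H t w - si_integral B H s w) ^+ 4) /\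
  Ex P (fun w => (si_integral B H t w - si_integral B H s w) ^+ 4) <=
    96 * C ^+ 4 * (t - s) ^+ 2.
Proof.
have := chain_moment4 Ffilt BB cT cS ah hC (si_size H).
rewrite -(funext si_chain) => -[i4 e4]; split => //; apply: le_trans e4 _.
(* The chain is increasing: this is read off from the variation of the constant integrand 1, which
   lies between 0 and the elapsed time. *)
have ct0 : 0 <= c (si_size H) - c 0.
  by have /andP[] := chain_var_bounds (h := fun _ _ => 1) (C := 1) cS
    (fun _ _ => ltac:(rewrite normr1; exact: lexx)) (si_size H) (point : Omega);
  rewrite expr1n mul1r => a b; exact: le_trans a b.
apply: ler_wpM2l; first by rewrite mulr_ge0// exprn_ge0.
apply: lerXn2r; rewrite ?nnegrE//; first by rewrite subr_ge0.
exact: lerB.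
Qed.

End bounded_simple.

Lemma si_at0 (Z : R -> Omega -> R) H w : si_valid T F H -> si_integral Z H 0 w = 0.
Proof.
move=> [rT _ _ _]; apply: big1 => i _; have iH := ltn_ord i.
have /andP[r0 _] := rT _ (ltnW iH); have /andP[r1 _] := rT _ iH.
by rewrite !min_l// subrr mulr0.
Qed.

Lemma bounded_ito_simple H C : si_valid T F H -> 0 <= C ->
  (forall i w, (i < si_size H)%N -> `|si_coef H i w| <= C) ->
  bounded_ito C (si_integral B H) (si_var H).
Proof.
move=> vH C0 HC; split.
- move=> t /andP[t0 tT]; have [] := simple_adm vH (lexx 0) t0 tT.
  under [X in adm _ X -> _]eq_fun do rewrite si_at0// subr0.
  have -> : (fun w => si_var H t w - si_var H 0 w) = si_var H t.
    apply/funext => w; rewrite /si_var [X in _ - X]si_at0 ?subr0//.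
    have [rT rS aH [D HD]] := vH; split => //.
      move=> i iH A mA; apply: (aH i iH ((fun x => x ^+ 2) @^-1` A)).
      rewrite -[X in measurable X]setTI.
      have : measurable_fun setT (fun x : R => x ^+ 2) by exact: measurable_funX.
      by apply.
    exists (D ^+ 2) => i w' iH /=; have := HD i w' iH.
    by rewrite normrX => h; rewrite lerXn2r ?nnegrE// (le_trans _ h).
  by [].
- by move=> s t w s0 st tT; have h := simple_var vH C0 HC st w; exact h.
- by move=> s t xi s0 st tT; exact: (simple_moments vH C0 HC s0 st tT).
- by move=> s t s0 st tT; exact: (simple_moment4 vH C0 HC s0 st tT).
Qed.

End simple.

(** * Localization of the price *)

Section simple_paths.
Context (R : realType) d (Omega : measurableType d) (T : R)
  (F : R -> set_system Omega).
Hypotheses (T0 : 0 < T).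
Implicit Types (H : simple_integrand R Omega).

Local Notation leb := lebesgue_measure.

(** The half-open intervals are disjoint, so at most one contains [s]. The index is found before the
    coefficients are chosen, so that it serves both an integrand and its image under [si_map]. *)
Lemma si_eval_cases H s : si_valid T F H ->
  (exists i : 'I_(si_size H), forall c : nat -> R,
     \sum_(j < si_size H) c j * \1_(`]si_time H j, si_time H j.+1]) s = c i) \/
  (forall c : nat -> R,
     \sum_(j < si_size H) c j * \1_(`]si_time H j, si_time H j.+1]) s = 0).
Proof.
move=> [_ rS _ _].
have rm i j : (i <= j)%N -> (j <= si_size H)%N -> si_time H i <= si_time H j.
  move=> ij; elim: j ij => [|j ih]; first by rewrite leqn0 => /eqP ->.
  rewrite leq_eqVlt => /predU1P[-> //|]; rewrite ltnS => ij jH.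
  by apply: le_trans (ih ij (ltnW jH)) (rS _ jH).
have [[i si]|/forallNP ns] := pselect (exists i : 'I_(si_size H),
    si_time H i < s <= si_time H i.+1); last first.
  right=> c; apply: big1 => j _; rewrite indicE memNset ?mulr0// => /=.
  by rewrite in_itv/=; exact: ns.
left; exists i => c; have /andP[s1 s2] := si.
rewrite (bigD1 i)//= indicE mem_set ?mulr1; last by rewrite /= in_itv/= s1 s2.
rewrite big1 ?addr0// => j; rewrite -val_eqE/= neq_ltn => ji.
rewrite indicE memNset ?mulr0// => /=; rewrite in_itv/= => /andP[sj sj'].
have jH := ltn_ord j; have iH := ltn_ord i.
case/orP: ji => [ji|ij].
  by have := rm _ _ ji (ltnW iH); lra.
by have := rm _ _ ij (ltnW jH); lra.
Qed.

Lemma si_eval_map (phi : R -> R) H s w : phi 0 = 0 -> si_valid T F H ->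
  si_eval (si_map phi H) s w = phi (si_eval H s w).
Proof.
move=> phi0 vH; rewrite /si_eval /=.
have [[i iE]|E0] := si_eval_cases s vH.
  by rewrite (iE (fun j => phi (si_coef H j w))) (iE (fun j => si_coef H j w)).
by rewrite (E0 (fun j => phi (si_coef H j w))) (E0 (fun j => si_coef H j w)) phi0.
Qed.

Lemma measurable_si_eval H w : measurable_fun setT (fun s => si_eval H s w).
Proof.
by apply: measurable_sum => i; apply: measurable_funM.
Qed.

Lemma integrable_indic_itvT (a b : R) (c : R) :
  leb.-integrable `]0, T] (fun s => (c * \1_(`]a, b]) s)%:E).
Proof.
apply: (@integrableZl _ _ _ leb _ _ c (EFin \o \1_(`]a, b]))) => //.
by apply: integrableS (integrable_indic_itv a b false false).
Qed.

Lemma si_integral_eval H w : si_valid T F H ->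
  si_integral (fun u _ => u) H T w = \int[leb]_(s in `]0, T]) si_eval H s w.
Proof.
move=> vH; have [rT rS _ _] := vH.
rewrite /Rintegral.
under eq_integral do rewrite /si_eval -sumEFin.
rewrite integral_sum//; last by move=> i; exact: integrable_indic_itvT.
apply: EFin_inj; rewrite fineK; last first.
  by apply/sum_fin_numP => i _ _; apply: integrable_fin_num => //; exact: integrable_indic_itvT.
rewrite -sumEFin; apply: eq_bigr => i _; have iH := ltn_ord i.
have /andP[r0 r1] := rT _ (ltnW iH); have /andP[r0' r1'] := rT _ iH.
rewrite !min_r// EFinM.
under eq_integral do rewrite EFinM.
rewrite integralZl//; last first.
  by apply: integrableS (integrable_indic_itv _ _ false false).
rewrite integral_indic// setIidl; last first.
  move=> s /=; rewrite !in_itv/= => /andP[s1 s2].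
  by rewrite (le_lt_trans r0 s1) (le_trans s2 r1').
congr (_ * _)%E; apply/esym; apply: (etrans (lebesgue_measure_itv `]si_time H i, si_time H i.+1])).
rewrite /= lte_fin; case: ltP => // h.
rewrite (_ : si_time H i.+1 = si_time H i) ?subrr//; apply/le_anti.
by rewrite h rS.
Qed.


Lemma si_var_eval H w : si_valid T F H ->
  si_var H T w = \int[leb]_(s in `]0, T]) (si_eval H s w) ^+ 2.
Proof.
move=> vH; rewrite /si_var si_integral_eval.
  by apply: eq_Rintegral => s _; rewrite si_eval_map// expr0n.
have [rT rS aH [D HD]] := vH; split => //.
  move=> i iH A mA; apply: (aH i iH ((fun x => x ^+ 2) @^-1` A)).
  rewrite -[X in measurable X]setTI.
  have : measurable_fun setT (fun x : R => x ^+ 2) by exact: measurable_funX.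
  by apply.
exists (D ^+ 2) => i w' iH /=; have := HD i w' iH.
by rewrite normrX => h; rewrite lerXn2r ?nnegrE// (le_trans _ h).
Qed.

Lemma si_valid_map (phi : R -> R) H : measurable_fun setT phi ->
  (forall C, exists D, forall x, `|x| <= C -> `|phi x| <= D) ->
  si_valid T F H -> si_valid T F (si_map phi H).
Proof.
move=> mphi bphi [rT rS aH [C HC]]; split => //.
  move=> i iH A mA; apply: (aH i iH (phi @^-1` A)).
  by rewrite -[X in measurable X]setTI; exact: mphi.
have [D phiD] := bphi C.
by exists D => i w iH /=; apply: phiD; exact: HC.
Qed.

End simple_paths.

Section lenglart.
Context (R : realType) d (Omega : measurableType d) (P : probability Omega R) (T : R)
  (F : R -> set_system Omega) (B : R -> Omega -> R).
Hypotheses (T0 : 0 < T) (Ffilt : is_filtration T F) (BB : brownian_motion P T F B).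
Variable H : simple_integrand R Omega.
Hypothesis vH : si_valid T F H.

Let S i w := \sum_(j < i) si_coef H j w ^+ 2 * (si_time H j.+1 - si_time H j).

(* The integrand is switched off before its accumulated energy exceeds [eta]. *)
Lemma si_integral_lenglart (eta e t : R) : 0 <= eta -> 0 < e -> 0 <= t <= T ->
  Pout P [set w | si_var H T w <= eta /\ e < `|si_integral B H t w|] (eta / e ^+ 2).
Proof.
move=> eta0 e0 /andP[t0 tT].
have [rT rS aH [C0 HC]] := vH.
pose C := Num.max C0 0.
have C_ge0 : 0 <= C by rewrite le_max lexx orbT.
have HC' i w : (i < si_size H)%N -> `|si_coef H i w| <= C.
  by move=> iH; rewrite le_max HC.
(* [S i.+1] includes the energy of the interval [i] itself. This keeps the accumulated energy below
   [eta], and adaptedness is preserved because that coefficient and the deterministic right end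
   point are known at the left end. *)
pose K := SimpleIntegrand (si_size H) (si_time H)
  (fun i w => if S i.+1 w <= eta then si_coef H i w else 0).
have rm i j : (i <= j)%N -> (j <= si_size H)%N -> si_time H i <= si_time H j.
  move=> ij; elim: j ij => [|j ih]; first by rewrite leqn0 => /eqP ->.
  rewrite leq_eqVlt => /predU1P[-> //|]; rewrite ltnS => ij jH.
  by apply: le_trans (ih ij (ltnW jH)) (rS _ jH).
have KC i w : (i < si_size K)%N -> `|si_coef K i w| <= C.
  by move=> iH /=; case: ifP; rewrite ?normr0// HC'.
have vK : si_valid T F K.
  split => //; last by exists C.
  move=> i /= iH; have riT := rT i (ltnW iH).
  have aS : adm (F (si_time H i)) (S i.+1).
    apply: (adm_sum Ffilt riT) => j _; have ji := ltn_ord j.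
    apply: (admM Ffilt riT); last exact: (adm_cst Ffilt).
    apply: (admX Ffilt riT); have jH : (j < si_size H)%N := leq_trans ji iH.
    have /andP[rj0 _] := rT j (ltnW jH); have /andP[_ riT'] := riT.
    apply: (adm_le Ffilt rj0 _ riT'); first by apply: rm => //; exact: ltnW.
    exact: aH.
  have -> : (fun w => if S i.+1 w <= eta then si_coef H i w else 0) =
      (fun w => si_coef H i w * \1_(`]-oo, eta]) (S i.+1 w)).
    apply/funext => w; rewrite indicE; case: ifPn => h.
      by rewrite mem_set ?mulr1//= in_itv.
    by rewrite memNset ?mulr0//= in_itv/=; exact/negP.
  apply: (admM Ffilt riT); first exact: aH.
  by apply: (adm_comp (g := \1_(`]-oo, eta]))) => //; exact: measurable_indic.
have bK := bounded_ito_simple Ffilt BB vK C_ge0 KC.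
have KS w k : (k <= si_size H)%N ->
    \sum_(i < k) si_coef K i w ^+ 2 * (si_time H i.+1 - si_time H i) <= eta.
  elim: k => [|k ih] kH; first by rewrite big_ord0.
  rewrite big_ord_recr/=; case: ifPn => [Sk|_]; last first.
    by rewrite expr0n mul0r addr0 ih// ltnW.
  apply: le_trans Sk; rewrite /S big_ord_recr/= lerD2r.
  apply: ler_sum => i _; apply: ler_wpM2r.
    by rewrite subr_ge0 rS// (leq_trans (ltn_ord i))// ltnW.
  by case: ifP; rewrite // expr0n sqr_ge0.
have varKT w : si_var K T w <= eta.
  apply: le_trans (KS w (si_size H) (leqnn _)); rewrite le_eqVlt; apply/orP; left.
  apply/eqP; apply: eq_bigr => i _ /=; have iH := ltn_ord i.
  have /andP[_ r1] := rT _ (ltnW iH); have /andP[_ r1'] := rT _ iH.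
  by rewrite !min_r.
have TT : 0 <= T by exact: ltW.
have T00 : 0 <= (0 : R) <= T by rewrite lexx TT.
have [_ _ i2 e2] := bi_mart bK (lexx 0) t0 tT (adm_cst Ffilt T00 1) (itg_cst P 1).
have J0 w : 1 * (si_integral B K t w - si_integral B K 0 w) ^+ 2 = si_integral B K t w ^+ 2.
  by rewrite (si_at0 B w vK) subr0 mul1r.
rewrite (funext J0) in i2 e2.
have EJ : Ex P (fun w => si_integral B K t w ^+ 2) <= eta.
  rewrite e2 -[leRHS](Ex_cst P); apply: Ex_le; last first.
  - move=> w; rewrite mul1r; have /andP[a _] := bi_var bK w t0 tT (lexx T).
    have /andP[b _] := bi_var bK w (lexx 0) (lexx 0) TT.
    have -> : si_var K 0 w = 0.
      apply: big1 => i _ /=; have iH := ltn_ord i.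
      have /andP[r0 _] := rT _ (ltnW iH); have /andP[r0' _] := rT _ iH.
      by rewrite !min_l// subrr mulr0.
    by rewrite subr0; apply: le_trans (varKT w); rewrite -subr_ge0.
  - exact: itg_cst.
  - apply: (@itg_bounded _ _ _ P (C ^+ 2 * t)).
      apply: measurable_funM => //; apply: measurable_funB.
        by apply: (adm_measurable Ffilt (t := t)); [rewrite t0|apply: (bi_adm bK _).2; rewrite t0].
      by apply: (adm_measurable Ffilt T00); apply: (bi_adm bK _).2.
    move=> w; rewrite mul1r; have /andP[a b] := bi_var bK w (lexx 0) t0 tT.
    by rewrite ger0_norm// -[in leRHS](subr0 t).
have e20 : 0 < e ^+ 2 by rewrite exprn_gt0.
apply: Pout_sub (Pout_markov i2 (fun w => sqr_ge0 _) EJ e20) => w /= [SH Hw].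
(* Every partial energy is at most the total one, so that on this event nothing has been switched
   off. *)
have KH : si_integral B K t w = si_integral B H t w.
  apply: eq_bigr => i _ /=; have iH := ltn_ord i; rewrite ifT//.
  apply: le_trans SH; rewrite /si_var /si_integral /= /S.
  have E j : (j < si_size H)%N -> si_coef H j w ^+ 2 *
      (Num.min T (si_time H j.+1) - Num.min T (si_time H j)) =
      si_coef H j w ^+ 2 * (si_time H j.+1 - si_time H j).
    move=> jH; have /andP[_ r1] := rT _ (ltnW jH); have /andP[_ r1'] := rT _ jH.
    by rewrite !min_r.
  under [leRHS]eq_bigr => j _ do rewrite E//.
  rewrite -!(big_mkord xpredT (fun j => si_coef H j w ^+ 2 * (si_time H j.+1 - si_time H j))).
  rewrite [leRHS](big_cat_nat _ (n := i.+1))//= lerDl big_nat_cond; apply: sumr_ge0 => j.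
  by rewrite andbT => /andP[_ jH]; rewrite mulr_ge0 ?sqr_ge0// subr_ge0 rS.
by rewrite KH -[ltRHS]real_normK ?num_real// ltrXn2r ?nnegrE ?(ltW e0).
Qed.

End lenglart.

(** * From local boundedness to a bound on a large event *)

Section localization.
Context (R : realType) d (Omega : measurableType d) (P : probability Omega R) (T : R)
  (F : R -> set_system Omega).
Hypotheses (T0 : 0 < T) (Ffilt : is_filtration T F).

(** The events [tau k < T] decrease to a null set, because the localizing sequence almost surely
    reaches [T]; off such an event the bound [C k] is valid up to [T]. *)
Lemma locally_bounded_Pout (H : R -> Omega -> R) (e : R) :
  locally_bounded P T F H -> 0 < e ->
  exists2 C : R, 0 <= C &
    Pout P (~` [set w | forall t, 0 < t <= T -> `|H t w| <= C]) e.
Proof.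
move=> [tau [[stau ntau atau] [C HC]]] e0.
have TT : 0 <= T <= T by rewrite (ltW T0) lexx.
pose A k := [set w | tau k w < T].
have mA k : measurable (A k).
  have [_ tauF] := stau k.
  (* A stopping time makes [tau k <= t] measurable for [t] in [0, T], so the strict inequality
     becomes a countable union; indices with a negative time contribute the empty set. *)
  rewrite (_ : A k = \bigcup_n [set w | tau k w <= T - n.+1%:R^-1 /\ 0 <= T - n.+1%:R^-1]).
    apply: bigcup_measurable => n _.
    have [Tn|Tn] := pselect (0 <= T - n.+1%:R^-1); last first.
      by rewrite (_ : [set w | _] = set0)//; apply/seteqP; split => // w [].
    have TnT : 0 <= T - n.+1%:R^-1 <= T by rewrite Tn lerBlDr lerDl invr_ge0 ler0n.
    rewrite (_ : [set w | _] = [set w | tau k w <= T - n.+1%:R^-1]); last first.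
      by apply/seteqP; split => w //= [].
    by have [/(_ _ TnT)[_ FO] _] := Ffilt; apply: FO; exact: tauF.
  have [t0 _] := stau k.
  apply/seteqP; split => [w /= twT|w [n _ /= [h _]]]; last first.
    by apply: (le_lt_trans h); rewrite ltrBlDr ltrDl invr_gt0 ltr0n.
  have d0 : 0 < T - tau k w by rewrite subr_gt0.
  have /andP[w0 _] := t0 w.
  have [n nd] : exists n, n.+1%:R^-1 < T - tau k w.
    exists (Num.truncn (T - tau k w)^-1).
    rewrite -[ltRHS]invrK ltf_pV2 ?posrE ?invr_gt0 ?ltr0n//.
    by apply: truncnS_gt.
  exists n => //=; split; first by rewrite lerBrDr -lerBrDl ltW.
  by rewrite subr_ge0 (le_trans (ltW nd))// lerBlDr lerDl.
have niA : nonincreasing_seq A.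
  apply/nonincreasing_seqP => k; apply/subsetPset => w /= h.
  by rewrite /A/= (le_lt_trans (ntau k w)).
have mcap : measurable (\bigcap_k A k) by exact: bigcap_measurableType.
have PA0 : (P (A 0%N) < +oo)%E by rewrite ltey_eq fin_num_measure.
have PA : P (\bigcap_k A k) = 0%E.
  apply/eqP; rewrite eq_le measure_ge0 andbT.
  have [N [mN PN0 NA]] := atau; rewrite -PN0.
  apply: le_measure; rewrite ?inE// => w wA; apply: NA => /= -[k _ /(_ k (leqnn _))].
  by move=> tT; have := wA k I; rewrite /A/= tT ltxx.
have := nonincreasing_cvg_mu PA0 mA mcap niA.
rewrite [X in _ --> X]PA.
move=> /fine_cvgP[_ /cvgrPdist_le /(_ e e0)[k _ /(_ k (leqnn _))]] /=.
rewrite sub0r normrN ger0_norm ?fine_ge0// => Pk.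
exists (Num.max (C k) 0); first by rewrite le_max lexx orbT.
exists (A k); split => //; last by rewrite -[P _]fineK ?fin_num_measure.
move=> w /= /existsNP[t /not_implyP[/andP[t0 tT] Ht]].
rewrite /A /= ltNge; apply/negP => Tk; apply: Ht.
by rewrite le_max HC// t0 (le_trans tT).
Qed.

End localization.

Definition clip {R : realType} (C x : R) : R := Num.max (- C) (Num.min C x).

Section clip.
Context {R : realType}.
Variable C : R.
Hypothesis C0 : 0 <= C.

Lemma measurable_clip : measurable_fun setT (clip C).
Proof. by apply: measurable_maxr => //; exact: measurable_minr. Qed.

Lemma clip_bound x : `|clip C x| <= C.
Proof.
rewrite /clip ler_norml le_max lexx/= ge_max ge_min lexx/= andbT.
by rewrite (le_trans _ C0)// oppr_le0.
Qed.

Lemma clip0 : clip C 0 = 0.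
Proof. by rewrite /clip min_r// max_r// oppr_le0. Qed.

(** With [x] a value of the simple integrand and [y] one of [sigma], the first half keeps the
    clipped integrand close to [sigma], the second bounds what clipping discards. *)
Lemma clip_proj x y : `|y| <= C ->
  `|clip C x - y| <= `|x - y| /\ `|x - clip C x| <= `|x - y|.
Proof.
rewrite ler_norml => /andP[y1 y2]; rewrite /clip.
case: (lerP C x) => xC; case: (lerP (- C) _) => h; do 2 (case: ler0P => ?); split; 
  do ?case: ler0P => ?; lra.
Qed.

End clip.

(** * Pathwise comparison of a simple integrand with the volatility *)

Section paths.
Context {R : realType}.
Local Notation leb := lebesgue_measure.
Variables (T : R) (T0 : 0 < T).

Lemma measurable_itv_cT (h : R -> R) :
  measurable_fun `[0, T] h -> measurable_fun `]0, T] h.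
Proof.
by apply: measurable_funS => // s /=; rewrite !in_itv/= => /andP[/ltW -> ->].
Qed.

Lemma bounded_integrable_itv (a b : R) (h : R -> R) (M : R) : measurable_fun `]a, b] h ->
  (forall s, a < s <= b -> `|h s| <= M) -> leb.-integrable `]a, b] (EFin \o h).
Proof.
move=> mh hM; apply: measurable_bounded_integrable => //.
  apply: (le_lt_trans (y := lebesgue_measure `]a, b]%classic)) => //.
  by rewrite lebesgue_measure_itv/=; case: ifP => // _; rewrite -EFinB ltry.
exists M; split; first exact: num_real.
by move=> y My s /=; rewrite in_itv/= => sI; apply: le_trans (hM s sI) (ltW My).
Qed.

Lemma Rintegral_itv_cst (a b c : R) : a <= b -> \int[leb]_(_ in `]a, b]) c = c * (b - a).
Proof.
move=> ab; rewrite Rintegral_cst//; congr (_ * _).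
apply: (etrans (congr1 fine (lebesgue_measure_itv `]a, b]))).
rewrite /= lte_fin; case: ltP => [//|ba /=].
by have -> : b = a; [apply/le_anti; rewrite ba ab|rewrite subrr].
Qed.

Lemma Rintegral_itv_bound (a b : R) (h : R -> R) (M : R) : a <= b ->
  measurable_fun `]a, b] h -> (forall s, a < s <= b -> `|h s| <= M) ->
  `|\int[leb]_(s in `]a, b]) h s| <= M * (b - a).
Proof.
move=> ab mh hM; have ih := bounded_integrable_itv mh hM.
apply: le_trans (le_normr_Rintegral _ ih) _ => //.
rewrite -Rintegral_itv_cst//; apply: le_Rintegral => //.
  exact: (integrable_norm ih).
exact: (@bounded_integrable_itv a b (fun=> M) `|M|).
Qed.

Lemma drift_increment (h : R -> R) (M s t : R) : measurable_fun `[0, T] h ->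
  (forall u, 0 < u <= T -> `|h u| <= M) -> 0 <= s -> s <= t -> t <= T ->
  `|\int[leb]_(u in `[0, t]) h u - \int[leb]_(u in `[0, s]) h u| <= M * (t - s).
Proof.
move=> mh hM s0 st tT.
have ms a b : 0 <= a -> b <= T -> measurable_fun `]a, b] h.
  move=> a0 bT; apply: measurable_funS (mh) => // u /=; rewrite !in_itv/= => /andP[u1 u2].
  by rewrite (le_trans a0 (ltW u1)) (le_trans u2).
have bd a b : 0 <= a -> b <= T -> forall u, a < u <= b -> `|h u| <= M.
  by move=> a0 bT u /andP[u1 u2]; apply: hM; rewrite (le_lt_trans a0 u1) (le_trans u2).
have i0 b : b <= T -> leb.-integrable `]0, b] (EFin \o h).
  by move=> bT; exact: bounded_integrable_itv (ms _ _ (lexx _) bT) (bd _ _ (lexx _) bT).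
have t0 := le_trans s0 st; have sT := le_trans st tT.
rewrite -!Rintegral_itv_obnd_cbnd; try exact: i0.
have := @Rintegral_itvB R h (BRight 0) (BRight t) s (i0 t tT).
rewrite !bnd_simp => /(_ s0 st) ->.
by apply: Rintegral_itv_bound => //; [exact: ms|exact: bd].
Qed.

Variables (f g : R -> R) (C M eta : R).
Hypotheses (C0 : 0 <= C) (mf : measurable_fun `[0, T] f) (mg : measurable_fun `[0, T] g)
  (fM : forall s, 0 < s <= T -> `|f s| <= M) (gC : forall s, 0 < s <= T -> `|g s| <= C)
  (fg : (\int[leb]_(s in `[0%R, T]) ((f s - g s) ^+ 2)%:E <= eta%:E)%E).

Let mfg : measurable_fun `]0, T] (fun s => (f s - g s) ^+ 2).
Proof. by apply: measurable_funX; apply: measurable_funB; exact: measurable_itv_cT. Qed.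

Let mcf : measurable_fun `]0, T] (fun s => clip C (f s)).
Proof. by apply: measurableT_comp; [exact: measurable_clip|exact: measurable_itv_cT]. Qed.

Let ifg : leb.-integrable `]0, T] (EFin \o (fun s => (f s - g s) ^+ 2)).
Proof.
apply: (@bounded_integrable_itv _ _ _ ((M + C) ^+ 2)) => // s sT.
rewrite normrX; apply: lerXn2r; rewrite ?nnegrE//.
  by apply: addr_ge0 => //; exact: le_trans (fM sT).
by apply: le_trans (ler_normB _ _) _; apply: lerD; [exact: fM|exact: gC].
Qed.

Lemma Rintegral_dist_le : \int[leb]_(s in `]0, T]) (f s - g s) ^+ 2 <= eta.
Proof.
rewrite -lee_fin; apply: le_trans fg; rewrite /Rintegral fineK ?integrable_fin_num//.
rewrite -integral_itv_obnd_cbnd//.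
by apply/measurable_EFinP.
Qed.

(** The energy of the discarded part, to which [si_integral_lenglart] is applied. *)
Lemma Rintegral_clip_residual :
  \int[leb]_(s in `]0, T]) (f s - clip C (f s)) ^+ 2 <= eta.
Proof.
apply: le_trans Rintegral_dist_le; apply: le_Rintegral => //.
- apply: (@bounded_integrable_itv _ _ _ ((M + C) ^+ 2)) => [|s sT].
    by apply: measurable_funX; apply: measurable_funB => //; exact: measurable_itv_cT.
  rewrite normrX; apply: lerXn2r; rewrite ?nnegrE//.
    by apply: addr_ge0 => //; exact: le_trans (fM sT).
  by apply: le_trans (ler_normB _ _) _; apply: lerD; [exact: fM|exact: clip_bound].
- move=> s /=; rewrite in_itv/= => sT.
  rewrite -[leLHS]real_normK ?num_real// -[leRHS]real_normK ?num_real//.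
  by apply: lerXn2r; rewrite ?nnegrE//; exact: (clip_proj (f s) (gC sT)).2.
Qed.

Let ig : leb.-integrable `]0, T] (EFin \o (fun s => g s ^+ 2)).
Proof.
apply: (@bounded_integrable_itv _ _ _ (C ^+ 2)) => [|s sT].
  by apply: measurable_funX; exact: measurable_itv_cT.
by rewrite normrX; apply: lerXn2r; rewrite ?nnegrE//; exact: gC.
Qed.

Lemma Rintegral_sqr_bound : 0 <= \int[leb]_(s in `[0, T]) g s ^+ 2 <= C ^+ 2 * T.
Proof.
rewrite -Rintegral_itv_obnd_cbnd//; apply/andP; split.
  by apply: Rintegral_ge0 => s _; exact: sqr_ge0.
apply: le_trans (ler_norm _) _; rewrite -[X in _ * X]subr0.
apply: Rintegral_itv_bound; [exact: ltW|by apply: measurable_funX; exact: measurable_itv_cT|].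
by move=> s sT; rewrite normrX; apply: lerXn2r; rewrite ?nnegrE//; exact: gC.
Qed.

(** Pointwise, the difference of squares is at most 2 C |f - g|, which is bounded by lam + C^2 (f -
    g)^2 / lam. The free parameter takes the place of the Cauchy-Schwarz inequality. *)
Lemma Rintegral_clip_sqr (lam : R) : 0 < lam ->
  `|\int[leb]_(s in `]0, T]) clip C (f s) ^+ 2 - \int[leb]_(s in `[0, T]) g s ^+ 2|
    <= lam * T + C ^+ 2 / lam * eta.
Proof.
move=> l0; rewrite -Rintegral_itv_obnd_cbnd//.
have icf : leb.-integrable `]0, T] (EFin \o (fun s => clip C (f s) ^+ 2)).
  apply: (@bounded_integrable_itv _ _ _ (C ^+ 2)) => [|s sT].
    by apply: measurable_funX.
  by rewrite normrX; apply: lerXn2r; rewrite ?nnegrE//; exact: clip_bound.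
rewrite -RintegralB//.
have il : leb.-integrable `]0, T] (EFin \o (fun=> lam)).
  exact: (@bounded_integrable_itv _ _ _ `|lam|).
have iB : leb.-integrable `]0, T] (EFin \o (fun s => clip C (f s) ^+ 2 - g s ^+ 2)).
  exact: (integrableB _ icf ig).
have iZ : leb.-integrable `]0, T] (EFin \o (fun s => C ^+ 2 / lam * (f s - g s) ^+ 2)).
  exact: (integrableZl _ _ ifg).
apply: le_trans (le_normr_Rintegral _ iB) _ => //.
apply: (@le_trans _ _ (\int[leb]_(s in `]0, T]) (lam + C ^+ 2 / lam * (f s - g s) ^+ 2))).
  apply: le_Rintegral => //; [exact: (integrable_norm iB)|exact: (integrableD _ il iZ)|].
  move=> s /=; rewrite in_itv/= => sT.
  have [h _] := clip_proj (f s) (gC sT).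
  have h1 : `|clip C (f s) ^+ 2 - g s ^+ 2| <= 2 * C * `|f s - g s|.
    rewrite subr_sqr normrM mulrC; apply: ler_pM => //.
    rewrite mulr_natl mulr2n; apply: le_trans (ler_normD _ _) _.
    by apply: lerD; [exact: clip_bound|exact: gC].
  apply: le_trans h1 _; rewrite -[(f s - g s) ^+ 2]real_normK ?num_real//.
  set y := `|_ - _|; rewrite -(ler_pM2l l0).
  rewrite (_ : lam * (lam + C ^+ 2 / lam * y ^+ 2) = lam ^+ 2 + (C * y) ^+ 2); last first.
    by field; rewrite gt_eqF.
  by have := sqr_ge0 (lam - C * y); nra.
rewrite RintegralD// Rintegral_itv_cst ?(ltW T0)// subr0 lerD2l RintegralZl//.
by apply: ler_wpM2l; [rewrite divr_ge0 ?sqr_ge0// ltW|exact: Rintegral_dist_le].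
Qed.

End paths.

(** * Approximation of the price by integrals with bounded integrands *)

Section approximation.
Context (R : realType) d (Omega : measurableType d) (P : probability Omega R) (T : R)
  (F : R -> set_system Omega) (B mu sigma X : R -> Omega -> R).
Hypotheses (T0 : 0 < T) (Ffilt : is_filtration T F) (BB : brownian_motion P T F B)
  (pmu : progressive T F mu) (lmu : locally_bounded P T F mu)
  (lsigma : locally_bounded P T F sigma) (Xito : ito_process P T F B mu sigma X).
Local Notation leb := lebesgue_measure.

Definition integrated_volatility w := \int[leb]_(u in `[0, T]) sigma u w ^+ 2.

Let psigma : progressive T F sigma.
Proof. by have [_ [I []]] := Xito. Qed.

Lemma measurable_X t : 0 <= t <= T -> measurable_fun setT (X t).
Proof. by move=> tT; have [aX _] := Xito; apply: (adm_measurable Ffilt tT); exact: aX. Qed.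

Lemma measurable_integral_horizon (H : R -> Omega -> R) (K : simple_integrand R Omega) :
  progressive T F H -> si_valid T F K ->
  measurable_fun setT (fun w => \int[leb]_(s in `[0%R, T]) ((si_eval K s w - H s w) ^+ 2)%:E)%E.
Proof.
move=> pH vK.
pose g (p : R * Omega) := \1_(`[0, T]%classic) p.1 *
  (si_eval K p.1 p.2 - on_horizon T H p) ^+ 2.
have mfst (A : set R) : measurable A -> measurable_fun setT (fun p : R * Omega => \1_A p.1 : R).
  move=> mA; have mi : measurable_fun setT (\1_A : R -> R) by exact: measurable_indic.
  exact: (measurableT_comp mi measurable_fst).
have mg : measurable_fun setT g.
  apply: measurable_funM; first exact: mfst.
  apply: measurable_funX; apply: measurable_funB; last exact: (measurable_on_horizon T0 Ffilt).
  apply: measurable_sum => i; apply: measurable_funM; last exact: mfst.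
  have [rT _ aK _] := vK; have iK := ltn_ord i.
  have mc : measurable_fun setT (si_coef K i).
    exact: (adm_measurable Ffilt (rT _ (ltnW iK)) (aK _ iK)).
  exact: (measurableT_comp mc measurable_snd).
have g0 p : 0 <= g p by rewrite mulr_ge0 ?sqr_ge0.
have := measurable_integral_section mg g0; apply: eq_measurable_fun => w _.
rewrite [RHS]integral_mkcond; apply: eq_integral => s _; rewrite /g patchE indicE/=.
case: ifPn => [|_]; last by rewrite mul0r.
by rewrite inE/= in_itv/= mul1r /on_horizon/= => ->.
Qed.

Lemma measurable_integrated_volatility : measurable_fun setT integrated_volatility.
Proof.
(* The squared distance of [sigma] to the zero integrand is the squared volatility. *)
pose K : simple_integrand R Omega := SimpleIntegrand 0 (fun=> 0) (fun _ _ => 0).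
have vK : si_valid T F K.
  by split => //= [i _|]; [rewrite lexx ltW|exists 0].
have := measurable_integral_horizon psigma vK => m.
rewrite /integrated_volatility /Rintegral.
apply: measurableT_comp => //; move: m; apply: eq_measurable_fun => w _.
by apply: eq_integral => s _; rewrite /si_eval big_ord0 sub0r sqrrN.
Qed.

Lemma measurable_si_integral (K : simple_integrand R Omega) t : 0 <= t <= T ->
  si_valid T F K -> measurable_fun setT (si_integral B K t).
Proof.
move=> tT vK; have [rT _ aK [C KC]] := vK.
have C0 : 0 <= Num.max C 0 by rewrite le_max lexx orbT.
have KC' i w : (i < si_size K)%N -> `|si_coef K i w| <= Num.max C 0.
  by move=> iK; rewrite le_max KC.
have bK := bounded_ito_simple Ffilt BB vK C0 KC'.
by apply: (adm_measurable Ffilt tT); exact: (bi_adm bK tT).1.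
Qed.

Lemma near_Pout (A : nat -> set Omega) (e : R) : 0 < e -> (forall k, measurable (A k)) ->
  P (A k) @[k --> \oo] --> 0%E -> \forall k \near \oo, Pout P (A k) e.
Proof.
move=> e0 mA /fine_cvgP[_ /cvgrPdist_le /(_ e e0)]; apply: filterS => k.
rewrite sub0r normrN/= ger0_norm ?fine_ge0// => Pk.
by exists (A k); split => //; rewrite -[P _]fineK ?fin_num_measure.
Qed.

(** The order of the quantifiers is essential: [C] depends on [eps] only, whereas [J] and [Q] may
    depend on the number of times, the times and the tolerance. Comparison at finitely many times
    suffices, so convergence in probability at fixed times can be used without maximal
    inequalities. *)
Lemma ito_approximation (eps : R) : 0 < eps -> exists2 C : R, 0 <= C &
  forall (n : nat) (tau : nat -> R) (eta : R), 0 < eta ->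
  (forall j, (j <= n)%N -> 0 <= tau j <= T) ->
  exists J Q, bounded_ito P T F C J Q /\
    Pout P (~` [set w | [/\ forall k l, (k <= n)%N -> (l <= n)%N ->
         `|(X (tau l) w - X (tau k) w) - (J (tau l) w - J (tau k) w)|
           <= C * `|tau l - tau k| + eta,
       `|Q T w - Q 0 w - integrated_volatility w| <= eta &
       0 <= integrated_volatility w <= C ^+ 2 * T]]) eps.
Proof.
move=> eps0; have e4 : 0 < eps / 4 by rewrite divr_gt0.
have [Cm Cm0 Pm] := locally_bounded_Pout T0 Ffilt lmu e4.
have [Cs Cs0 Ps] := locally_bounded_Pout T0 Ffilt lsigma e4.
pose C := Num.max Cm Cs.
have CmC : Cm <= C by rewrite le_max lexx.
have CsC : Cs <= C by rewrite le_max lexx orbT.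
have C0 : 0 <= C := le_trans Cm0 CmC.
exists C => // n tau eta eta0 tauT.
have [aX [I [_ _ aI _ [Hk [vHk Henergy Hint]]] aeX]] := Xito.
pose e' := eta / 4.
have e'0 : 0 < e' by rewrite divr_gt0.
(* The first entry makes the [n.+1] exceptional probabilities from [si_integral_lenglart] add up to
   at most [eps / 8]; the second makes the error of the quadratic variation at most [eta]. *)
pose eta1 := Num.min (eps / 8 / n.+1%:R * e' ^+ 2) (eta ^+ 2 / (4 * T * (C ^+ 2 + 1))).
have eta10 : 0 < eta1.
  rewrite lt_min; apply/andP; split.
    by rewrite mulr_gt0 ?exprn_gt0// !divr_gt0.
  by rewrite divr_gt0 ?exprn_gt0// !mulr_gt0// ltr_wpDl ?sqr_ge0.
have energy : \forall k \near \oo, Pout P [set w | (eta1%:E < \int[leb]_(s in `[0%R, T])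
    ((si_eval (Hk k) s w - sigma s w) ^+ 2)%:E)%E] (eps / 4).
  apply: near_Pout => // [k|]; last exact: Henergy.
  rewrite -[X in measurable X]setTI.
  by apply: emeasurable_fun_o_infty => //; exact: measurable_integral_horizon.
have integ : \forall k \near \oo, forall j : 'I_n.+1,
    Pout P [set w | e' < `|si_integral B (Hk k) (tau j) w - I (tau j) w|] (eps / 8 / n.+1%:R).
  apply: filter_forall => j; have jT : 0 <= tau j <= T by apply: tauT; rewrite -ltnS.
  apply: near_Pout => // [|k|]; last exact: Hint.
    by rewrite !divr_gt0.
  rewrite -[X in measurable X]setTI; apply: measurable_fun_ltr => //.
  apply: measurableT_comp => //; apply: measurable_funB; first exact: measurable_si_integral.
  by apply: (adm_measurable Ffilt jT); exact: aI.
have [k [Ek Ik]] : exists k, Pout P [set w | (eta1%:E < \int[leb]_(s in `[0%R, T])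
    ((si_eval (Hk k) s w - sigma s w) ^+ 2)%:E)%E] (eps / 4) /\ forall j : 'I_n.+1,
    Pout P [set w | e' < `|si_integral B (Hk k) (tau j) w - I (tau j) w|] (eps / 8 / n.+1%:R).
  exact: (filter_ex (filterI energy integ)).
set H := Hk k in Ek Ik.
have vH : si_valid T F H by exact: vHk.
(* Clipping the coefficients clips the integrand, since at each time at most one term is present;
   the two parts add up to [H]. *)
pose Hc := si_map (clip C) H; pose Hr := si_map (fun x => x - clip C x) H.
have mclip := @measurable_clip R C.
have vHc : si_valid T F Hc.
  by apply: si_valid_map => // D; exists C => x _; exact: clip_bound.
have vHr : si_valid T F Hr.
  apply: si_valid_map => //; first by apply: measurable_funB => //; exact: measurable_id.
  move=> D; exists (D + C) => x xD; apply: le_trans (ler_normB _ _) _.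
  by apply: lerD => //; exact: clip_bound.
have bHc : bounded_ito P T F C (si_integral B Hc) (si_var Hc).
  by apply: bounded_ito_simple => // i w iH; exact: clip_bound.
exists (si_integral B Hc), (si_var Hc); split => //.
have TT : 0 <= T <= T by rewrite (ltW T0) lexx.
have lengl (j : 'I_n.+1) : Pout P [set w | si_var Hr T w <= eta1 /\
    e' < `|si_integral B Hr (tau j) w|] (eps / 8 / n.+1%:R).
  have jT : 0 <= tau j <= T by apply: tauT; rewrite -ltnS.
  apply: Pout_le (si_integral_lenglart T0 Ffilt BB vHr (ltW eta10) e'0 jT).
  by rewrite ler_pdivrMr ?exprn_gt0// ge_min lexx.
have sumE (e : R) : \sum_(j < n.+1) (e / n.+1%:R) = e.
  by rewrite sumr_const card_ord -[LHS]mulr_natr divfK// pnatr_eq0.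
have := Pout_bigU lengl; rewrite sumE => PL.
have := Pout_bigU Ik; rewrite sumE => PI.
have PX := ae_Pout aeX.
have PB := PoutU (PoutU Pm Ps) (PoutU Ek (PoutU (PoutU PL PI) PX)).
(* The shares belong, in this order, to the bounds on [mu] and [sigma], the energy, the discarded
   integrals, the convergence of the integrals, and the null set where the decomposition of [X]
   fails. *)
have epsE : eps / 4 + eps / 4 + (eps / 4 + (eps / 8 + eps / 8 + 0)) = eps by field.
rewrite epsE in PB.
apply: Pout_sub PB => w; apply: contra_notP => /not_orP[/not_orP[/contrapT wm /contrapT ws]].
move=> /not_orP[/negP wE /not_orP[/not_orP[/forallNP wL /forallNP wI] /contrapT wX]].
rewrite -leNgt in wE.
have sC u : 0 < u <= T -> `|sigma u w| <= C by move=> /ws h; exact: le_trans h CsC.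
have mC u : 0 < u <= T -> `|mu u w| <= C by move=> /wm h; exact: le_trans h CmC.
have msig := measurable_horizon_section T0 Ffilt psigma w.
have mmu := measurable_horizon_section T0 Ffilt pmu w.
pose f s := si_eval H s w.
have mf : measurable_fun `[0, T] f by apply: measurable_funTS; exact: measurable_si_eval.
have [M fM] : exists M, forall s, 0 < s <= T -> `|f s| <= M.
  exists (\sum_(i < si_size H) `|si_coef H i w|) => s _.
  apply: le_trans (ler_norm_sum _ _ _) _; apply: ler_sum => i _.
  by rewrite normrM -[leRHS]mulr1 ler_wpM2l// indic_norm_le1.
have varr : si_var Hr T w <= eta1.
  rewrite (si_var_eval w vHr).
  have r0 : 0 - clip C 0 = 0 by rewrite clip0// subr0.
  under eq_Rintegral => s _ do rewrite (si_eval_map s w r0 vH).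
  exact: (Rintegral_clip_residual C0 mf msig fM sC wE).
have JE t : si_integral B H t w - si_integral B Hc t w = si_integral B Hr t w.
  by rewrite /si_integral -sumrB; apply: eq_bigr => i _ /=; rewrite -mulrBl.
split.
- move=> k' l k'n ln.
  have dist j : (j <= n)%N -> `|I (tau j) w - si_integral B Hc (tau j) w| <= eta / 2.
    move=> jn; have jn' : (j < n.+1)%N by [].
    have := wI (Ordinal jn') => /= /negP; rewrite -leNgt => h1.
    have := wL (Ordinal jn') => /= /not_andP[//|/negP]; rewrite -leNgt -JE => h2.
    rewrite (_ : eta / 2 = e' + e'); last by rewrite /e'; field.
    apply: le_trans (ler_distD (si_integral B H (tau j) w) _ _) _.
    by apply: lerD => //; rewrite distrC.
  have kT := tauT _ k'n; have lT := tauT _ ln.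
  have drift : `|\int[leb]_(u in `[0, tau l]) mu u w - \int[leb]_(u in `[0, tau k']) mu u w|
      <= C * `|tau l - tau k'|.
    have /andP[k0 kT'] := kT; have /andP[l0 lT'] := lT.
    have [kl|/ltW lk] := lerP (tau k') (tau l).
      exact: (drift_increment mmu mC).
    by rewrite distrC; exact: (drift_increment mmu mC).
  rewrite (wX _ kT) (wX _ lT).
  have := dist _ k'n; have := dist _ ln; move: drift.
  set D1 := \int[_]_(_ in _) _; set D2 := \int[_]_(_ in _) _; set dt := C * _.
  set I1 := I (tau l) w; set I2 := I (tau k') w.
  set J1 := si_integral B Hc (tau l) w; set J2 := si_integral B Hc (tau k') w.
  move=> hD h1 h2.
  rewrite (_ : X 0 w + D1 + I1 - (X 0 w + D2 + I2) - (J1 - J2) =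
    (D1 - D2) + ((I1 - J1) - (I2 - J2))); last by ring.
  apply: le_trans (ler_normD _ _) _; apply: lerD => //.
  by apply: le_trans (ler_normB _ _) _; rewrite (splitr eta); apply: lerD.
- rewrite (_ : si_var Hc 0 w = 0); last first.
    apply: big1 => i _ /=; have iH := ltn_ord i; have [rT _ _ _] := vH.
    have /andP[r0 _] := rT _ (ltnW iH); have /andP[r0' _] := rT _ iH.
    by rewrite !min_l// subrr mulr0.
  rewrite subr0 (si_var_eval w vHc).
  under eq_Rintegral => s _ do rewrite (si_eval_map s w (clip0 C0) vH).
  (* This makes [lam * T] half of the tolerance; [eta1] was chosen so that the other term takes at
     most the other half. *)
  pose lam := eta / (2 * T).
  have lam0 : 0 < lam by rewrite divr_gt0// mulr_gt0.
  apply: le_trans (Rintegral_clip_sqr T0 C0 mf msig fM sC wE lam0) _.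
  have h : eta1 * (4 * T * (C ^+ 2 + 1)) <= eta ^+ 2.
    rewrite -ler_pdivlMr ?ge_min ?lexx ?orbT//.
    by rewrite !mulr_gt0// ltr_wpDl ?sqr_ge0.
  have h' : eta1 * (2 * T) * C ^+ 2 * 2 <= eta ^+ 2.
    apply: le_trans h; rewrite -subr_ge0.
    rewrite (_ : _ - _ = eta1 * (4 * T)); last by ring.
    by rewrite mulr_ge0 ?mulr_ge0 ?ltW.
  rewrite (_ : lam * T = eta / 2); last by rewrite /lam; field; rewrite gt_eqF.
  rewrite (_ : C ^+ 2 / lam * eta1 = (eta1 * (2 * T) * C ^+ 2) / eta); last first.
    by rewrite /lam; field; rewrite !gt_eqF.
  rewrite [leRHS](splitr eta) lerD2l ler_pdivrMr//.
  move: h'; rewrite expr2; lra.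
- exact: (Rintegral_sqr_bound T0 C0 msig sC).
Qed.

End approximation.

(** * Quadratic forms in the errors *)

Lemma measurable_sum_cond (R : realType) d (T : measurableType d) I (r : seq I) (Q : pred I)
    (f : I -> T -> R) : (forall i, measurable_fun setT (f i)) ->
  measurable_fun setT (fun x => \sum_(i <- r | Q i) f i x).
Proof.
by move=> mf; under eq_fun do rewrite big_mkcond; apply: measurable_sum => i; case: (Q i).
Qed.

Section second_moments.
Context (R : realType) d (Omega : measurableType d) (P : probability Omega R).

Lemma Ex_sqr_sum (I : finType) (Q : pred I) (z : I -> Omega -> R) :
  (forall i j, itg P (fun w => z i w * z j w)) ->
  Ex P (fun w => (\sum_(i | Q i) z i w) ^+ 2) =
  \sum_(i | Q i) \sum_(j | Q j) Ex P (fun w => z i w * z j w).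
Proof.
move=> iz.
under eq_Ex do rewrite expr2 big_distrlr/=.
rewrite Ex_sum; last by move=> i; exact: itg_sum.
by apply: eq_bigr => i _; rewrite Ex_sum.
Qed.

Lemma itg_sqr_sum (I : finType) (Q : pred I) (z : I -> Omega -> R) :
  (forall i j, itg P (fun w => z i w * z j w)) ->
  itg P (fun w => (\sum_(i | Q i) z i w) ^+ 2).
Proof.
move=> iz; under eq_fun do rewrite expr2 big_distrlr/=.
by apply: itg_sum => i; exact: itg_sum.
Qed.

Lemma Ex_sqr_orthogonal (I : finType) (Q : pred I) (z : I -> Omega -> R) :
  (forall i j, itg P (fun w => z i w * z j w)) ->
  (forall i j, Q i -> Q j -> i != j -> Ex P (fun w => z i w * z j w) = 0) ->
  Ex P (fun w => (\sum_(i | Q i) z i w) ^+ 2) = \sum_(i | Q i) Ex P (fun w => z i w ^+ 2).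
Proof.
move=> iz oz; rewrite Ex_sqr_sum//; apply: eq_bigr => i Qi.
rewrite (bigD1 i)//= big1 ?addr0 => [|j /andP[Qj ji]].
  by apply: eq_Ex => w; rewrite expr2.
by apply: oz => //; rewrite eq_sym.
Qed.

Lemma Pout_sqr (f : Omega -> R) (c lam : R) : itg P (fun w => f w ^+ 2) ->
  Ex P (fun w => f w ^+ 2) <= c -> 0 < lam ->
  Pout P [set w | lam < `|f w|] (c / lam ^+ 2).
Proof.
move=> fi fc l0.
have l20 : 0 < lam ^+ 2 by rewrite exprn_gt0.
apply: Pout_sub (Pout_markov fi (fun w => sqr_ge0 _) fc l20) => w /= Hw.
by rewrite -[ltRHS]real_normK ?num_real// ltrXn2r ?nnegrE ?(ltW l0).
Qed.

Lemma adm_generatedP (A : set_system Omega) (f : Omega -> R) :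
  adm <<s A>> f <-> measurable_fun setT (f : g_sigma_algebraType A -> R).
Proof.
by split => [af _ B mB|mf B mB]; [rewrite setTI; exact: af|
  rewrite -[X in <<s _>> X]setTI; exact: mf].
Qed.

End second_moments.
Arguments adm_generatedP {R d Omega A f}.

Section noise.
Context (R : realType) d (Omega : measurableType d) (P : probability Omega R).
Variables (n : nat) (U : nat -> Omega -> R) (T : R) (X : R -> Omega -> R).
Hypotheses (mU : forall j, measurable_fun setT (U j)) (iU : mutually_independent P n U)
  (iUX : independent_systems P (sigma_generated [set j | (j <= n)%N] U)
          (sigma_generated `[0, T] X)).
Let GX := [set X i @^-1` A | i in `[0, T]%classic & A in (measurable : set_system R)].
Let GU := [set U i @^-1` A | i in [set j | (j <= n)%N] & A in (measurable : set_system R)].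

Lemma adm_X t : 0 <= t <= T -> adm <<s GX>> (X t).
Proof. by move=> tT A mA; apply: sub_sigma_algebra; exists t => //; exists A. Qed.

Lemma adm_U j (g : R -> R) : (j <= n)%N -> measurable_fun setT g -> adm <<s GU>> (g \o U j).
Proof.
move=> jn mg A mA; apply: sub_sigma_algebra; exists j => //; exists (g @^-1` A) => //.
by rewrite -[X in measurable X]setTI; exact: mg.
Qed.

Variables (I : finType) (Q : pred I) (l k : I -> nat) (D : nat).
Hypotheses (ln : forall p, Q p -> (l p <= n)%N) (kn : forall p, Q p -> (k p <= n)%N)
  (lk : forall p, Q p -> l p != k p)
  (degD : forall j, (#|[pred p | Q p && ((l p == j) || (k p == j))]| <= D)%N).
Variables (g h : R -> R).
Hypotheses (mg : measurable_fun setT g) (mh : measurable_fun setT h)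
  (g2 : forall x, `|g x| <= 2) (h2 : forall x, `|h x| <= 2)
  (g0 : forall j, (j <= n)%N -> Ex P (fun w => g (U j w)) = 0).

Let bg : bounded_measurable g. Proof. by split => //; exists 2. Qed.
Let bh : bounded_measurable h. Proof. by split => //; exists 2. Qed.
Let psi p w := g (U (l p) w) * h (U (k p) w).

Let mgU j : measurable_fun setT (fun w => g (U j w)).
Proof. exact: (measurableT_comp mg (mU j)). Qed.
Let mhU j : measurable_fun setT (fun w => h (U j w)).
Proof. exact: (measurableT_comp mh (mU j)). Qed.
Let mpsi p : measurable_fun setT (psi p).
Proof. exact: measurable_funM. Qed.
Let psi4 p w : `|psi p w| <= 4.
Proof. by rewrite normrM (_ : 4 = 2 * 2 :> R) ?ler_pM//; ring. Qed.

Section mixed.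
Variable (q : I -> Omega -> R) (Cq : R).
Hypotheses (mq : forall p, measurable_fun setT (q p)) (aq : forall p, adm <<s GX>> (q p))
  (qC : forall p w, `|q p w| <= Cq).

Let z p w := q p w * psi p w.

Let iz p p' : itg P (fun w => z p w * z p' w).
Proof.
apply: (@itg_bounded _ _ _ P (Cq * 4 * (Cq * 4))).
  by apply: measurable_funM; exact: measurable_funM.
by move=> w; rewrite normrM; apply: ler_pM => //; rewrite normrM; apply: ler_pM.
Qed.

(** Not symmetric: only [g] is centred, so a product of two terms is known to have mean zero when
    the index [l p] of the first does not occur in the second. *)
Let touch p p' := (l p == l p') || (l p == k p').

Let Ezz p p' : Q p -> Q p' -> Ex P (fun w => z p w * z p' w) <=
  if touch p p' then 8 * (Ex P (fun w => q p w ^+ 2) + Ex P (fun w => q p' w ^+ 2)) else 0.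
Proof.
move=> Qp Qp'.
have iq2 j : itg P (fun w => q j w ^+ 2).
  apply: (@itg_bounded _ _ _ P (Cq ^+ 2)); first exact: measurable_funX.
  by move=> w; rewrite normrX; apply: lerXn2r; rewrite ?nnegrE// (le_trans _ (qC j w)).
case: ifPn => [_|]; rewrite /touch.
  rewrite -ExD// -ExZ; last exact: itgD.
  apply: Ex_le => //; first by apply: itgZ; exact: itgD.
  move=> w; apply: le_trans (ler_norm _) _; rewrite /z normrM.
  rewrite [`|q p w * _|]normrM [`|q p' w * _|]normrM.
  rewrite -[q p w ^+ 2]real_normK ?num_real// -[q p' w ^+ 2]real_normK ?num_real//.
  have := psi4 p w; have := psi4 p' w; have := normr_ge0 (psi p w); have := normr_ge0 (psi p' w).
  have := normr_ge0 (q p w); have := normr_ge0 (q p' w).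
  set a := `|q p w|; set b := `|q p' w|; set x := `|psi p w|; set y := `|psi p' w| => b0 a0 y0 x0 y4 x4.
  have xy : x * y <= 16 by rewrite (_ : 16 = 4 * 4 :> R) ?ler_pM//; ring.
  have ab : 0 <= a * b by exact: mulr_ge0.
  rewrite (_ : a * x * (b * y) = (a * b) * (x * y)); last by ring.
  apply: (le_trans (ler_wpM2l ab xy)).
  by have := sqr_ge0 (a - b); nra.
rewrite negb_or => /andP[ll lk'].
have -> : (fun w => z p w * z p' w) = (fun w => (q p w * q p' w) * (psi p w * psi p' w)).
  by apply/funext => w; rewrite /z; ring.
have iW : itg P (fun w => q p w * q p' w).
  apply: (@itg_bounded _ _ _ P (Cq * Cq)); first exact: measurable_funM.
  by move=> w; rewrite normrM ler_pM.
have iV : itg P (fun w => psi p w * psi p' w).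
  apply: (@itg_bounded _ _ _ P (4 * 4)); first exact: measurable_funM.
  by move=> w; rewrite normrM ler_pM.
have ind : indep2 P (fun w => q p w * q p' w) (fun w => psi p w * psi p' w).
  move=> A A' mA mA'; rewrite setIC muleC; apply: iUX.
    have : adm <<s GU>> (fun w => psi p w * psi p' w).
      have aU j (f : R -> R) (jn : (j <= n)%N) (mf : measurable_fun setT f) :=
        (adm_generatedP).1 (adm_U jn mf).
      apply/adm_generatedP; apply: measurable_funM; apply: measurable_funM.
      - exact: aU (ln Qp) mg.
      - exact: aU (kn Qp) mh.
      - exact: aU (ln Qp') mg.
      - exact: aU (kn Qp') mh.
    by apply.
  have : adm <<s GX>> (fun w => q p w * q p' w).
    by apply/adm_generatedP; apply: measurable_funM; apply/adm_generatedP.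
  by apply.
have [_ ->] := indep2_Ex iW iV ind.
rewrite (_ : Ex P (fun w => psi p w * psi p' w) = 0) ?mulr0//.
rewrite -[RHS](@Ex_isolated_factor _ _ _ P n U (l p) (k p) (l p') (k p') g h g h)//;
  rewrite ?ln ?kn ?lk ?g0 ?ln//.
by apply: eq_Ex => w; rewrite /psi; ring.
Qed.

(** The coefficients depend on the price only, so products of terms that do not touch have mean
    zero; the others cost at most 8 times the sum of the two squared coefficients. A pair touches at
    most [D] pairs and is touched by at most [2 D], whence 24 = 8 * 3. *)
Lemma mixed_noise_moment :
  itg P (fun w => (\sum_(p | Q p) z p w) ^+ 2) /\
  Ex P (fun w => (\sum_(p | Q p) z p w) ^+ 2) <=
    24 * D%:R * \sum_(p | Q p) Ex P (fun w => q p w ^+ 2).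
Proof.
split; first exact: itg_sqr_sum.
rewrite Ex_sqr_sum//; set e := fun p => Ex P (fun w => q p w ^+ 2).
have e0 p : 0 <= e p by apply: Ex_ge0 => w; exact: sqr_ge0.
apply: (@le_trans _ _ (\sum_(p | Q p) \sum_(p' | Q p')
    if touch p p' then 8 * (e p + e p') else 0)).
  by apply: ler_sum => p Qp; apply: ler_sum => p' Qp'; exact: Ezz.
have cnt (A : pred I) (c : R) : \sum_(p | A p) c = #|A|%:R * c.
  by rewrite sumr_const mulr_natl.
have E p p' : (if touch p p' then 8 * (e p + e p') else 0) =
    (if touch p p' then 8 * e p else 0) + (if touch p p' then 8 * e p' else 0).
  by case: ifP; rewrite ?addr0// mulrDr.
under eq_bigr => p _ do under eq_bigr => p' _ do rewrite E.
under eq_bigr => p _ do rewrite big_split/=.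
rewrite big_split/= [X in _ + X]exchange_big/=.
rewrite (_ : 24 * _ * _ = 8 * D%:R * (\sum_(p | Q p) e p) + 16 * D%:R * (\sum_(p | Q p) e p)); last by ring.
apply: lerD; rewrite mulr_sumr; apply: ler_sum => p Qp; rewrite -big_mkcondr/= cnt.
  rewrite mulrCA -mulrA ler_pM2l// ler_wpM2r// ler_nat.
  apply: leq_trans (degD (l p)); apply/subset_leq_card/fintype.subsetP => p'.
  rewrite !inE => /andP[Qp' /orP[/eqP->|/eqP->]]; by rewrite Qp' eqxx ?orbT.
rewrite (_ : 16 * D%:R * e p = (D + D)%:R * (8 * e p)); last by rewrite natrD; ring.
apply: ler_wpM2r; first by rewrite mulr_ge0.
rewrite ler_nat; apply: leq_trans (leq_add (degD (l p)) (degD (k p))).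
rewrite -cardUI; apply: leq_trans (leq_addr _ _).
apply/subset_leq_card/fintype.subsetP => p'; rewrite !inE => /andP[Qp' /orP[lp|lp]].
  by rewrite Qp' lp.
by rewrite Qp' lp orbT.
Qed.

End mixed.

(** A Chebyshev bound given the price: multiplying the coefficients by the indicator that their
    squares sum to at most [M] keeps them functions of the price, and the moment bound then holds
    with a deterministic right-hand side. *)
Lemma mixed_noise_tail (q : I -> Omega -> R) (Cq M lam : R) :
  (forall p, measurable_fun setT (q p)) -> (forall p, adm <<s GX>> (q p)) ->
  (forall p w, `|q p w| <= Cq) -> 0 <= M -> 0 < lam ->
  Pout P [set w | lam < `|\sum_(p | Q p) q p w * (g (U (l p) w) * h (U (k p) w))| /\
                  \sum_(p | Q p) q p w ^+ 2 <= M] (24 * D%:R * M / lam ^+ 2).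
Proof.
move=> mq aq qC M0 l0.
pose S w := \sum_(p | Q p) q p w ^+ 2.
pose b w : R := \1_(`]-oo, M]) (S w).
have mS : measurable_fun setT S by apply: measurable_sum_cond => p; exact: measurable_funX.
have aS : adm <<s GX>> S.
  apply/adm_generatedP; apply: measurable_sum_cond => p; apply: measurable_funX.
  by apply/adm_generatedP.
have mi : measurable_fun setT (\1_(`]-oo, M]) : R -> R) by exact: measurable_indic.
have mb : measurable_fun setT b by exact: measurableT_comp mi mS.
have ab : adm <<s GX>> b.
  move=> A mA; apply: (aS (\1_(`]-oo, M]) @^-1` A)).
  by rewrite -[X in measurable X]setTI; exact: mi.
have b1 w : `|b w| <= 1 by exact: indic_norm_le1.
pose q' p w := q p w * b w.
have mq' p : measurable_fun setT (q' p) by exact: measurable_funM.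
have aq' p : adm <<s GX>> (q' p).
  by apply/adm_generatedP; apply: measurable_funM; apply/adm_generatedP.
have qC' p w : `|q' p w| <= Cq.
  by rewrite normrM -[leRHS]mulr1; apply: ler_pM.
have [i e] := mixed_noise_moment mq' aq' qC'.
have Sq' w : \sum_(p | Q p) q' p w ^+ 2 <= M.
  under eq_bigr do rewrite exprMn; rewrite -mulr_suml -/(S w) /b indicE.
  case: (boolP (S w \in _)); last by rewrite expr0n mulr0.
  by rewrite inE/= in_itv/= expr1n mulr1.
have iq2 p : itg P (fun w => q' p w ^+ 2).
  apply: (@itg_bounded _ _ _ P (Cq ^+ 2)); first exact: measurable_funX.
  by move=> w; rewrite normrX; apply: lerXn2r; rewrite ?nnegrE// (le_trans _ (qC' p w)).
have eM : \sum_(p | Q p) Ex P (fun w => q' p w ^+ 2) <= M.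
  rewrite -Ex_sum// -[leRHS](Ex_cst P); apply: Ex_le => //; first exact: itg_sum.
  exact: itg_cst.
have {}e : Ex P (fun w => (\sum_(p | Q p) q' p w * psi p w) ^+ 2) <= 24 * D%:R * M.
  by apply: le_trans e _; rewrite ler_wpM2l// mulr_ge0.
apply: Pout_sub (Pout_sqr i e l0) => w /= [Hl HM].
have bw : b w = 1 by rewrite /b indicE mem_set//= in_itv.
by under eq_bigr do rewrite /q' bw mulr1.
Qed.

Section pure.
Variable b : I -> R.
Hypotheses (kl : forall p, Q p -> (k p < l p)%N)
  (inj : forall p p', Q p -> Q p' -> l p = l p' -> k p = k p' -> p = p').

(** With both factors centred, one index isolated in either of two pairs annihilates their
    covariance. Distinct pairs oriented by [k p < l p] always have one, so no degree enters the
    bound. *)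
Lemma pure_noise_moment :
  itg P (fun w => (\sum_(p | Q p) b p * (g (U (l p) w) * g (U (k p) w))) ^+ 2) /\
  Ex P (fun w => (\sum_(p | Q p) b p * (g (U (l p) w) * g (U (k p) w))) ^+ 2) <=
    16 * \sum_(p | Q p) b p ^+ 2.
Proof.
pose z p w := b p * (g (U (l p) w) * g (U (k p) w)).
have mz p : measurable_fun setT (z p).
  by apply: measurable_funM => //; exact: measurable_funM.
have gg p w : `|g (U (l p) w) * g (U (k p) w)| <= 4.
  by rewrite normrM (_ : 4 = 2 * 2 :> R) ?ler_pM//; ring.
have iz p p' : itg P (fun w => z p w * z p' w).
  apply: (@itg_bounded _ _ _ P ((`|b p| * 4) * (`|b p'| * 4))); first exact: measurable_funM.
  by move=> w; rewrite normrM; apply: ler_pM => //; rewrite normrM ler_wpM2l.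
split; first exact: itg_sqr_sum.
rewrite Ex_sqr_orthogonal//.
  rewrite mulr_sumr; apply: ler_sum => p Qp.
  rewrite -[leRHS](Ex_cst P); apply: Ex_le => //; first exact: (iz p p).
    exact: itg_cst.
  move=> w; rewrite /z exprMn mulrC; apply: ler_wpM2r; first exact: sqr_ge0.
  rewrite -[leLHS]real_normK ?num_real// (_ : 16 = 4 ^+ 2); last by ring.
  by apply: lerXn2r; rewrite ?nnegrE.
move=> p p' Qp Qp' pp'.
have E w : z p w * z p' w = b p * b p' *
    (g (U (l p) w) * g (U (k p) w) * (g (U (l p') w) * g (U (k p') w))).
  by rewrite /z; ring.
rewrite (eq_Ex _ E) ExZ; last first.
  apply: (@itg_bounded _ _ _ P (4 * 4)).
    by apply: measurable_funM; exact: measurable_funM.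
  by move=> w; rewrite normrM ler_pM.
have iso a b1 c e : (a <= n)%N -> (b1 <= n)%N -> (c <= n)%N -> (e <= n)%N ->
    a != b1 -> a != c -> a != e ->
    Ex P (fun w => g (U a w) * g (U b1 w) * g (U c w) * g (U e w)) = 0.
  by move=> an bn cn en ab ac ae; apply: (Ex_isolated_factor mU iU an bn cn en) => //; exact: g0.
suff -> : Ex P (fun w => g (U (l p) w) * g (U (k p) w) * (g (U (l p') w) * g (U (k p') w))) = 0.
  by rewrite mulr0.
have klp := kl Qp; have klp' := kl Qp'.
have [ll|ll] := eqVneq (l p) (l p').
  have kk : k p != k p'.
    by apply: contraNneq pp' => kk; apply/eqP; exact: inj.
  rewrite -[RHS](iso (k p) (l p) (l p') (k p'))//; rewrite ?ln ?kn// -?ll ?(ltn_eqF klp)//.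
  by apply: eq_Ex => w; ring.
(* If the larger index of [p] is the smaller one of [p'], then [l p'] exceeds the three other
   indices and is isolated; otherwise [l p] is. *)
have [lk'|lk'] := eqVneq (l p) (k p').
  rewrite -[RHS](iso (l p') (k p') (l p) (k p))//; rewrite ?ln ?kn// ?lk// 1?eq_sym//.
    by apply: eq_Ex => w; ring.
  by apply/negP => /eqP e; move: klp'; rewrite -lk' -e ltnNge ltnW.
rewrite -[RHS](iso (l p) (k p) (l p') (k p'))//; rewrite ?ln ?kn// ?lk//.
by apply: eq_Ex => w; ring.
Qed.

End pure.

Lemma linear_noise_moment (v : 'I_n.+1 -> R) :
  itg P (fun w => (\sum_(j < n.+1) v j * g (U j w)) ^+ 2) /\
  Ex P (fun w => (\sum_(j < n.+1) v j * g (U j w)) ^+ 2) <= 4 * \sum_(j < n.+1) v j ^+ 2.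
Proof.
pose z (j : 'I_n.+1) w := v j * g (U j w).
have iz p p' : itg P (fun w => z p w * z p' w).
  apply: (@itg_bounded _ _ _ P ((`|v p| * 2) * (`|v p'| * 2))).
    by apply: measurable_funM => //; exact: measurable_funM.
  by move=> w; rewrite normrM; apply: ler_pM => //; rewrite normrM ler_wpM2l.
split; first exact: itg_sqr_sum.
rewrite (Ex_sqr_orthogonal iz).
  rewrite mulr_sumr; apply: ler_sum => p Qp.
  rewrite -[leRHS](Ex_cst P); apply: Ex_le => //; first exact: (iz p p).
    exact: itg_cst.
  move=> w; rewrite /z exprMn mulrC; apply: ler_wpM2r; first exact: sqr_ge0.
  rewrite -[leLHS]real_normK ?num_real// (_ : 4 = 2 ^+ 2); last by ring.
  by apply: lerXn2r; rewrite ?nnegrE.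
move=> p p' _ _ pp'.
(* The constant function fills the two spare places of [Ex_isolated_factor]. *)
have b1 : bounded_measurable (fun=> 1 : R) by exact: bounded_measurable_cst.
have pn : (p <= n)%N by rewrite -ltnS. have pn' : (p' <= n)%N by rewrite -ltnS.
have E w : z p w * z p' w = v p * v p' * (g (U p w) * g (U p' w) * 1 * 1).
  by rewrite /z; ring.
rewrite (eq_Ex _ E) ExZ; last first.
  apply: (@itg_bounded _ _ _ P (2 * 2)).
    by do 3 apply: measurable_funM => //.
  by move=> w; rewrite !mulr1 normrM ler_pM.
rewrite (@Ex_isolated_factor _ _ _ P n U p p' p' p' g g (fun=> 1) (fun=> 1))// ?mulr0//.
exact: g0.
Qed.

End noise.

(** * The weights of G *)

Section weights.
Context {R : realType}.
Variable n : nat.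
Local Notation N := (nscales R n).
Hypothesis N2 : (1 < N)%N.

Lemma nscales_sqr : (N ^ 2 <= n.+1)%N.
Proof.
rewrite -(ler_nat R) natrX.
have h : (N%:R : R) <= Num.sqrt (n.+1%:R) by have /andP[] := truncn_itv (sqrtr_ge0 (n.+1%:R : R)).
rewrite -[leRHS]sqr_sqrtr//; apply: lerXn2r; rewrite ?nnegrE//.
Qed.

Lemma nscales_gt : n%:R < ((N%:R : R) + 1) ^+ 2.
Proof.
have h : Num.sqrt (n.+1%:R) < (N%:R : R) + 1.
  by rewrite natr1; apply: truncnS_gt.
apply: (@lt_trans _ _ (n.+1%:R)); first by rewrite ltr_nat.
rewrite -[ltLHS]sqr_sqrtr//; apply: ltrXn2r => //; rewrite ?nnegrE//.
Qed.

(* Coefficient of the unnormalised sum over lag [m] in the real part of [G]. *)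
Definition lag_weight (m : nat) : R :=
  weight R n m / m%:R + (if m == 1%N then zeta R n else 0) - (if m == 2%N then zeta R n / 2 else 0).

Local Notation NR := (N%:R : R).
Let NR2 : 2 <= NR. Proof. by rewrite ler_nat. Qed.

Let NRD0 : 0 < NR * (NR ^+ 2 - 1).
Proof. by move: NR2; move: NR => x x2; apply: mulr_gt0; [lra|nra]. Qed.

Let NR0 : NR != 0.
Proof. by rewrite pnatr_eq0 -lt0n ltnW. Qed.

Let NR1 : NR ^+ 2 - 1 != 0.
Proof. by move: NRD0; rewrite pmulr_rgt0 ?ltr0n 1?ltnW// => /gt_eqF ->. Qed.

Let NR_gt0 : 0 < NR.
Proof. by rewrite ltr0n ltnW. Qed.

Let zetaE : zeta R n = 2 / n.+1%:R.
Proof.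
rewrite /zeta /scale; have : n.+1%:R != 0 :> R by rewrite pnatr_eq0.
by move: (n.+1%:R : R) => x x0; field; rewrite x0.
Qed.

(** The weight proper contributes 6 / N^2, because [m] is within (N - 1) / 2 of the centre (N + 1) /
    2; the correction [zeta] is 2 / (n + 1), at most 2 / N^2. *)
Lemma lag_weight_bound m : (0 < m <= N)%N -> `|lag_weight m| <= 8 / N%:R ^+ 2.
Proof.
move=> /andP[m0 mN]; rewrite /lag_weight.
have m0R : m%:R != 0 :> R by rewrite pnatr_eq0 -lt0n.
have m1 : 1 <= m%:R :> R by rewrite (ler_nat R 1).
have mNR : m%:R <= NR by rewrite ler_nat.
have D0 := NRD0.
have E : weight R n m / m%:R = 12 * (m%:R - NR / 2 - 1 / 2) / (NR * (NR ^+ 2 - 1)).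
  by rewrite /weight /scale; field; rewrite m0R NR0 NR1.
have b1 : `|weight R n m / m%:R| <= 6 / NR ^+ 2.
  rewrite E normrM normfV (gtr0_norm D0) ler_pdivrMr//.
  have -> : 6 / NR ^+ 2 * (NR * (NR ^+ 2 - 1)) = 6 * (NR ^+ 2 - 1) / NR.
    by field; rewrite NR0.
  rewrite ler_pdivlMr//.
  rewrite normrM ger0_norm//.
  have : `|m%:R - NR / 2 - 1 / 2| <= (NR - 1) / 2.
    by move: m1 mNR; move: (m%:R) (NR) => x y; rewrite ler_norml; lra.
  by move: NR2; move: NR => x x2; set y := `|_|; nra.
have z0 : 0 <= zeta R n by rewrite zetaE divr_ge0.
have z1 : zeta R n <= 2 / NR ^+ 2.
  rewrite zetaE ler_pM2l// lef_pV2 ?posrE//; last by rewrite exprn_gt0.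
  by rewrite -natrX ler_nat nscales_sqr.
apply: le_trans (_ : 6 / NR ^+ 2 + zeta R n <= _); last first.
  by move: z1; move: (NR ^+ 2)^-1 => x; lra.
move: b1; set u := weight R n m / m%:R => b1.
have [e|_] := eqVneq m 1%N.
  by rewrite e/= subr0; apply: le_trans (ler_normD _ _) _; rewrite (ger0_norm z0) lerD2r.
rewrite addr0; case: ifP => _.
  apply: le_trans (ler_normB _ _) _; have z2 : 0 <= zeta R n / 2 by exact: (divr_ge0 z0).
  rewrite (ger0_norm z2).
  by apply: lerD => //; move: z0; lra.
by rewrite subr0; apply: le_trans b1 _; rewrite lerDl.
Qed.

Let sum1 (k : nat) : \sum_(i < k) (i.+1%:R : R) = k%:R * (k%:R + 1) / 2.
Proof.
elim: k => [|k ih]; first by rewrite big_ord0 mul0r mul0r.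
by rewrite big_ord_recr/= ih -!natr1; field.
Qed.

Let sum2 (k : nat) : \sum_(i < k) (i.+1%:R : R) ^+ 2 =
  k%:R * (k%:R + 1) * (2 * k%:R + 1) / 6.
Proof.
elim: k => [|k ih]; first by rewrite big_ord0 !mul0r.
by rewrite big_ord_recr/= ih -!natr1; field.
Qed.

Let sum_at (j : nat) (c : R) (F : nat -> R) : (0 < j <= N)%N ->
  \sum_(i < N) F i.+1 * (if i.+1 == j then c else 0) = F j * c.
Proof.
move=> /andP[j0 jN]; have jN' : (j.-1 < N)%N by rewrite prednK.
rewrite (bigD1 (Ordinal jN'))//= prednK// eqxx big1 ?addr0// => i.
by rewrite -val_eqE/= => ij; case: eqP => [e|]; rewrite ?mulr0//; move: ij; rewrite -e eqxx.
Qed.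

Let wE i : weight R n i.+1 / i.+1%:R = 12 / (NR * (NR ^+ 2 - 1)) * i.+1%:R
    - 12 / (NR * (NR ^+ 2 - 1)) * ((NR + 1) / 2).
Proof.
have m0R : i.+1%:R != 0 :> R by rewrite pnatr_eq0.
have D0 := NRD0.
rewrite /weight /scale; move: m0R; move: (i.+1%:R : R) => x m0R.
by field; rewrite m0R NR0 NR1.
Qed.

(** The weights linear in [m] are antisymmetric about (N + 1) / 2 and cancel; what is left is
    [zeta - zeta / 2]. *)
Lemma sum_lag_weight : \sum_(i < N) lag_weight i.+1 = n.+1%:R^-1.
Proof.
rewrite /lag_weight sumrB big_split/=.
have s1 j (c : R) : (0 < j <= N)%N -> \sum_(i < N) (if i.+1 == j then c else 0) = c.
  move=> jN; rewrite -[RHS]mul1r -(sum_at c (fun=> 1) jN).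
  by apply: eq_bigr => i _; rewrite mul1r.
rewrite (s1 1%N _ (ltnW N2)) (s1 2%N _ N2).
under eq_bigr do rewrite wE; rewrite sumrB -mulr_sumr sum1 sumr_const card_ord -mulr_natr.
have D0 := NRD0.
rewrite zetaE; have : n.+1%:R != 0 :> R by rewrite pnatr_eq0.
by move: (n.+1%:R : R) => x x0; field; rewrite x0 NR0 NR1.
Qed.

(** The correction drops out, lag 1 contributing [zeta] and lag 2 twice [- zeta / 2]; the
    normalisation by N (N^2 - 1) / 12 is the centred sum of squares of 1, ..., N. *)
Lemma sum_lag_weight1 : \sum_(i < N) i.+1%:R * lag_weight i.+1 = 1.
Proof.
under eq_bigr do rewrite /lag_weight mulrBr mulrDr.
rewrite sumrB big_split/=.
rewrite (sum_at (zeta R n) (fun j => j%:R) (j := 1%N) (ltnW N2)).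
rewrite (sum_at (zeta R n / 2) (fun j => j%:R) (j := 2%N) N2).
under eq_bigr => i _ do rewrite wE mulrBr [_ * (12 / _ * _)]mulrCA -expr2.
rewrite sumrB -mulr_sumr -mulr_suml sum1 sum2.
have D0 := NRD0.
by field; rewrite NR0 NR1.
Qed.

End weights.

Lemma card_window (n a b : nat) : #|[pred l : 'I_n | (a <= l < b)%N]| = (minn b n - a)%N.
Proof.
rewrite -sum1_card.
transitivity (\sum_(0 <= l < n | (a <= l < b)%N) 1)%N; first by rewrite big_mkord.
have -> : (\sum_(0 <= l < n | (a <= l < b)%N) 1 = \sum_(a <= l < minn b n) 1)%N.
  rewrite [RHS](big_nat_widenl a 0)//= [RHS](big_nat_widen _ _ n) ?geq_minr//=.
  rewrite [LHS]big_nat_cond [RHS]big_nat_cond; apply: eq_bigl => l.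
  by rewrite leq_min; case: (l < n)%N; rewrite ?andbT ?andbF.
by rewrite sum_nat_const_nat muln1.
Qed.

(** * Combinatorics of the lag pairs *)

Section kernel.
Context {R : realType}.
Variables (n N : nat) (beta : nat -> R).

(** The first component is the lag minus one, the second the later observation. The condition says
    that the lag does not exceed the later index, so that the truncated subtraction in [lo] is
    exact. *)
Definition lag_pair (p : 'I_N * 'I_n.+1) : bool := (p.1 < p.2)%N.
Definition hi (p : 'I_N * 'I_n.+1) : nat := p.2.
Definition lo (p : 'I_N * 'I_n.+1) : nat := (p.2 - p.1.+1)%N.
Local Notation Q := lag_pair.

Lemma hi_le p : (hi p <= n)%N. Proof. by rewrite -ltnS /hi ltn_ord. Qed.
Lemma lo_le p : (lo p <= n)%N. Proof. by apply: leq_trans (leq_subr _ _) (hi_le p). Qed.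
Lemma lo_lt_hi p : Q p -> (lo p < hi p)%N.
Proof. by rewrite /Q /lo /hi => h; lia. Qed.
Lemma hi_subn_lo p : Q p -> (hi p - lo p = p.1.+1)%N.
Proof. by rewrite /Q /lo /hi => h; lia. Qed.

Lemma lag_pair_inj p p' : Q p -> Q p' -> hi p = hi p' -> lo p = lo p' -> p = p'.
Proof.
case: p p' => [i l] [i' l']; rewrite /Q /lo /hi/= => il il' ll e.
by congr pair; apply: val_inj => //=; lia.
Qed.

Lemma sum_lag (F : nat -> nat -> R) :
  \sum_(i < N) beta i.+1 * (\sum_(i.+1 <= l < n.+1) F i.+1 l) =
  \sum_(p | Q p) beta p.1.+1 * F p.1.+1 (hi p).
Proof.
under eq_bigr do rewrite mulr_sumr big_geq_mkord.
by rewrite pair_big_dep/=.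
Qed.

(** For a given lag, the pair is determined by its later index and also by its earlier one. *)
Lemma lag_degree j : (#|[pred p | Q p && ((hi p == j) || (lo p == j))]| <= 2 * N)%N.
Proof.
have inj_card (B : pred ('I_N * 'I_n.+1)) : {in B &, injective fst} -> (#|B| <= N)%N.
  by move=> iB; rewrite -(card_in_image iB) -[leqRHS]card_ord max_card.
rewrite mul2n -addnn.
apply: (@leq_trans (#|[pred p | Q p && (hi p == j)]| + #|[pred p | Q p && (lo p == j)]|)).
  rewrite -cardUI; apply: leq_trans (leq_addr _ _); apply/subset_leq_card/fintype.subsetP => p.
  by rewrite !inE => /andP[-> /orP[->|->]]; rewrite ?orbT.
apply: leq_add; apply: inj_card => -[i l] [i' l']; rewrite !inE /Q /hi /lo/=.
  by move=> /andP[_ /eqP lj] /andP[_ /eqP lj'] ->; congr pair; apply: val_inj; rewrite /= lj.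
move=> /andP[il /eqP e] /andP[il' /eqP e'] ii; rewrite ii in il e *; congr pair.
by apply: val_inj => /=; lia.
Qed.

Definition covers (i : nat) p := (lo p <= i < hi p)%N.

(** Matrix of the quadratic form that the weighted sum of squared lag increments induces on the
    elementary increments. *)
Definition kernel i j := \sum_(p | Q p) beta p.1.+1 * ((covers i p)%:R * (covers j p)%:R).

Lemma kernelC i j : kernel i j = kernel j i.
Proof. by apply: eq_bigr => p _; rewrite [X in _ * X]mulrC. Qed.

Lemma increment_sum (J : nat -> R) p : Q p ->
  J (hi p) - J (lo p) = \sum_(i < n) (covers i p)%:R * (J i.+1 - J i).
Proof.
move=> Qp; rewrite -telescope_sumr ?(ltnW (lo_lt_hi Qp))//.
rewrite (big_nat_widen _ _ n) ?hi_le//= big_geq_mkord big_mkcond/=.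
apply: eq_bigr => i _; rewrite /covers andbC.
by case: ifP => _; rewrite ?mul1r ?mul0r.
Qed.

Lemma lag_quadratic_form (J : nat -> R) :
  \sum_(p | Q p) beta p.1.+1 * (J (hi p) - J (lo p)) ^+ 2 =
  \sum_(i < n) \sum_(j < n) kernel i j * ((J i.+1 - J i) * (J j.+1 - J j)).
Proof.
under eq_bigr => p Qp do rewrite increment_sum// expr2 big_distrlr/= mulr_sumr.
rewrite exchange_big/=; apply: eq_bigr => i _.
under eq_bigr => p Qp do rewrite mulr_sumr.
rewrite exchange_big/=; apply: eq_bigr => j _.
rewrite mulr_suml; apply: eq_bigr => p _; ring.
Qed.

Let covers_card i (m : 'I_N) : (#|[pred l : 'I_n.+1 | (m < l)%N && covers i (m, l)]| <= m.+1)%N.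
Proof.
apply: (@leq_trans #|[pred l : 'I_n.+1 | (i.+1 <= l < i.+1 + m.+1)%N]|).
  apply/subset_leq_card/fintype.subsetP => l; rewrite !inE /covers /hi /lo/= => h; lia.
by rewrite card_window; lia.
Qed.

Variable A : R.
Hypotheses (N0 : (0 < N)%N) (Nn : (N <= n)%N)
  (bA : forall m, (0 < m <= N)%N -> `|beta m| <= A).

Let A0 : 0 <= A. Proof. by apply: le_trans (bA (m := 1) _); rewrite ?N0. Qed.

(** At most [m] intervals of lag [m] contain a given increment. For weights of order N^(-2) the
    matrix is therefore bounded, whatever [n]. *)
Lemma kernel_bound i j : `|kernel i j| <= A * N%:R ^+ 2.
Proof.
apply: le_trans (ler_norm_sum _ _ _) _.
apply: (@le_trans _ _ (\sum_(m < N) \sum_(l < n.+1 | (m < l)%N && covers i (m, l)) A)).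
  rewrite pair_big_dep/= [leRHS]big_mkcond [leLHS]big_mkcond/=.
  apply: ler_sum => -[m l] _; rewrite /Q/=; case: (m < l)%N => //=.
  rewrite normrM normrM !normr_nat.
  case: (covers i _); last by rewrite mul0r mulr0.
  rewrite mul1r; apply: (@le_trans _ _ `|beta m.+1|); last by apply: bA; rewrite /= ltn_ord.
  by rewrite ler_piMr//; case: (covers j _).
rewrite (_ : A * N%:R ^+ 2 = \sum_(m < N) A * N%:R); last first.
  by rewrite sumr_const card_ord -[RHS]mulr_natr expr2 mulrA.
apply: ler_sum => m _; rewrite sumr_const -[leLHS]mulr_natr.
by apply: ler_wpM2l => //; rewrite ler_nat; apply: leq_trans (covers_card i m) _.
Qed.

Lemma kernel_far i j : (i + N <= j)%N -> kernel i j = 0.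
Proof.
move=> ij; apply: big1 => -[m l] Qp; have mN := ltn_ord m; set p := (m, l) in Qp *.
case: (boolP (covers i p)) => ci; last by rewrite mul0r mulr0.
case: (boolP (covers j p)) => cj; last by rewrite mulr0 mulr0.
by exfalso; move: Qp ci cj; rewrite /Q /covers /lo /hi /=; lia.
Qed.

(** Away from the two ends exactly [m] intervals of lag [m] contain the increment, which turns the
    diagonal coefficient into the sum of m beta_m. *)
Lemma kernel_diag i : \sum_(m < N) m.+1%:R * beta m.+1 = 1 ->
  (N <= i.+1)%N -> (i + N <= n)%N -> kernel i i = 1.
Proof.
move=> b1 Ni iN; rewrite -b1 /kernel.
transitivity (\sum_(m < N) \sum_(l < n.+1 | (m < l)%N && covers i (m, l)) beta m.+1).
  rewrite pair_big_dep/= big_mkcond/= [RHS]big_mkcond/=.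
  apply: eq_bigr => -[m l] _; rewrite /Q/=; case: (m < l)%N => //=.
  by case: (covers i _); rewrite /= ?mulr1 ?mulr0.
apply: eq_bigr => m _; rewrite sumr_const -[LHS]mulr_natl; congr (_%:R * _).
have mN := ltn_ord m.
transitivity #|[pred l : 'I_n.+1 | (i.+1 <= l < i.+1 + m.+1)%N]|; last by rewrite card_window; lia.
apply: eq_card => l; rewrite !inE /covers /hi /lo/=; lia.
Qed.

Definition edge (i : nat) : bool := (i.+1 < N)%N || (n < i + N)%N.

Lemma edge_card (k : nat) : (k <= n.+1)%N -> (#|[pred i : 'I_k | edge i]| <= 2 * N)%N.
Proof.
move=> kn; rewrite mul2n -addnn.
apply: (@leq_trans (#|[pred i : 'I_k | (0 <= i < N)%N]| + #|[pred i : 'I_k | (n.+1 - N <= i < n.+1)%N]|)).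
  rewrite -cardUI; apply: leq_trans (leq_addr _ _); apply/subset_leq_card/fintype.subsetP => i.
  have := ltn_ord i; rewrite !inE /edge; lia.
by rewrite !card_window; lia.
Qed.

(* Coefficient of the [j]-th observation in the part of the noise that is linear in the errors. *)
Definition linear_weight (j : nat) : R :=
  \sum_(m < N) beta m.+1 * ((m < j)%N%:R + (j + m.+1 <= n)%N%:R).

Lemma lag_linear_form (C : nat -> R) :
  \sum_(p | Q p) beta p.1.+1 * (C (hi p) + C (lo p)) =
  \sum_(j < n.+1) linear_weight j * C j.
Proof.
under [RHS]eq_bigr do rewrite mulr_suml.
rewrite exchange_big/=.
transitivity (\sum_(m < N) beta m.+1 * (\sum_(m.+1 <= l < n.+1) (C l + C (l - m.+1)%N))).
  by rewrite (sum_lag (fun m l => C l + C (l - m)%N)).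
apply: eq_bigr => m _.
under [RHS]eq_bigr do rewrite -mulrA mulrDl.
rewrite -mulr_sumr; congr (_ * _); rewrite !big_split/=; congr (_ + _).
  rewrite big_geq_mkord big_mkcond/=; apply: eq_bigr => j _.
  by case: ifP => _; rewrite ?mul1r ?mul0r.
rewrite -{1}(add0n m.+1) big_addn.
under eq_bigr do rewrite addnK.
rewrite big_mkord (big_ord_widen _ C (leq_subr m.+1 n.+1)) big_mkcond/=.
apply: eq_bigr => j _; have -> : (j < n.+1 - m.+1)%N = (j + m.+1 <= n)%N by have := ltn_ord m; lia.
by case: ifP => _; rewrite ?mul1r ?mul0r.
Qed.

Lemma linear_weight_bound j : `|linear_weight j| <= 2 * (A * N%:R).
Proof.
apply: le_trans (ler_norm_sum _ _ _) _.
rewrite (_ : 2 * _ = \sum_(m < N) A * 2); last first.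
  by rewrite sumr_const card_ord -[RHS]mulr_natr; ring.
apply: ler_sum => m _; rewrite normrM; apply: ler_pM => //; first by apply: bA; rewrite /= ltn_ord.
by rewrite ger0_norm ?addr_ge0//; case: (m < j)%N; case: (_ <= n)%N; rewrite /=; lra.
Qed.

Lemma linear_weight_inner j : ~~ edge j -> (N <= j)%N ->
  linear_weight j = 2 * \sum_(m < N) beta m.+1.
Proof.
rewrite negb_or -!leqNgt => /andP[_ jn] Nj; rewrite mulr_sumr; apply: eq_bigr => m _.
have mN := ltn_ord m; rewrite (_ : (m < j)%N)//; last by lia.
by rewrite (_ : (j + m.+1 <= n)%N); [rewrite /=; ring|lia].
Qed.

(** An inner observation is a later and an earlier end point for every lag, so its weight is only 2
    / (n + 1). The at most 3 N remaining ones have weights O(1/N) when [A] is of order N^(-2), and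
    the sum of squares is O(1/N). *)
Lemma sum_linear_weight_sqr : \sum_(m < N) beta m.+1 = n.+1%:R^-1 ->
  \sum_(j < n.+1) linear_weight j ^+ 2 <=
    4 / n.+1%:R + (3 * N)%:R * (2 * (A * N%:R)) ^+ 2.
Proof.
move=> bs.
(* [edge] is fitted to increments. The observation [N - 1] is not an edge index, yet it is no later
   end point for lag [N]; hence the second condition. *)
pose e (j : 'I_n.+1) := edge j || (j < N)%N.
apply: (@le_trans _ _ (\sum_(j < n.+1) ((2 / n.+1%:R) ^+ 2 +
    (if e j then (2 * (A * N%:R)) ^+ 2 else 0)))).
  apply: ler_sum => j _; case: ifPn => [_|]; rewrite /e.
    rewrite -[leLHS]real_normK ?num_real// ler_wpDl ?sqr_ge0//.
    by apply: lerXn2r; rewrite ?nnegrE ?linear_weight_bound// !mulr_ge0.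
  rewrite negb_or -leqNgt => /andP[ej Nj].
  by rewrite linear_weight_inner// bs addr0.
rewrite big_split/= -big_mkcond/= !sumr_const card_ord; apply: lerD.
  rewrite -[leLHS]mulr_natr; have : n.+1%:R != 0 :> R by rewrite pnatr_eq0.
  move: (n.+1%:R : R) => x x0; rewrite le_eqVlt; apply/orP; left; apply/eqP.
  by field.
rewrite -[leLHS]mulr_natl; apply: ler_wpM2r; first exact: sqr_ge0.
rewrite ler_nat; apply: (@leq_trans (#|[pred j : 'I_n.+1 | edge j]| + #|[pred j : 'I_n.+1 | (0 <= j < N)%N]|)).
  rewrite -cardUI; apply: leq_trans (leq_addr _ _); apply/subset_leq_card/fintype.subsetP => i.
  by rewrite !inE.
by rewrite card_window; have := edge_card (leqnn n.+1); lia.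
Qed.

(** Writing the off-diagonal part with earlier indices inside makes it a martingale transform when
    the [x i] are martingale increments. *)
Lemma sum_symmetric_split (w : nat -> nat -> R) (x : nat -> R) (k : nat) :
  (forall i j, w i j = w j i) ->
  \sum_(i < k) \sum_(j < k) w i j * (x i * x j) =
  \sum_(i < k) w i i * x i ^+ 2 + 2 * \sum_(j < k) x j * \sum_(i < j) w i j * x i.
Proof.
move=> wC; elim: k => [|k ih]; first by rewrite !big_ord0 mulr0 addr0.
under eq_bigr do rewrite big_ord_recr/=.
rewrite big_split/= [in LHS]big_ord_recr/= [X in _ + X = _]big_ord_recr/=.
rewrite [X in _ = X + _]big_ord_recr/= [X in _ = _ + 2 * X]big_ord_recr/=.
have E1 : \sum_(j < k) w k j * (x k * x j) = x k * \sum_(i < k) w i k * x i.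
  by rewrite mulr_sumr; apply: eq_bigr => j _; rewrite wC; ring.
have E2 : \sum_(j < k) w j k * (x j * x k) = x k * \sum_(i < k) w i k * x i.
  by rewrite mulr_sumr; apply: eq_bigr => j _; ring.
rewrite E1 E2 ih; ring.
Qed.

End kernel.

(** * Quadratic forms in martingale increments *)

Lemma itg_of_sqr {R : realType} {d} {Omega : measurableType d} (P : probability Omega R)
    (f : Omega -> R) : measurable_fun setT f -> itg P (fun w => f w ^+ 2) -> itg P f.
Proof.
move=> mf fi; apply: (itg_le mf (itgD (itg_cst P 1) fi)) => w.
by rewrite -[f w ^+ 2]real_normK ?num_real//; move: `|f w| (normr_ge0 (f w)) => x x0; nra.
Qed.

Section quadratic_form.
Context {R : realType} {d} {Omega : measurableType d} (P : probability Omega R).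
Variables (T : R) (F : R -> set_system Omega).
Hypothesis Ffilt : is_filtration T F.
Variables (C : R) (J Q : R -> Omega -> R).
Hypothesis JQ : bounded_ito P T F C J Q.
Variables (n : nat) (tau : nat -> R) (kappa : R).
Hypotheses (tauT : forall j, (j <= n)%N -> 0 <= tau j <= T)
  (tau_nd : forall j, (j < n)%N -> tau j <= tau j.+1)
  (tau_step : forall j, (j < n)%N -> tau j.+1 - tau j <= kappa)
  (kappa0 : 0 <= kappa).

Let tau0 j : (j <= n)%N -> 0 <= tau j. Proof. by move=> /tauT/andP[]. Qed.
Let tau1 j : (j <= n)%N -> tau j <= T. Proof. by move=> /tauT/andP[]. Qed.

Lemma grid_le i j : (i <= j)%N -> (j <= n)%N -> tau i <= tau j.
Proof.
move=> ij; rewrite -(subnKC ij); elim: (j - i)%N => [|k ih]; first by rewrite addn0.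
by rewrite addnS => h; apply: le_trans (ih (ltnW h)) (tau_nd h).
Qed.

Lemma grid_gap i j : (i <= j)%N -> (j <= n)%N -> tau j - tau i <= (j - i)%:R * kappa.
Proof.
move=> ij; rewrite -{1 2}(subnKC ij); elim: (j - i)%N => [|k ih].
  by rewrite addn0 subrr mul0r.
rewrite addnS => h; have := ih (ltnW h); have := tau_step h.
by rewrite -[k.+1%:R]natr1 mulrDl mul1r; lra.
Qed.

Local Notation B := (C ^+ 2 * kappa).
Let B0 : 0 <= B. Proof. exact: (mulr_ge0 (sqr_ge0 _) kappa0). Qed.

Definition inc i w := J (tau i.+1) w - J (tau i) w.
Definition vinc i w := Q (tau i.+1) w - Q (tau i) w.

Lemma adm_inc i j : (i < j)%N -> (j <= n)%N ->
  adm (F (tau j)) (inc i) /\ adm (F (tau j)) (vinc i).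
Proof.
move=> ij jn; have h k : (k <= j)%N -> adm (F (tau j)) (J (tau k)) /\ adm (F (tau j)) (Q (tau k)).
  move=> kj; have kn := leq_trans kj jn; have [aJ aQ] := bi_adm JQ (tauT kn).
  by split; apply: (adm_le Ffilt (tau0 kn) (grid_le kj jn) (tau1 jn)).
have [J1 Q1] := h _ ij; have [J2 Q2] := h _ (ltnW ij).
by split; apply: (admB Ffilt (tauT jn)).
Qed.

Lemma measurable_inc i : (i < n)%N ->
  measurable_fun setT (inc i) /\ measurable_fun setT (vinc i).
Proof.
by move=> ni; have [h1 h2] := adm_inc (ltnSn i) ni;
  split; apply: (adm_measurable Ffilt (tauT ni)).
Qed.

Lemma vinc_bounds i w : (i < n)%N -> 0 <= vinc i w <= B.
Proof.
move=> ni; have /andP[h1 h2] := bi_var JQ w (tau0 (ltnW ni)) (tau_nd ni) (tau1 ni).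
by rewrite /vinc h1/=; apply: le_trans h2 _; apply: (ler_wpM2l (sqr_ge0 _)); exact: tau_step.
Qed.

Lemma bounded_ito_moment2 u v : 0 <= u -> u <= v -> v <= T ->
  itg P (fun w => (J v w - J u w) ^+ 2) /\
  Ex P (fun w => (J v w - J u w) ^+ 2) <= C ^+ 2 * (v - u).
Proof.
move=> u0 uv vT.
have uT : 0 <= u <= T by rewrite u0 (le_trans uv).
have vT' : 0 <= v <= T by rewrite vT (le_trans u0).
have [_ _ i2 e2] := bi_mart JQ u0 uv vT (adm_cst Ffilt uT 1) (itg_cst P 1).
have vb w := bi_var JQ w u0 uv vT.
have [[_ aQv] [_ aQu]] := (bi_adm JQ vT', bi_adm JQ uT).
have iQ : itg P (fun w => Q v w - Q u w).
  apply: (@itg_bounded _ _ _ P (C ^+ 2 * (v - u))).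
    by apply: measurable_funB; [exact: (adm_measurable Ffilt vT')|
       exact: (adm_measurable Ffilt uT)].
  by move=> w; have /andP[h1 h2] := vb w; rewrite ger0_norm.
split; first by apply: eq_itg i2 => w; rewrite mul1r.
have -> : Ex P (fun w => (J v w - J u w) ^+ 2) = Ex P (fun w => Q v w - Q u w).
  by move: e2; under eq_Ex do rewrite mul1r; under [in RHS]eq_Ex do rewrite mul1r.
apply: (@le_trans _ _ (Ex P (fun=> C ^+ 2 * (v - u)))).
  by apply: Ex_le => //; [exact: itg_cst|move=> w; have /andP[] := vb w].
by rewrite Ex_cst.
Qed.

Lemma inc_moment2 k l : (k <= l)%N -> (l <= n)%N ->
  itg P (fun w => (J (tau l) w - J (tau k) w) ^+ 2) /\
  Ex P (fun w => (J (tau l) w - J (tau k) w) ^+ 2) <= C ^+ 2 * ((l - k)%:R * kappa).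
Proof.
move=> kl ln; have kn := leq_trans kl ln.
have [i2 e2] := bounded_ito_moment2 (tau0 kn) (grid_le kl ln) (tau1 ln).
by split => //; apply: le_trans e2 _; apply: (ler_wpM2l (sqr_ge0 _)); exact: grid_gap.
Qed.

Lemma inc_moment4 k l : (k <= l)%N -> (l <= n)%N ->
  itg P (fun w => (J (tau l) w - J (tau k) w) ^+ 4) /\
  Ex P (fun w => (J (tau l) w - J (tau k) w) ^+ 4) <=
    96 * C ^+ 4 * ((l - k)%:R * kappa) ^+ 2.
Proof.
move=> kl ln; have kn := leq_trans kl ln.
have [i4 e4] := bi_mom4 JQ (tau0 kn) (grid_le kl ln) (tau1 ln).
split => //; apply: le_trans e4 _; apply: ler_wpM2l.
  by rewrite mulr_ge0// exprn_even_ge0.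
by apply: lerXn2r; rewrite ?nnegrE ?subr_ge0 ?grid_le ?grid_gap// mulr_ge0.
Qed.

Lemma itg_inc2 i : (i < n)%N -> itg P (fun w => inc i w ^+ 2).
Proof. by move=> ni; have [] := inc_moment2 (leqnSn i) ni. Qed.

Lemma Ex_inc2 i : (i < n)%N -> Ex P (fun w => inc i w ^+ 2) <= B.
Proof. by move=> ni; have [_] := inc_moment2 (leqnSn i) ni; rewrite subSnn mul1r. Qed.

Lemma inc_martingale i xi : (i < n)%N -> adm (F (tau i)) xi -> itg P xi ->
  [/\ itg P (fun w => xi w * inc i w), Ex P (fun w => xi w * inc i w) = 0,
      itg P (fun w => xi w * inc i w ^+ 2) &
      Ex P (fun w => xi w * inc i w ^+ 2) = Ex P (fun w => xi w * vinc i w)].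
Proof.
by move=> ni ax ix; apply: (bi_mart JQ (tau0 (ltnW ni)) (tau_nd ni) (tau1 ni) ax ix).
Qed.

(** A squared increment minus the increment of the quadratic variation is a martingale difference,
    so the terms are orthogonal. The constant is 2 * 96 + 2, from the fourth moment and the squared
    compensator. *)
Lemma compensated_squares :
  itg P (fun w => (\sum_(i < n) (inc i w ^+ 2 - vinc i w)) ^+ 2) /\
  Ex P (fun w => (\sum_(i < n) (inc i w ^+ 2 - vinc i w)) ^+ 2) <= 194 * n%:R * B ^+ 2.
Proof.
pose z (i : 'I_n) w := inc i w ^+ 2 - vinc i w.
have mz (i : 'I_n) : measurable_fun setT (z i).
  have [m1 m2] := measurable_inc (ltn_ord i).
  by apply: measurable_funB => //; exact: measurable_funX.
have zb (i : 'I_n) w : z i w ^+ 2 <= 2 * inc i w ^+ 4 + 2 * B ^+ 2.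
  have /andP[v0 vB] := vinc_bounds w (ltn_ord i).
  have vB2 : vinc i w ^+ 2 <= B ^+ 2 by apply: lerXn2r; rewrite ?nnegrE.
  rewrite /z (_ : inc i w ^+ 4 = (inc i w ^+ 2) ^+ 2); last by rewrite -exprM.
  by move: (inc i w ^+ 2) (sqr_ge0 (inc i w)) => x x0; nra.
have i4 (i : 'I_n) := inc_moment4 (leqnSn i) (ltn_ord i).
have ib (i : 'I_n) : itg P (fun w => 2 * inc i w ^+ 4 + 2 * B ^+ 2).
  by apply: itgD; [apply: itgZ; exact: (i4 i).1|exact: itg_cst].
have iz2 (i : 'I_n) : itg P (fun w => z i w ^+ 2).
  apply: itg_le (ib i) _; first exact: measurable_funX.
  by move=> w; rewrite ger0_norm ?sqr_ge0.
have iz (i j : 'I_n) : itg P (fun w => z i w * z j w) by apply: itg_mul_sq.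
split; first exact: itg_sqr_sum.
have oz (i j : 'I_n) : (i < j)%N -> Ex P (fun w => z i w * z j w) = 0.
  move=> ij; have [a1 a2] := adm_inc ij (ltnW (ltn_ord j)).
  have jT := tauT (ltnW (ltn_ord j)).
  have az : adm (F (tau j)) (z i) by apply: (admB Ffilt jT) => //; apply: (admX Ffilt jT).
  have zi : itg P (z i) by exact: itg_of_sqr.
  have [_ _ i1 e1] := inc_martingale (ltn_ord j) az zi.
  have i2 : itg P (fun w => z i w * vinc j w).
    apply: (@itg_mulb _ _ _ _ B) => //; first by have [] := measurable_inc (ltn_ord j).
    by move=> w; have /andP[h1 h2] := vinc_bounds w (ltn_ord j); rewrite ger0_norm.
  by under eq_Ex do rewrite /z mulrBr; rewrite ExB// e1 subrr.
rewrite Ex_sqr_orthogonal//; last first.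
  move=> i j _ _ ij; case: (ltngtP i j) => [|ji|/val_inj e].
  - exact: oz.
  - by under eq_Ex do rewrite mulrC; exact: oz.
  - by rewrite e eqxx in ij.
apply: (@le_trans _ _ (\sum_(i < n) 194 * B ^+ 2)); last first.
  by rewrite sumr_const card_ord -[leLHS]mulr_natr le_eqVlt; apply/orP; left; apply/eqP; ring.
apply: ler_sum => i _; apply: (le_trans (Ex_le (iz2 i) (ib i) (zb i))).
have [i4i e4i] := i4 i.
rewrite ExD; [|by apply: itgZ|exact: itg_cst].
rewrite ExZ// Ex_cst; move: e4i; rewrite subSnn mul1r /inc.
move: (Ex P _) => x; rewrite (_ : B ^+ 2 = C ^+ 4 * kappa ^+ 2); [lra|ring].
Qed.

Variables (W : nat -> nat -> R) (N : nat) (K : R) (edge : pred nat).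
Hypotheses (WK : forall i j, `|W i j| <= K)
  (W_far : forall i j, (i + N <= j)%N -> W i j = 0)
  (W_diag : forall i, ~~ edge i -> W i i = 1)
  (edgeN : (#|[pred i : 'I_n | edge i]| <= 2 * N)%N).

Let K0 : 0 <= K. Proof. exact: le_trans (normr_ge0 _) (WK 0 0). Qed.

Let past j w := \sum_(i < j) W i j * inc i w.

Lemma adm_past j : (j <= n)%N -> adm (F (tau j)) (past j).
Proof.
move=> jn; apply: (adm_sum Ffilt (tauT jn)) => i _; apply: (admZ Ffilt (tauT jn)).
by have [] := adm_inc (ltn_ord i) jn.
Qed.

Let itg_incM i j : (i < n)%N -> (j < n)%N -> itg P (fun w => inc i w * inc j w).
Proof.
move=> ni nj; have [mi _] := measurable_inc ni; have [mj _] := measurable_inc nj.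
by apply: itg_mul_sq => //; exact: itg_inc2.
Qed.

(** The increments are orthogonal, and by [W_far] at most [N] of them enter with a nonzero
    coefficient. *)
Lemma past_moment j : (j <= n)%N -> itg P (fun w => past j w ^+ 2) /\
  Ex P (fun w => past j w ^+ 2) <= N%:R * (K ^+ 2 * B).
Proof.
move=> jn; have ijn (i : 'I_j) : (i < n)%N := leq_trans (ltn_ord i) jn.
have iz (i k : 'I_j) : itg P (fun w => (W i j * inc i w) * (W k j * inc k w)).
  apply: (eq_itg (f := fun w => W i j * W k j * (inc i w * inc k w))).
    by move=> w; ring.
  by apply: itgZ; exact: itg_incM.
split; first exact: itg_sqr_sum.
have o (i k : 'I_j) : (i < k)%N -> Ex P (fun w => (W i j * inc i w) * (W k j * inc k w)) = 0.
  move=> ik; rewrite (eq_Ex _ (g := fun w => (W i j * W k j) * (inc i w * inc k w))); last first.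
    by move=> w; ring.
  rewrite ExZ; last exact: itg_incM.
  have [ai _] := adm_inc ik (ltnW (ijn k)).
  have ii : itg P (inc i).
    by have [mi _] := measurable_inc (ijn i); apply: itg_of_sqr => //; exact: itg_inc2.
  by have [_ -> _ _] := inc_martingale (ijn k) ai ii; rewrite mulr0.
rewrite Ex_sqr_orthogonal//; last first.
  move=> i k _ _ ik; case: (ltngtP i k) => [|ki|/val_inj e].
  - exact: o.
  - by under eq_Ex do rewrite mulrC; exact: o.
  - by rewrite e eqxx in ik.
apply: (@le_trans _ _ (\sum_(i < j | (j - N <= i < j)%N) K ^+ 2 * B)).
  rewrite [leRHS]big_mkcond/=; apply: ler_sum => i _.
  under eq_Ex do rewrite exprMn.
  rewrite ExZ ?itg_inc2//; case: ifPn => ij; last first.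
    rewrite W_far ?expr0n ?mul0r//; move: ij (ltn_ord i); lia.
  rewrite ler_pM ?sqr_ge0 ?Ex_inc2//; first by apply: Ex_ge0 => w; exact: sqr_ge0.
  by rewrite -[leLHS]real_normK ?num_real// lerXn2r ?nnegrE.
rewrite sumr_const -[leLHS]mulr_natl ler_wpM2r//; first by rewrite mulr_ge0 ?sqr_ge0.
by rewrite ler_nat card_window; lia.
Qed.

Lemma martingale_transform_moment :
  itg P (fun w => (\sum_(j < n) inc j w * past j w) ^+ 2) /\
  Ex P (fun w => (\sum_(j < n) inc j w * past j w) ^+ 2) <=
    n%:R * (B * (N%:R * (K ^+ 2 * B))).
Proof.
have nj (j : 'I_n) := ltnW (ltn_ord j).
have mp (j : 'I_n) : measurable_fun setT (past j).
  by apply: (adm_measurable Ffilt (tauT (nj j))); exact: adm_past.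
have my (j : 'I_n) : measurable_fun setT (fun w => inc j w * past j w).
  by apply: measurable_funM => //; have [] := measurable_inc (ltn_ord j).
have ap2 (j : 'I_n) : adm (F (tau j)) (fun w => past j w ^+ 2).
  by apply: (admX Ffilt (tauT (nj j))); exact: adm_past.
have H (j : 'I_n) := inc_martingale (ltn_ord j) (ap2 j) (past_moment (nj j)).1.
have E2 (j : 'I_n) w : past j w ^+ 2 * inc j w ^+ 2 = (inc j w * past j w) ^+ 2 by ring.
have iy (j : 'I_n) : itg P (fun w => (inc j w * past j w) ^+ 2).
  by apply: eq_itg (E2 j) _; have [] := H j.
have iyy (i j : 'I_n) : itg P (fun w => (inc i w * past i w) * (inc j w * past j w)).
  exact: itg_mul_sq.
split; first exact: itg_sqr_sum.
have o (i j : 'I_n) : (i < j)%N ->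
    Ex P (fun w => (inc i w * past i w) * (inc j w * past j w)) = 0.
  move=> ij; rewrite (eq_Ex _ (g := fun w => (inc i w * past i w) * past j w * inc j w)); last first.
    by move=> w; ring.
  have jT := tauT (nj j).
  have ax : adm (F (tau j)) (fun w => (inc i w * past i w) * past j w).
    apply: (admM Ffilt jT); last exact: adm_past.
    apply: (admM Ffilt jT); first by have [] := adm_inc ij (nj j).
    apply: (adm_le Ffilt (tau0 (nj i)) (grid_le (ltnW ij) (nj j)) (tau1 (nj j))).
    exact: adm_past.
  have ix : itg P (fun w => (inc i w * past i w) * past j w).
    by apply: itg_mul_sq => //; have [] := past_moment (nj j).
  by have [_ -> _ _] := inc_martingale (ltn_ord j) ax ix.
rewrite Ex_sqr_orthogonal//; last first.
  move=> i k _ _ ik; case: (ltngtP i k) => [|ki|/val_inj e].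
  - exact: o.
  - by under eq_Ex do rewrite mulrC; exact: o.
  - by rewrite e eqxx in ik.
apply: (@le_trans _ _ (\sum_(j < n) B * (N%:R * (K ^+ 2 * B)))); last first.
  by rewrite sumr_const card_ord -[leLHS]mulr_natl.
apply: ler_sum => j _; rewrite -(eq_Ex _ (E2 j)); have [_ _ _ ->] := H j.
have [ip ep] := past_moment (nj j).
apply: (@le_trans _ _ (Ex P (fun w => B * past j w ^+ 2))); last first.
  by rewrite ExZ// ler_wpM2l.
apply: Ex_le; last 2 first.
- exact: itgZ.
- move=> w; rewrite mulrC ler_wpM2r ?sqr_ge0//.
  by have /andP[] := vinc_bounds w (ltn_ord j).
apply: (@itg_mulb _ _ _ _ B) => //; first by have [] := measurable_inc (ltn_ord j).
by move=> w; have /andP[h1 h2] := vinc_bounds w (ltn_ord j); rewrite ger0_norm.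
Qed.

Hypothesis WC : forall i j, W i j = W j i.

(** An integrable majorant lets errors of different nature be added before Markov's inequality is
    applied once. The two martingale parts S enter through 2 |S| <= e + S^2 / e, which keeps the
    majorant in terms of second moments; [e] will be the rate. [S3] collects the edge indices, where
    the diagonal of [W] may differ from 1. *)
Lemma quadratic_form_majorant (e : R) : 0 < e -> exists Z : Omega -> R,
  [/\ itg P Z, forall w, 0 <= Z w,
      forall w, `|\sum_(i < n) \sum_(j < n) W i j * (inc i w * inc j w)
                 - (Q (tau n) w - Q (tau 0) w)| <= Z w
    & Ex P Z <= 2 * e + n%:R * B ^+ 2 * (194 + N%:R * K ^+ 2) / e
                + 2 * N%:R * (K + 1) * B].
Proof.
move=> e0; have [i1 b1] := compensated_squares; have [i2 b2] := martingale_transform_moment.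
pose S1 w := \sum_(i < n) (inc i w ^+ 2 - vinc i w).
pose S2 w := \sum_(j < n) inc j w * past j w.
pose S3 w := \sum_(i < n | edge i) (K + 1) * inc i w ^+ 2.
have i3 : itg P S3.
  pose g (i : nat) w := if (i < n)%N then (K + 1) * inc i w ^+ 2 else 0.
  apply: (eq_itg (f := fun w => \sum_(i < n | edge i) g i w)) => [w|].
    by apply: eq_bigr => i _; rewrite /g ltn_ord.
  apply: itg_sum => i; apply: (eq_itg (f := fun w => (K + 1) * inc i w ^+ 2)).
    by move=> w; rewrite /g ltn_ord.
  by apply: itgZ; exact: itg_inc2.
have b3 : Ex P S3 <= 2 * N%:R * (K + 1) * B.
  rewrite /S3 Ex_sum => [|i]; last by apply: itgZ; exact: itg_inc2.
  apply: (@le_trans _ _ (\sum_(i < n | edge i) (K + 1) * B)).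
    apply: ler_sum => i _; rewrite ExZ ?itg_inc2//.
    by rewrite ler_wpM2l ?Ex_inc2// addr_ge0.
  rewrite sumr_const -[leLHS]mulr_natl -[leRHS]mulrA ler_wpM2r//.
    by rewrite mulr_ge0// addr_ge0.
  by rewrite -natrM ler_nat.
exists (fun w => ((e + e^-1 * S1 w ^+ 2) + (e + e^-1 * S2 w ^+ 2)) + S3 w).
have S30 w : 0 <= S3 w.
  by apply: sumr_ge0 => i _; apply: mulr_ge0 (sqr_ge0 _); rewrite addr_ge0.
have ei0 : 0 < e^-1 by rewrite invr_gt0.
have E0 (f : Omega -> R) w : 0 <= e^-1 * f w ^+ 2 := mulr_ge0 (ltW ei0) (sqr_ge0 _).
have j1 : itg P (fun w => e + e^-1 * S1 w ^+ 2).
  by apply: itgD; [exact: itg_cst|exact: itgZ].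
have j2 : itg P (fun w => e + e^-1 * S2 w ^+ 2).
  by apply: itgD; [exact: itg_cst|exact: itgZ].
split.
- by apply: itgD => //; exact: itgD.
- by move=> w; have := E0 S1 w; have := E0 S2 w; have := S30 w; lra.
- move=> w.
  have -> : Q (tau n) w - Q (tau 0) w = \sum_(i < n) vinc i w.
    by rewrite -(telescope_sumr (fun i => Q (tau i) w))// big_mkord.
  rewrite (@sum_symmetric_split _ W (fun i => inc i w) n WC).
  rewrite -/(S2 w).
  have -> : \sum_(i < n) W i i * inc i w ^+ 2 + 2 * S2 w - \sum_(i < n) vinc i w =
      S1 w + 2 * S2 w + \sum_(i < n) (W i i - 1) * inc i w ^+ 2.
    rewrite /S1 !sumrB.
    under [X in _ = _ + X]eq_bigr do rewrite mulrBl mul1r.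
    by rewrite sumrB; ring.
  have h3 : `|\sum_(i < n) (W i i - 1) * inc i w ^+ 2| <= S3 w.
    apply: le_trans (ler_norm_sum _ _ _) _; rewrite /S3 [leRHS]big_mkcond/=.
    apply: ler_sum => i _; case: ifPn => [_|/W_diag ->]; last by rewrite subrr mul0r normr0.
    rewrite normrM [`|_ ^+ 2|]ger0_norm ?sqr_ge0// ler_wpM2r ?sqr_ge0//.
    by apply: le_trans (ler_normB _ _) _; rewrite normr1 lerD2r.
  have amgm (x : R) : 2 * `|x| <= e + e^-1 * x ^+ 2.
    rewrite -[x ^+ 2]real_normK ?num_real//; move: `|x| => y.
    rewrite -subr_ge0 (_ : _ - _ = e^-1 * (e - y) ^+ 2); first exact: (mulr_ge0 (ltW ei0) (sqr_ge0 _)).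
    by field; rewrite gt_eqF.
  have := amgm (S1 w); have := amgm (S2 w); have := normr_ge0 (S1 w).
  move: h3 => + + + +.
  apply: (fun h h3 h0 h2 h1 => le_trans (ler_normD _ _) (lerD (le_trans (ler_normD _ _) (h h0 h2 h1)) h3)).
  by rewrite normrM (ger0_norm (ler0n _ 2)); lra.
- rewrite ExD => [||//]; last exact: itgD.
  rewrite ExD// !ExD ?ExZ ?Ex_cst//; [|exact: itg_cst|exact: itgZ|exact: itg_cst|exact: itgZ].
  have h1 : e^-1 * Ex P (fun w => S1 w ^+ 2) <= e^-1 * (194 * n%:R * B ^+ 2) by rewrite ler_wpM2l// ltW.
  have h2 : e^-1 * Ex P (fun w => S2 w ^+ 2) <= e^-1 * (n%:R * (B * (N%:R * (K ^+ 2 * B)))) by rewrite ler_wpM2l// ltW.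
  rewrite (_ : n%:R * B ^+ 2 * (194 + N%:R * K ^+ 2) / e =
    e^-1 * (194 * n%:R * B ^+ 2) + e^-1 * (n%:R * (B * (N%:R * (K ^+ 2 * B))))); last by ring.
  by lra.
Qed.

End quadratic_form.

(** * Trigonometric expansion of the noise *)

Section trigonometric_bounds.
Context {R : realType}.
Implicit Types y : R.

(** By the mean value theorem y - sin y = y (1 - cos z), and the half-angle formula turns this into
    2 y sin(z/2)^2, to which the first bound applies. *)
Lemma sinB_le y : 0 <= y -> `|sin y| <= y /\ `|y - sin y| <= y ^+ 3.
Proof.
move=> y0.
have cs x : {within `[0, x], continuous (@sin R)}.
  exact/continuous_subspaceT/continuous_sin.
have sin_le (x : R) : 0 <= x -> `|sin x| <= x.
  move=> x0; have [z _] := @MVT_segment R sin cos 0 x x0 (fun u _ => is_derive_sin u) (cs x).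
  by rewrite sin0 !subr0 => ->; rewrite normrM (ger0_norm x0) ler_piMl// cos_max.
split; first exact: sin_le.
have [z] := @MVT_segment R sin cos 0 y y0 (fun u _ => is_derive_sin u) (cs y).
rewrite sin0 !subr0 in_itv/= => /andP[z0 zy] ->.
have h0 : 0 <= z / 2 by rewrite divr_ge0.
have -> : y - cos z * y = 2 * sin (z / 2) ^+ 2 * y.
  have -> : cos z = cos ((z / 2) *+ 2) by congr cos; rewrite -mulr_natr; field.
  by rewrite cos_mulr2n cos2sin2; ring.
have s2 : sin (z / 2) ^+ 2 <= (z / 2) ^+ 2.
  by rewrite -[leLHS]real_normK ?num_real// lerXn2r ?nnegrE// sin_le.
have zy2 : z ^+ 2 <= y ^+ 2 by rewrite lerXn2r ?nnegrE.
have s0 := sqr_ge0 (sin (z / 2)).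
rewrite ger0_norm; last by rewrite mulr_ge0// mulr_ge0.
rewrite (_ : y ^+ 3 = y ^+ 2 * y) ?ler_wpM2r//; last by ring.
have -> : y ^+ 2 = z ^+ 2 + (y ^+ 2 - z ^+ 2) by ring.
have E : (z / 2) ^+ 2 = z ^+ 2 / 4 by field.
by rewrite E in s2; have := sqr_ge0 z; lra.
Qed.

Lemma one_subr_cos y : 1 - cos y = 2 * sin (`|y| / 2) ^+ 2.
Proof.
rewrite -cos_norm; have -> : cos `|y| = cos ((`|y| / 2) *+ 2) by congr cos; rewrite -mulr_natr; field.
by rewrite cos_mulr2n cos2sin2; ring.
Qed.

Lemma one_subr_cos_le y : 0 <= 1 - cos y <= y ^+ 2 / 2.
Proof.
rewrite subr_ge0 cos_le1/= one_subr_cos.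
have [h _] := sinB_le (divr_ge0 (normr_ge0 y) (ler0n R 2)).
have -> : y ^+ 2 / 2 = 2 * (`|y| / 2) ^+ 2.
  by rewrite -[y ^+ 2]real_normK ?num_real//; field.
by rewrite ler_wpM2l// -[leLHS]real_normK ?num_real// lerXn2r ?nnegrE.
Qed.

(** By the half-angle formula the left-hand side is 2 (h - sin h) (h + sin h) with h = |y| / 2. *)
Lemma cos_taylor2 y : `|cos y - 1 + y ^+ 2 / 2| <= y ^+ 4.
Proof.
have -> : cos y - 1 + y ^+ 2 / 2 = 2 * ((`|y| / 2 - sin (`|y| / 2)) * (`|y| / 2 + sin (`|y| / 2))).
  have -> : cos y - 1 = - (2 * sin (`|y| / 2) ^+ 2) by rewrite -one_subr_cos; ring.
  by rewrite -[y ^+ 2]real_normK ?num_real//; field.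
have y0 := divr_ge0 (normr_ge0 y) (ler0n R 2).
have [h1 h2] := sinB_le y0.
rewrite normrM (ger0_norm (ler0n R 2)) normrM.
have h3 : `| (`|y| / 2) + sin (`|y| / 2)| <= `|y|.
  by apply: le_trans (ler_normD _ _) _; rewrite (ger0_norm y0); lra.
have -> : y ^+ 4 = `|y| ^+ 3 * `|y|.
  rewrite (_ : y ^+ 4 = (y ^+ 2) ^+ 2); last by ring.
  by rewrite -[y ^+ 2]real_normK ?num_real//; ring.
rewrite mulrA ler_pM// ?mulr_ge0//.
have -> : `|y| ^+ 3 = 8 * (`|y| / 2) ^+ 3 by field.
by have := exprn_ge0 3 y0; lra.
Qed.

End trigonometric_bounds.

Section characteristic_function.
Context {R : realType} {d} {Omega : measurableType d} (P : probability Omega R).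
Variables (V : Omega -> R) (f : R -> R).
Hypotheses (mV : measurable_fun setT V) (fd : is_density f) (Vf : has_density P V f).

Lemma Ex_density (g : R -> R) : measurable_fun setT g -> (forall x, `|g x| <= 1) ->
  Ex P (fun w => g (V w)) = \int[lebesgue_measure]_x (g x * f x).
Proof.
move=> mg g1; have [mf f0 fi] := fd.
have fint : lebesgue_measure.-integrable setT (EFin \o f).
  apply/integrableP; split; first exact/measurable_EFinP.
  by under eq_integral => x _ do rewrite /= ger0_norm//; rewrite fi ltry.
have gfint : lebesgue_measure.-integrable setT (EFin \o (fun x => g x * f x)).
  apply: le_integrable fint => //; first by apply/measurable_EFinP; exact: measurable_funM.
  by move=> x _ /=; rewrite lee_fin normrM ler_piMl.
have ig : itg P (fun w => g (V w)) by apply: (itg_bounded_comp P mV); split => //; exists 1.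
(* The formula for nonnegative functions applies after a shift by 1, whose integral against the
   density is known. *)
have m1 : measurable_fun setT (fun x : R => g x + 1) by exact: measurable_funD.
have g0 x : 0 <= g x + 1 by have := g1 x; rewrite ler_norml; lra.
have E := ge0_integral_density mV mf f0 Vf m1 g0.
have : Ex P (fun w => g (V w) + 1) = \int[lebesgue_measure]_x (g x * f x) + 1.
  rewrite /Ex /Rintegral E.
  have -> : (\int[lebesgue_measure]_x ((g x + 1) * f x)%:E =
      \int[lebesgue_measure]_x ((g x * f x)%:E + (f x)%:E))%E.
    by apply: eq_integral => x _; rewrite mulrDl mul1r EFinD.
  rewrite integralD//= fi fineD//.
  exact: integrable_fin_num.
by rewrite ExD// ?Ex_cst; [move=> /addIr|exact: itg_cst].
Qed.

End characteristic_function.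

Section noise_tail.
Context (R : realType) d (Omega : measurableType d) (P : probability Omega R).
Variables (n : nat) (U : nat -> Omega -> R) (T : R) (X : R -> Omega -> R).
Hypotheses (mU : forall j, measurable_fun setT (U j)) (iU : mutually_independent P n U)
  (iUX : independent_systems P (sigma_generated [set j | (j <= n)%N] U)
          (sigma_generated `[0, T] X)).
Let GX := [set X i @^-1` A | i in `[0, T]%classic & A in (measurable : set_system R)].
Variables (I : finType) (Q : pred I) (l k : I -> nat).
Hypotheses (ln : forall p, Q p -> (l p <= n)%N) (kn : forall p, Q p -> (k p <= n)%N).
Variables (s c : R).
Hypotheses (cE : forall j, (j <= n)%N -> Ex P (fun w => cos (s * U j w)) = c)
  (sE : forall j, (j <= n)%N -> Ex P (fun w => sin (s * U j w)) = 0).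

Let gC (x : R) := cos (s * x) - c.
Let gS (x : R) := sin (s * x).
Let hC (x : R) := cos (s * x).
Let hc (x : R) := c.

Let mscale : measurable_fun setT (fun x : R => s * x). Proof. exact: measurable_funM. Qed.
Let mhC : measurable_fun setT hC.
Proof. by apply: (measurableT_comp _ mscale); exact: continuous_measurable_fun (@continuous_cos R). Qed.
Let mgS : measurable_fun setT gS.
Proof. by apply: (measurableT_comp _ mscale); exact: continuous_measurable_fun (@continuous_sin R). Qed.
Let mgC : measurable_fun setT gC. Proof. exact: measurable_funB. Qed.
Let mhc : measurable_fun setT hc. Proof. exact: measurable_cst. Qed.

Let icos j : itg P (fun w => cos (s * U j w)).
Proof. by apply: (itg_bounded_comp P (mU j) (g := hC)); split => //; exists 1 => x; exact: cos_max. Qed.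

Lemma cf_le1 : `|c| <= 1.
Proof.
rewrite -(cE (leq0n n)) ler_norml -[X in _ && (_ <= X)](Ex_cst P 1) -[X in (X <= _) && _](Ex_cst P (-1)).
by apply/andP; split; apply: Ex_le => //; try exact: itg_cst; move=> w; rewrite ?cos_geN1 ?cos_le1.
Qed.

Let hC2 x : `|hC x| <= 2. Proof. by apply: le_trans (cos_max _) _; lra. Qed.
Let gS2 x : `|gS x| <= 2. Proof. by apply: le_trans (sin_max _) _; lra. Qed.
Let gC2 x : `|gC x| <= 2.
Proof. by apply: le_trans (ler_normB _ _) _; have := cos_max (s * x); have := cf_le1; lra. Qed.
Let hc2 x : `|hc x| <= 2. Proof. by apply: le_trans cf_le1 _; lra. Qed.
Let gC0 j : (j <= n)%N -> Ex P (fun w => gC (U j w)) = 0.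
Proof. by move=> jn; rewrite /gC ExB ?Ex_cst ?cE ?subrr//; exact: itg_cst. Qed.

(** Addition formulas and centring of the cosines split the sum into six, each with a centred factor
    at one index: three with coefficients from [f1] and three from [f2]. Where the centred factor
    sits at [k p], the roles of the indices are exchanged; where nothing remains at the other index,
    its function is the constant [c]. *)
Lemma noise_tail (D : nat) (lk : forall p, Q p -> l p != k p)
    (degD : forall j, (#|[pred p | Q p && ((l p == j) || (k p == j))]| <= D)%N)
    (b : I -> R) (x : I -> Omega -> R) (f1 f2 : R -> R) (M lam : R) :
  (forall p, adm <<s GX>> (x p)) -> (forall p, measurable_fun setT (x p)) ->
  measurable_fun setT f1 -> measurable_fun setT f2 ->
  (forall y, `|f1 y| <= 2) -> (forall y, `|f2 y| <= 2) -> 0 <= M -> 0 < lam ->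
  Pout P [set w | 6 * lam < `|\sum_(p | Q p) b p *
       (f1 (x p w) * (cos (s * (U (l p) w - U (k p) w)) - c ^+ 2)
        - f2 (x p w) * sin (s * (U (l p) w - U (k p) w)))| /\
      \sum_(p | Q p) b p ^+ 2 * (f1 (x p w) ^+ 2 + f2 (x p w) ^+ 2) <= M]
    (6 * (24 * D%:R * M / lam ^+ 2)).
Proof.
move=> ax mx mf1 mf2 f12 f22 M0 l0.
have kl p : Q p -> k p != l p by move=> Qp; rewrite eq_sym lk.
have degD' j : (#|[pred p | Q p && ((k p == j) || (l p == j))]| <= D)%N.
  by apply: leq_trans (degD j); apply/subset_leq_card/fintype.subsetP => p; rewrite !inE orbC.
pose q (f : R -> R) p w := b p * f (x p w).
have qP (f : R -> R) (mf : measurable_fun setT f) (f2' : forall y, `|f y| <= 2) :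
    [/\ forall p, measurable_fun setT (q f p), forall p, adm <<s GX>> (q f p) &
        forall p w, `|q f p w| <= (\sum_p `|b p|) * 2].
  split=> p.
  - by apply: measurable_funM => //; exact: measurableT_comp mf (mx p).
  - apply/adm_generatedP; apply: measurable_funM => //.
    by apply: measurableT_comp mf _; apply/adm_generatedP.
  - move=> w; rewrite normrM ler_pM// (bigD1 p)//= lerDl; exact: sumr_ge0.
have [m1 a1 c1] := qP _ mf1 f12; have [m2 a2 c2] := qP _ mf2 f22.
have T1 := mixed_noise_tail mU iU iUX ln kn lk degD mgC mhC gC2 hC2 gC0 m1 a1 c1 M0 l0.
have T2 := mixed_noise_tail mU iU iUX kn ln kl degD' mgC mhc gC2 hc2 gC0 m1 a1 c1 M0 l0.
have T3 := mixed_noise_tail mU iU iUX ln kn lk degD mgS mgS gS2 gS2 sE m1 a1 c1 M0 l0.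
have T4 := mixed_noise_tail mU iU iUX ln kn lk degD mgS mhC gS2 hC2 sE m2 a2 c2 M0 l0.
have T5 := mixed_noise_tail mU iU iUX ln kn lk degD mgC mgS gC2 gS2 gC0 m2 a2 c2 M0 l0.
have T6 := mixed_noise_tail mU iU iUX kn ln kl degD' mgS mhc gS2 hc2 sE m2 a2 c2 M0 l0.
have TT := PoutU T1 (PoutU T2 (PoutU T3 (PoutU T4 (PoutU T5 T6)))).
apply: Pout_le (Pout_sub _ TT); first by rewrite le_eqVlt; apply/orP; left; apply/eqP; ring.
move=> w /= [H HM].
have HE (f : R -> R) : (forall y : R, f y ^+ 2 <= f1 y ^+ 2 + f2 y ^+ 2) -> \sum_(p | Q p) q f p w ^+ 2 <= M.
  move=> h; apply: le_trans HM; apply: ler_sum => p _; rewrite /q exprMn.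
  by apply: ler_wpM2l; [exact: sqr_ge0|exact: h].
have H1 : \sum_(p | Q p) q f1 p w ^+ 2 <= M by apply: HE => y; rewrite lerDl sqr_ge0.
have H2 : \sum_(p | Q p) q f2 p w ^+ 2 <= M by apply: HE => y; rewrite lerDr sqr_ge0.
apply: contrapT => /not_orP[n1 /not_orP[n2 /not_orP[n3 /not_orP[n4 /not_orP[n5 n6]]]]].
have le_lam (S : R) : ~ (lam < `|S| /\ \sum_(p | Q p) q f1 p w ^+ 2 <= M) -> `|S| <= lam.
  by move=> h; rewrite leNgt; apply/negP => h'; apply: h.
have le_lam2 (S : R) : ~ (lam < `|S| /\ \sum_(p | Q p) q f2 p w ^+ 2 <= M) -> `|S| <= lam.
  by move=> h; rewrite leNgt; apply/negP => h'; apply: h.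
move/le_lam: n1 => n1; move/le_lam: n2 => n2; move/le_lam: n3 => n3.
move/le_lam2: n4 => n4; move/le_lam2: n5 => n5; move/le_lam2: n6 => n6.
move: H; apply/negP; rewrite -leNgt.
have -> : \sum_(p | Q p) b p *
       (f1 (x p w) * (cos (s * (U (l p) w - U (k p) w)) - c ^+ 2)
        - f2 (x p w) * sin (s * (U (l p) w - U (k p) w))) =
    \sum_(p | Q p) q f1 p w * (gC (U (l p) w) * hC (U (k p) w))
  + \sum_(p | Q p) q f1 p w * (gC (U (k p) w) * hc (U (l p) w))
  + \sum_(p | Q p) q f1 p w * (gS (U (l p) w) * gS (U (k p) w))
  - \sum_(p | Q p) q f2 p w * (gS (U (l p) w) * hC (U (k p) w))
  + \sum_(p | Q p) q f2 p w * (gC (U (l p) w) * gS (U (k p) w))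
  + \sum_(p | Q p) q f2 p w * (gS (U (k p) w) * hc (U (l p) w)).
  rewrite -!big_split/= -sumrB -!big_split/=; apply: eq_bigr => p _.
  by rewrite (mulrBr s) cosB sinB /q /gC /gS /hC /hc; ring.
move: n1 n2 n3 n4 n5 n6; rewrite !ler_norml; lra.
Qed.

(** With deterministic coefficients the noise is the sum of two orthogonal quadratic forms, in
    centred cosines and in sines, and of a linear form. Collected by observation, the linear form
    has the coefficients [v], whose cancellations a bound pair by pair would lose. *)
Lemma pure_noise_tail (b : I -> R) (v : 'I_n.+1 -> R) (lam : R)
    (kl : forall p, Q p -> (k p < l p)%N)
    (inj : forall p p', Q p -> Q p' -> l p = l p' -> k p = k p' -> p = p') :
  (forall w, \sum_(p | Q p) b p * (gC (U (l p) w) + gC (U (k p) w)) =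
             \sum_(j < n.+1) v j * gC (U j w)) -> 0 < lam ->
  Pout P [set w | 3 * lam < `|\sum_(p | Q p) b p *
       (cos (s * (U (l p) w - U (k p) w)) - c ^+ 2)|]
    ((32 * \sum_(p | Q p) b p ^+ 2 + 4 * \sum_(j < n.+1) v j ^+ 2) / lam ^+ 2).
Proof.
move=> vE l0; have lk p : Q p -> l p != k p by move=> /kl; rewrite neq_ltn orbC => ->.
have [i1 e1] := pure_noise_moment mU iU ln kn lk mgC gC2 gC0 b kl inj.
have [i2 e2] := pure_noise_moment mU iU ln kn lk mgS gS2 sE b kl inj.
have [i3 e3] := linear_noise_moment mU iU mgC gC2 gC0 v.
have TT := PoutU (Pout_sqr i1 e1 l0) (PoutU (Pout_sqr i2 e2 l0) (Pout_sqr i3 e3 l0)).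
apply: Pout_le (Pout_sub _ TT).
  by rewrite le_eqVlt; apply/orP; left; apply/eqP; ring.
move=> w /= H.
apply: contrapT => /not_orP[n1 /not_orP[n2 n3]].
move: n1 n2 n3 => /negP; rewrite -leNgt => n1 /negP; rewrite -leNgt => n2 /negP; rewrite -leNgt => n3.
move: H; apply/negP; rewrite -leNgt.
have -> : \sum_(p | Q p) b p * (cos (s * (U (l p) w - U (k p) w)) - c ^+ 2) =
    \sum_(p | Q p) b p * (gC (U (l p) w) * gC (U (k p) w))
  + \sum_(p | Q p) b p * (gS (U (l p) w) * gS (U (k p) w))
  + c * \sum_(j < n.+1) v j * gC (U j w).
  rewrite -vE mulr_sumr -!big_split/=; apply: eq_bigr => p _.
  by rewrite (mulrBr s) cosB /gC /gS; ring.
have n4 : `|c * \sum_(j < n.+1) v j * gC (U j w)| <= lam.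
  by rewrite normrM; apply: le_trans n3; rewrite ler_piMl// cf_le1.
by move: n1 n2 n4; rewrite !ler_norml; lra.
Qed.

End noise_tail.

(** * Boundedness in probability *)

Section bounded_in_probability.
Context {R : realType} {d} {Omega : measurableType d} (P : probability Omega R).
Implicit Types (a b : nat -> R) (Z S V : nat -> Omega -> R).

(** The notion [bigOp] with measurable supersets in place of the events, so that intermediate
    quantities need no measurability. *)
Definition Op a Z : Prop := forall e : R, 0 < e -> exists2 M : R, 0 < M &
  \forall n \near \oo, Pout P [set w | M * a n < `|Z n w|] e.

Lemma Op_le (K : R) a a' Z Z' : 0 < K -> Op a Z ->
  (\forall n \near \oo, forall w, `|Z' n w| <= `|Z n w|) ->
  (\forall n \near \oo, a n <= K * a' n) -> Op a' Z'.
Proof.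
move=> K0 OZ ZZ aa e e0; have [M M0 HM] := OZ _ e0; exists (M * K); first exact: mulr_gt0.
near=> n; have H : Pout P [set w | M * a n < `|Z n w|] e by near: n.
apply: Pout_sub H => w /= h.
have h1 : `|Z' n w| <= `|Z n w| by move: w h; near: n; apply: filterS ZZ => n h w _; exact: h.
have h2 : a n <= K * a' n by near: n.
apply: le_lt_trans (lt_le_trans h h1).
by rewrite -mulrA ler_wpM2l// ltW.
Unshelve. all: by end_near. Qed.

Lemma Op_near a Z Z' : Op a Z -> (\forall n \near \oo, forall w, `|Z' n w| <= `|Z n w|) -> Op a Z'.
Proof. by move=> OZ ZZ; apply: (Op_le ltr01 OZ ZZ); near=> n; rewrite mul1r.
Unshelve. all: by end_near. Qed.

Lemma Op_rate (K : R) a a' Z : 0 < K -> Op a Z ->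
  (\forall n \near \oo, a n <= K * a' n) -> Op a' Z.
Proof. by move=> K0 OZ; apply: (Op_le K0 OZ); near=> n.
Unshelve. all: by end_near. Qed.

Lemma OpD a Z Z' : Op a Z -> Op a Z' -> Op a (fun n w => Z n w + Z' n w).
Proof.
move=> OZ OZ' e e0; have e20 : 0 < e / 2 by rewrite divr_gt0.
have [M M0 HM] := OZ _ e20; have [M' M'0 HM'] := OZ' _ e20.
exists (M + M'); first exact: addr_gt0.
near=> n.
have H : Pout P [set w | M * a n < `|Z n w|] (e / 2) by near: n.
have H' : Pout P [set w | M' * a n < `|Z' n w|] (e / 2) by near: n.
have := PoutU H H'; rewrite -splitr; apply: Pout_sub => w /= h.
apply: contrapT => /not_orP[/negP h1 /negP h2].
rewrite -leNgt in h1; rewrite -leNgt in h2.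
by move: h; apply/negP; rewrite -leNgt (le_trans (ler_normD _ _))// mulrDl lerD.
Unshelve. all: by end_near. Qed.

Lemma Op_sum (I : Type) (r : seq I) a (Z : I -> nat -> Omega -> R) :
  (forall i, Op a (Z i)) -> (\forall n \near \oo, 0 <= a n) ->
  Op a (fun n w => \sum_(i <- r) Z i n w).
Proof.
move=> OZ a0; elim: r => [|i r ih].
  move=> e e0; exists 1 => //; near=> n.
  rewrite (_ : [set w | _] = set0); last first.
    apply/seteqP; split => w //=; rewrite big_nil normr0 mul1r ltNge => /negP; apply.
    by near: n.
  by exists set0; split => //; rewrite measure0 lee_fin ltW.
have -> : (fun n w => \sum_(j <- i :: r) Z j n w) =
    (fun n w => Z i n w + \sum_(j <- r) Z j n w).
  by apply/funext => n; apply/funext => w; rewrite big_cons.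
exact: OpD.
Unshelve. all: by end_near. Qed.

Lemma OpZ (c : R) a Z : Op a Z -> (\forall n \near \oo, 0 <= a n) ->
  Op a (fun n w => c * Z n w).
Proof.
move=> OZ a0 e e0; have [M M0 HM] := OZ _ e0.
have c0 : 0 <= `|c| by [].
exists ((`|c| + 1) * M); first by rewrite mulr_gt0// ltr_wpDl.
near=> n; have H : Pout P [set w | M * a n < `|Z n w|] e by near: n.
have an0 : 0 <= a n by near: n.
apply: Pout_sub H => w /=; rewrite normrM -mulrA => h; rewrite ltNge; apply/negP => h'.
move: h; apply/negP; rewrite -leNgt.
apply: ler_pM => //; by rewrite lerDl.
Unshelve. all: by end_near. Qed.

Lemma Op_bounded_mul a Z Z' : Op (fun=> 1) Z -> Op a Z' -> (\forall n \near \oo, 0 <= a n) ->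
  Op a (fun n w => Z n w * Z' n w).
Proof.
move=> OZ OZ' a0 e e0; have e20 : 0 < e / 2 by rewrite divr_gt0.
have [M M0 HM] := OZ _ e20; have [M' M'0 HM'] := OZ' _ e20.
exists (M * M'); first exact: mulr_gt0.
near=> n.
have H : Pout P [set w | M * 1 < `|Z n w|] (e / 2) by near: n.
have H' : Pout P [set w | M' * a n < `|Z' n w|] (e / 2) by near: n.
have an0 : 0 <= a n by near: n.
have := PoutU H H'; rewrite -splitr; apply: Pout_sub => w /= h.
apply: contrapT => /not_orP[/negP h1 /negP h2].
rewrite -leNgt mulr1 in h1; rewrite -leNgt in h2.
by move: h; apply/negP; rewrite -leNgt normrM -mulrA ler_pM.
Unshelve. all: by end_near. Qed.

(** Markov's inequality off an exceptional event. The majorant and its constant may depend on [e],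
    as they do through the localization bound. *)
Lemma Op_majorant a Z : (\forall n \near \oo, 0 < a n) ->
  (forall e : R, 0 < e -> exists2 K : R, 0 < K & \forall n \near \oo,
     exists Z' : Omega -> R, [/\ itg P Z', forall w, 0 <= Z' w, Ex P Z' <= K * a n
       & Pout P (~` [set w | `|Z n w| <= Z' w + K * a n]) e]) -> Op a Z.
Proof.
move=> a0 H e e0; have e20 : 0 < e / 2 by rewrite divr_gt0.
have [K K0 HK] := H _ e20.
have KK0 : 0 < K / (e / 2) by rewrite divr_gt0.
exists (K / (e / 2) + K); first exact: addr_gt0.
near=> n.
have an0 : 0 < a n by near: n.
have [Z' [iZ Z0 EZ PZ]] : exists Z' : Omega -> R, [/\ itg P Z', forall w, 0 <= Z' w, Ex P Z' <= K * a n
       & Pout P (~` [set w | `|Z n w| <= Z' w + K * a n]) (e / 2)] by near: n.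
have Ma : 0 < K / (e / 2) * a n by rewrite mulr_gt0.
have := PoutU (Pout_markov iZ Z0 EZ Ma) PZ.
have -> : K * a n / (K / (e / 2) * a n) + e / 2 = e.
  by field; rewrite !gt_eqF.
apply: Pout_sub => w /= h; apply: contrapT => /not_orP[/negP h1 /contrapT h2].
rewrite -leNgt in h1; move: h; apply/negP; rewrite -leNgt mulrDl.
by apply: le_trans h2 _; rewrite lerD2r.
Unshelve. all: by end_near. Qed.

(** [c n * V n] plays the part of a random conditional variance of [S n]: if it is of order a^2 in
    probability, then [S] is of order [a]. *)
Lemma Op_conditional (K : R) a b (c : nat -> R) S V : 0 <= K -> Op b V ->
  (\forall n \near \oo, [/\ 0 < a n, 0 <= b n & c n * b n <= K * a n ^+ 2]) ->
  (\forall n \near \oo, forall M lam : R, 0 <= M -> 0 < lam ->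
     Pout P [set w | lam < `|S n w| /\ `|V n w| <= M] (c n * M / lam ^+ 2)) -> Op a S.
Proof.
move=> K0 OV abc SV e e0; have e20 : 0 < e / 2 by rewrite divr_gt0.
have [M M0 HM] := OV _ e20.
(* The tail bound is K M / L^2; since L is at least 1, L^2 is at least L, hence at least K M / (e /
   2). *)
pose L := 1 + K * M / (e / 2).
have KM0 : 0 <= K * M / (e / 2) by rewrite !mulr_ge0 ?invr_ge0 ?(ltW M0)// ltW.
have L1 : 1 <= L by rewrite lerDl.
have L0 : 0 < L by exact: lt_le_trans L1.
exists L => //; near=> n.
have [an0 bn0 abn] : [/\ 0 < a n, 0 <= b n & c n * b n <= K * a n ^+ 2] by near: n.
have H1 : Pout P [set w | M * b n < `|V n w|] (e / 2) by near: n.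
have H2 : Pout P [set w | L * a n < `|S n w| /\ `|V n w| <= M * b n]
    (c n * (M * b n) / (L * a n) ^+ 2).
  have : forall M lam : R, 0 <= M -> 0 < lam ->
     Pout P [set w | lam < `|S n w| /\ `|V n w| <= M] (c n * M / lam ^+ 2) by near: n.
  by apply; [rewrite mulr_ge0// ltW|rewrite mulr_gt0].
have h : c n * (M * b n) / (L * a n) ^+ 2 <= e / 2.
  rewrite ler_pdivrMr; last by rewrite exprn_gt0// mulr_gt0.
  apply: (@le_trans _ _ (M * (K * a n ^+ 2))).
    by rewrite mulrCA ler_wpM2l// ltW.
  rewrite exprMn mulrA [leRHS]mulrA ler_wpM2r ?sqr_ge0//.
  have -> : M * K = e / 2 * (L - 1) by rewrite /L; field; rewrite gt_eqF.
  by rewrite ler_wpM2l// ?(ltW e20)//; nra.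
have := PoutU (Pout_le h H2) H1; rewrite -splitr; apply: Pout_sub => w /= hw.
apply: contrapT => /not_orP[h1 /negP h2]; apply: h1; split => //.
by rewrite leNgt.
Unshelve. all: by end_near. Qed.

Lemma Op_tail (K : R) a (c : nat -> R) S : 0 <= K ->
  (\forall n \near \oo, 0 < a n /\ c n <= K * a n ^+ 2) ->
  (\forall n \near \oo, forall lam : R, 0 < lam ->
     Pout P [set w | lam < `|S n w|] (c n / lam ^+ 2)) ->
  (\forall n \near \oo, 0 <= c n) -> Op a S.
Proof.
move=> K0 ac Sc c0; apply: (@Op_conditional K a (fun=> 1) c S (fun _ _ => 1)) => //.
- move=> e e0; exists 1 => //; near=> n.
  rewrite (_ : [set w | _] = set0); first by exists set0; split => //; rewrite measure0 lee_fin ltW.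
  by apply/seteqP; split => w //=; rewrite mulr1 normr1 ltxx.
- near=> n; have [] : 0 < a n /\ c n <= K * a n ^+ 2 by near: n.
  by rewrite mulr1.
near=> n => M lam M0 lam0.
have H : Pout P [set w | lam < `|S n w|] (c n / lam ^+ 2).
  by move: lam lam0 {M0}; near: n.
have cn0 : 0 <= c n by near: n.
(* Here the role of [V] is played by the constant 1: for [M] below 1 the event is empty. *)
have [M1|M1] := leP 1 M.
  apply: Pout_le (Pout_sub _ H); last by move=> w [].
  by rewrite ler_wpM2r ?invr_ge0 ?sqr_ge0// ler_peMr.
rewrite (_ : [set w | _] = set0).
  by exists set0; split => //; rewrite measure0 lee_fin divr_ge0 ?sqr_ge0// mulr_ge0.
by apply/seteqP; split => w //= [_]; rewrite normr1 leNgt M1.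
Unshelve. all: by end_near. Qed.

End bounded_in_probability.

(** * Orders of magnitude of the number of scales and of the mesh *)

Section rates.
Context {R : realType}.
Local Notation r := (rate R).

Lemma rate_gt0 n : (0 < n)%N -> 0 < r n.
Proof. by move=> n0; rewrite powR_gt0// ltr0n. Qed.

Lemma rate4 n : r n ^+ 4 = n%:R^-1.
Proof.
rewrite /rate powRN exprVn; congr (_^-1).
by rewrite -powR_mulrn ?powR_ge0// -powRrM mulVf ?powRr1// pnatr_eq0.
Qed.

Lemma rate_le1 n : (0 < n)%N -> r n <= 1.
Proof.
move=> n0; rewrite leNgt; apply/negP => r1.
have : 1 < r n ^+ 4 by rewrite exprn_egt1.
by rewrite rate4 ltNge invf_le1 ?ltr0n// ler1n n0.
Qed.

Lemma rate_small (e : R) : 0 < e -> \forall n \near \oo, r n <= e.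
Proof.
move=> e0; near=> n; have n0 : (0 < n)%N by near: n; exact: nbhs_infty_gt.
have h : (e ^+ 4)^-1 <= n%:R by near: n; exact: nbhs_infty_ger.
rewrite -(@ler_pXn2r _ 4) ?nnegrE ?(ltW (rate_gt0 _)) ?(ltW e0)// rate4.
by rewrite invf_ple ?posrE ?exprn_gt0 ?ltr0n.
Unshelve. all: by end_near. Qed.

(** From [n = 3] on there are at least two scales, so that the denominator of the weights is nonzero
    and both corrected lags occur. *)
Lemma nscales_rate n : (2 < n)%N -> let N := nscales R n in
  [/\ (1 < N)%N, (N <= n)%N, N%:R * r n ^+ 2 <= 2 & 1 <= 2 * N%:R * r n ^+ 2].
Proof.
move=> n2 N.
have n0 : (0 < n)%N by lia.
have nR : 0 < n%:R :> R by rewrite ltr0n.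
have N1 : (1 < N)%N.
  rewrite /N /nscales truncn_ge_nat ?sqrtr_ge0// -[leLHS](ger0_norm (ler0n R 2)) -sqrtr_sqr -natrX ler_sqrt// ler_nat.
  by lia.
have NN : (N ^ 2 <= n.+1)%N := nscales_sqr n.
have Nn : n%:R < (N%:R + 1) ^+ 2 :> R := nscales_gt n.
have rr : (r n ^+ 2) ^+ 2 = n%:R^-1 by rewrite -exprM rate4.
have r2 : 0 <= r n ^+ 2 := sqr_ge0 _.
split => //; first by nia.
  have h : (N%:R * r n ^+ 2) ^+ 2 <= 2 ^+ 2.
    by rewrite exprMn rr ler_pdivrMr// -!natrX -natrM ler_nat; lia.
  by move: h; rewrite ler_pXn2r ?nnegrE ?(mulr_ge0 _ r2).
have h : 1 ^+ 2 <= (2 * N%:R * r n ^+ 2) ^+ 2.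
  rewrite expr1n exprMn rr ler_pdivlMr// mul1r.
  apply: le_trans (ltW Nn) _; rewrite lerXn2r ?nnegrE ?mulr_ge0 ?addr_ge0//.
  by rewrite (_ : 2 * N%:R = N%:R + N%:R) ?lerD2l ?ler1n ?(ltnW N1)//; ring.
by move: h; rewrite ler_pXn2r ?nnegrE ?(mulr_ge0 _ r2)// mulr_ge0.
Qed.

End rates.

Section grids.
Context {R : realType} (T : R) (T0 : 0 < T) (t : nat -> nat -> R).
Hypotheses (t_grid : forall n, (0 < n)%N -> is_grid T n (t n))
  (t_regular : asymp (R := R) (fun n => min_step n (t n)) (fun n => max_step n (t n))).

Lemma grid_mono n i j : (0 < n)%N -> (i <= j)%N -> (j <= n)%N -> t n i <= t n j.
Proof.
move=> n0 ij; have [_ _ tS] := t_grid n0.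
rewrite -(subnKC ij); elim: (j - i)%N => [|k ih]; first by rewrite addn0.
by rewrite addnS => h; apply: le_trans (ih (ltnW h)) (ltW (tS _ h)).
Qed.

Lemma grid_in n j : (0 < n)%N -> (j <= n)%N -> 0 <= t n j <= T.
Proof.
move=> n0 jn; have [h1 h2 _] := t_grid n0.
by rewrite -{1}h1 -h2 !grid_mono.
Qed.

(** The smallest step is at most [T / n], and regularity bounds the largest by a multiple of it. *)
Lemma grid_step : exists2 K : R, 0 < K &
  forall n j, (0 < n)%N -> (j < n)%N -> t n j.+1 - t n j <= K / n%:R.
Proof.
have [c1 [c2 [c10 _ H]]] := t_regular.
exists (T / c1); first by rewrite divr_gt0.
move=> n j n0 jn; have [t0 tn tS] := t_grid n0.
have nR : 0 < n%:R :> R by rewrite ltr0n.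
have le_max i : (i < n)%N -> t n i.+1 - t n i <= max_step n (t n).
  move=> ni; apply: (@le_bigmax_seq _ _ _ _ _ i.+1 xpredT (fun j => t n j - t n j.-1)) => //.
  by rewrite mem_index_iota.
have ge_min i : (i < n)%N -> min_step n (t n) <= t n i.+1 - t n i.
  move=> ni; apply: (@ge_bigmin_seq _ _ _ _ _ i.+1 xpredT (fun j => t n j - t n j.-1)) => //.
  by rewrite mem_index_iota.
have max0 : 0 < max_step n (t n) by apply: lt_le_trans (le_max _ n0); rewrite subr_gt0 tS.
have /andP[+ _] := H n n0; rewrite ler_pdivlMr// => c1m.
have minT : n%:R * min_step n (t n) <= T.
  rewrite -tn -[leRHS]subr0 -t0 -(telescope_sumr (t n))// big_mkord.
  rewrite -[n in n%:R]card_ord mulr_natl -sumr_const; apply: ler_sum => i _.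
  exact: ge_min.
apply: le_trans (le_max _ jn) _.
rewrite ler_pdivlMr// ler_pdivlMr//.
by apply: le_trans minT; rewrite mulrC mulrA [c1 * _]mulrC mulrC ler_wpM2l// 1?mulrC// ltW.
Qed.

End grids.

Lemma bigminn_le (I : eqType) (s : seq I) (F : I -> nat) (x : nat) (i : I) : i \in s ->
  (\big[minn/x]_(j <- s) F j <= F i)%N.
Proof.
elim: s => // a s ih; rewrite inE big_cons => /orP[/eqP->|/ih h]; first exact: geq_minl.
by apply: leq_trans (geq_minr _ _) h.
Qed.

(** The two correction terms are absorbed into the weights of lags 1 and 2; the factor 1/2 at lag 2
    is the normalisation of [phi_hat]. *)
Lemma Re_G (R : realType) (n : nat) (Y : nat -> R) (s : R) : (1 < nscales R n)%N ->
  complex.Re (G n Y s) = \sum_(p : 'I_(nscales R n) * 'I_n.+1 | lag_pair p)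
    lag_weight (R := R) n p.1.+1 * cos (s * (Y (hi p) - Y (lo p))).
Proof.
move=> N2.
have Re_phi K : complex.Re (phi_hat n Y K s) =
    K%:R^-1 * \sum_(K <= l < n.+1) cos (s * (Y l - Y (l - K)%N)).
  rewrite /phi_hat.
  have -> : (K%:R^-1 : R[i]) = Complex (K%:R^-1) 0 by rewrite -(rmorph_nat (real_complex R)) -fmorphV.
  have -> : \sum_(K <= l < n.+1) cexpi (s * (Y l - Y (l - K)%N)) =
     Complex (\sum_(K <= l < n.+1) cos (s * (Y l - Y (l - K)%N)))
             (\sum_(K <= l < n.+1) sin (s * (Y l - Y (l - K)%N))).
    by elim/big_ind3 : _ => // a1 b1 c1 a2 b2 c2 -> ->.
  by rewrite /= mul0r subr0.
have ReZ (a : R) (z : R[i]) : complex.Re (Complex a 0 * z) = a * complex.Re z.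
  by case: z => x y /=; rewrite mul0r subr0.
rewrite -(sum_lag n (nscales R n) (lag_weight (R := R) n) (fun m l => cos (s * (Y l - Y (l - m)%N)))).
pose c m := \sum_(m <= l < n.+1) cos (s * (Y l - Y (l - m)%N)).
rewrite /G raddfD/= raddf_sum/= ReZ raddfB/= !Re_phi.
under eq_bigr do rewrite ReZ Re_phi mulrA.
rewrite -/(c 1%N) -/(c 2%N).
rewrite (eq_bigr (fun i : 'I_(nscales R n) => weight R n i.+1 / i.+1%:R * c i.+1 +
  (if i.+1 == 1%N then zeta R n else 0) * c i.+1 - (if i.+1 == 2%N then zeta R n / 2 else 0) * c i.+1)); last first.
  by move=> i _; rewrite -/(c i.+1) /lag_weight mulrBl mulrDl.
rewrite sumrB big_split/= -addrA; congr (_ + _).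
  by rewrite big_add1 big_mkord.
rewrite /scale invr1 mul1r mulrBr; congr (_ - _).
  rewrite (bigD1 (Ordinal (ltnW N2)))//= big1 ?addr0// => i; rewrite -val_eqE/= => i0.
  by rewrite eqSS (negPf i0) mul0r.
rewrite (bigD1 (Ordinal N2))//= big1 ?addr0 ?mulrA// => i; rewrite -val_eqE/= => i0.
by rewrite eqSS (negPf i0) mul0r.
Qed.

(** Lag m has n + 1 - m pairs, so the total is (n + 1) / (n + 1) - 1 by the two moment identities of
    the weights. *)
Lemma sum_lag_pairs (R : realType) (n : nat) : (1 < nscales R n)%N ->
  \sum_(p : 'I_(nscales R n) * 'I_n.+1 | lag_pair p) lag_weight (R := R) n p.1.+1 = 0.
Proof.
move=> N2; have NN : (nscales R n ^ 2 <= n.+1)%N := nscales_sqr n.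
have -> : \sum_(p : 'I_(nscales R n) * 'I_n.+1 | lag_pair p) lag_weight (R := R) n p.1.+1 =
    \sum_(p : 'I_(nscales R n) * 'I_n.+1 | lag_pair p) lag_weight (R := R) n p.1.+1 * 1.
  by under [RHS]eq_bigr do rewrite mulr1.
rewrite -(sum_lag n (nscales R n) (lag_weight (R := R) n) (fun _ _ => 1)).
rewrite (eq_bigr (fun i : 'I_(nscales R n) => n.+1%:R * lag_weight (R := R) n i.+1 - i.+1%:R * lag_weight (R := R) n i.+1)).
  by rewrite sumrB -mulr_sumr sum_lag_weight// sum_lag_weight1// divff ?subrr//.
move=> i _; have iN := ltn_ord i.
by rewrite big_const_nat iter_addr_0 natrB; [ring|nia].
Qed.

(** * Increments over lags and neighbours *)

Section efficient_price.
Context (R : realType) (d : measure_display)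
  (Omega : measurableType d) (P : probability Omega R)
  (T : R) (T0 : 0 < T) (F : R -> set_system Omega) (Ffilt : is_filtration T F)
  (B mu sigma X : R -> Omega -> R) (BB : brownian_motion P T F B)
  (pmu : progressive T F mu) (lmu : locally_bounded P T F mu)
  (lsigma : locally_bounded P T F sigma) (Xito : ito_process P T F B mu sigma X)
  (t : nat -> nat -> R) (t_grid : forall n, (0 < n)%N -> is_grid T n (t n))
  (t_regular : asymp (R := R) (fun n => min_step n (t n)) (fun n => max_step n (t n))).

Local Notation r := (rate R).
Local Notation NS n := (nscales R n).
Local Notation IV := (integrated_volatility T sigma).
Local Notation Q := lag_pair.

Definition dX n (p : 'I_(NS n) * 'I_n.+1) w := X (t n (hi p)) w - X (t n (lo p)) w.

(** The tolerance [r n ^+ 4] is 1/n, the order of the mesh and hence of the drift over one step. *)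
Lemma grid_approximation (e : R) : 0 < e -> exists2 C : R, 0 <= C &
  forall n, (0 < n)%N -> exists J V, bounded_ito P T F C J V /\
    Pout P (~` [set w | [/\ forall k l, (k <= n)%N -> (l <= n)%N ->
         `|(X (t n l) w - X (t n k) w) - (J (t n l) w - J (t n k) w)|
           <= C * `|t n l - t n k| + r n ^+ 4,
       `|V T w - V 0 w - IV w| <= r n ^+ 4 & 0 <= IV w <= C ^+ 2 * T]]) e.
Proof.
move=> e0; have [C C0 H] := ito_approximation T0 Ffilt BB pmu lmu lsigma Xito e0.
exists C => // n n0; apply: H; first by rewrite exprn_gt0// rate_gt0.
by move=> j jn; apply: grid_in t_grid _ _ _ _.
Qed.

Lemma integrated_volatility_Op : Op P (fun=> 1) (fun=> IV).
Proof.
apply: Op_majorant; first by near=> n.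
move=> e e0; have [C C0 H] := grid_approximation e0.
have CT0 : 0 <= C ^+ 2 * T by rewrite mulr_ge0 ?sqr_ge0// ltW.
exists (C ^+ 2 * T + 1); first by rewrite ltr_wpDl.
near=> n; have n0 : (0 < n)%N by near: n; exact: nbhs_infty_gt.
have [J [V [_ HP]]] := H n n0.
exists (fun=> 0); split => //; first exact: itg_cst.
  by rewrite Ex_cst mulr1 addr_ge0.
apply: Pout_sub HP; apply: subsetC => w /= [_ _ /andP[h1 h2]].
by rewrite ger0_norm// add0r mulr1; lra.
Unshelve. all: by end_near. Qed.

(** There are at most N (n + 1) pairs, which is of order r^(-6). *)
Lemma lag_sum_le n (f : 'I_(NS n) * 'I_n.+1 -> R) (c : R) : (2 < n)%N -> 0 <= c ->
  (forall p, Q p -> f p <= c * r n ^+ 6) -> \sum_(p | Q p) f p <= 4 * c.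
Proof.
move=> n2 c0 fc; have [_ _ Nr _] := nscales_rate (R := R) n2.
have n0 : (0 < n)%N by lia.
have r0 := rate_gt0 (R := R) n0.
apply: (@le_trans _ _ (\sum_(p : 'I_(NS n) * 'I_n.+1) c * r n ^+ 6)).
  rewrite big_mkcond/=; apply: ler_sum => p _; case: ifPn => [/fc//|_].
  by rewrite mulr_ge0// exprn_ge0// ltW.
rewrite sumr_const card_prod !card_ord -[leLHS]mulr_natl natrM.
have nr : n.+1%:R * r n ^+ 4 <= 2.
  by rewrite rate4 ler_pdivrMr ?ltr0n// -natrM ler_nat; lia.
have -> : (NS n)%:R * n.+1%:R * (c * r n ^+ 6) =
    c * (((NS n)%:R * r n ^+ 2) * (n.+1%:R * r n ^+ 4)) by ring.
rewrite mulrC; apply: ler_wpM2r => //.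
rewrite (_ : 4 = 2 * 2 :> R); last by ring.
by apply: ler_pM => //; rewrite mulr_ge0// exprn_ge0// ltW.
Qed.

Let cpow4 (a b : R) : (a + b) ^+ 4 <= 8 * a ^+ 4 + 8 * b ^+ 4.
Proof.
have h : (a + b) ^+ 2 <= 2 * (a ^+ 2 + b ^+ 2) by have := sqr_ge0 (a - b); nra.
have -> : (a + b) ^+ 4 = ((a + b) ^+ 2) ^+ 2 by ring.
apply: (@le_trans _ _ ((2 * (a ^+ 2 + b ^+ 2)) ^+ 2)).
  by rewrite lerXn2r ?nnegrE ?sqr_ge0// mulr_ge0// addr_ge0 ?sqr_ge0.
by have := sqr_ge0 (a ^+ 2 - b ^+ 2); nra.
Qed.

Let cpow2 (a b : R) : (a + b) ^+ 2 <= 2 * a ^+ 2 + 2 * b ^+ 2.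
Proof. by have := sqr_ge0 (a - b); nra. Qed.

Section lag_approximation.
Variables (K C : R) (n : nat) (J V : R -> Omega -> R).
Hypotheses (K0 : 0 < K) (HK : forall n j, (0 < n)%N -> (j < n)%N -> t n j.+1 - t n j <= K / n%:R)
  (C0 : 0 <= C) (n2 : (2 < n)%N) (JV : bounded_ito P T F C J V).

Let n0 : (0 < n)%N. Proof. exact: ltn_trans n2. Qed.
Let r0 : 0 < r n. Proof. exact: rate_gt0. Qed.
Let r1 : r n <= 1. Proof. exact: rate_le1. Qed.
Let tT j : (j <= n)%N -> 0 <= t n j <= T. Proof. exact: (grid_in t_grid). Qed.
Let tnd j : (j < n)%N -> t n j <= t n j.+1.
Proof. by move=> jn; apply: (grid_mono t_grid). Qed.
Let tstep j : (j < n)%N -> t n j.+1 - t n j <= K * r n ^+ 4.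
Proof. by move=> jn; rewrite rate4; exact: HK. Qed.
Let k0 : 0 <= K * r n ^+ 4. Proof. by rewrite mulr_ge0 ?exprn_ge0 ?(ltW K0)// ltW. Qed.

Definition dJ (p : 'I_(NS n) * 'I_n.+1) w := J (t n (hi p)) w - J (t n (lo p)) w.

Lemma lag_gap (p : 'I_(NS n) * 'I_n.+1) : Q p -> (hi p - lo p)%:R * (K * r n ^+ 4) <= 2 * K * r n ^+ 2.
Proof.
move=> Qp; have [_ _ Nr _] := nscales_rate (R := R) n2.
rewrite hi_subn_lo//.
apply: (@le_trans _ _ ((NS n)%:R * (K * r n ^+ 4))).
  by rewrite ler_wpM2r// ler_nat ltn_ord.
have -> : (NS n)%:R * (K * r n ^+ 4) = ((NS n)%:R * r n ^+ 2) * (K * r n ^+ 2) by ring.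
by rewrite -[leRHS]mulrA ler_wpM2r// mulr_ge0 ?sqr_ge0// ltW.
Qed.

Lemma dJ_moment2 (p : 'I_(NS n) * 'I_n.+1) : Q p -> itg P (fun w => dJ p w ^+ 2) /\
  Ex P (fun w => dJ p w ^+ 2) <= 2 * C ^+ 2 * K * r n ^+ 2.
Proof.
move=> Qp; have [h1 h2] := inc_moment2 Ffilt JV tT tnd tstep (ltnW (lo_lt_hi Qp)) (hi_le p).
split => //; apply: le_trans h2 _.
rewrite (_ : 2 * C ^+ 2 * K * r n ^+ 2 = C ^+ 2 * (2 * K * r n ^+ 2)); last by ring.
by apply: (ler_wpM2l (sqr_ge0 _)); exact: lag_gap.
Qed.

Lemma dJ_moment4 (p : 'I_(NS n) * 'I_n.+1) : Q p -> itg P (fun w => dJ p w ^+ 4) /\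
  Ex P (fun w => dJ p w ^+ 4) <= 96 * C ^+ 4 * (4 * K ^+ 2) * r n ^+ 4.
Proof.
move=> Qp; have [h1 h2] := inc_moment4 JV tT tnd tstep k0 (ltnW (lo_lt_hi Qp)) (hi_le p).
split => //; apply: le_trans h2 _.
rewrite (_ : 96 * C ^+ 4 * (4 * K ^+ 2) * r n ^+ 4 = 96 * C ^+ 4 * (2 * K * r n ^+ 2) ^+ 2); last by ring.
apply: ler_wpM2l; first by rewrite mulr_ge0// exprn_ge0.
apply: lerXn2r; rewrite ?nnegrE ?lag_gap// ?mulr_ge0// ?sqr_ge0// ltW//.
Qed.

Lemma dX_dJ (p : 'I_(NS n) * 'I_n.+1) w : Q p -> (forall k l, (k <= n)%N -> (l <= n)%N ->
    `|(X (t n l) w - X (t n k) w) - (J (t n l) w - J (t n k) w)|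
           <= C * `|t n l - t n k| + r n ^+ 4) ->
  `|dX p w - dJ p w| <= (2 * C * K + 1) * r n ^+ 2.
Proof.
move=> Qp H; apply: le_trans (H _ _ (lo_le p) (hi_le p)) _.
have g := grid_gap tstep (ltnW (lo_lt_hi Qp)) (hi_le p).
have g0 : t n (lo p) <= t n (hi p).
  exact: (grid_mono t_grid n0 (ltnW (lo_lt_hi Qp)) (hi_le p)).
rewrite ger0_norm ?subr_ge0// mulrDl mul1r; apply: lerD.
  apply: (le_trans (ler_wpM2l C0 (le_trans g (lag_gap Qp)))).
  by rewrite le_eqVlt; apply/orP; left; apply/eqP; ring.
by apply: ler_wiXn2l => //; exact: ltW.
Qed.

End lag_approximation.

(** A k-th power of a lag increment is of order r^k, so this normalisation makes each term of order
    r^6. The second powers serve the conditional variance of the noise, the fourth the Taylor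
    remainder. *)
Lemma lag_powers_Op k : (k == 2%N) || (k == 4%N) ->
  Op P (fun=> 1) (fun n w => \sum_(p : 'I_(NS n) * 'I_n.+1 | Q p) r n ^+ (6 - k) * dX p w ^+ k).
Proof.
move=> hk; have [K K0 HK] := grid_step T0 t_grid t_regular.
have k_ge0 (x : R) : 0 <= x ^+ k by case/orP: hk => /eqP->; rewrite exprn_even_ge0.
have cpow (a b : R) : (a + b) ^+ k <= 8 * a ^+ k + 8 * b ^+ k.
  case/orP: hk => /eqP-> //; apply: (le_trans (cpow2 a b)).
  by have := sqr_ge0 a; have := sqr_ge0 b; lra.
apply: Op_majorant; first by near=> n.
move=> e e0; have [C C0 H] := grid_approximation e0.
pose D := 8 * (2 * C * K + 1) ^+ k.
pose D' := 8 * (2 * C ^+ 2 * K + 96 * C ^+ 4 * (4 * K ^+ 2)).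
have D0 : 0 <= D by rewrite mulr_ge0.
have D'0 : 0 <= D' by rewrite mulr_ge0// addr_ge0 ?mulr_ge0 ?exprn_ge0// ltW.
exists (4 * D' + 4 * D + 1); first by rewrite ltr_wpDl// addr_ge0// mulr_ge0.
near=> n; have n2 : (2 < n)%N by near: n; exact: nbhs_infty_gt.
have n0 : (0 < n)%N by lia.
have r0 := rate_gt0 (R := R) n0; have r1 := rate_le1 (R := R) n0.
have [J [V [JV HP]]] := H n n0.
have k6 : (k <= 6)%N by case/orP: hk => /eqP->.
have mom (p : 'I_(NS n) * 'I_n.+1) : Q p -> itg P (fun w => dJ J p w ^+ k) /\ Ex P (fun w => dJ J p w ^+ k) <= D' / 8 * r n ^+ k.
  move=> Qp; have [a1 a2] := dJ_moment2 K0 HK n2 JV Qp.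
  have [b1 b2] := dJ_moment4 K0 HK C0 n2 JV Qp.
  rewrite /D' (mulrC 8) mulfK//.
  have c1 : 0 <= 2 * C ^+ 2 * K by rewrite !mulr_ge0// ltW.
  have c2 : 0 <= 96 * C ^+ 4 * (4 * K ^+ 2) by rewrite !mulr_ge0 ?exprn_ge0 ?(ltW K0)//.
  case/orP: hk => /eqP->; split => //; [apply: le_trans a2 _|apply: le_trans b2 _];
    by rewrite ler_wpM2r ?exprn_ge0 ?(ltW r0)// ?lerDl ?lerDr.
pose g (p : 'I_(NS n) * 'I_n.+1) w := if Q p then 8 * r n ^+ (6 - k) * dJ J p w ^+ k else 0.
have g0 p w : 0 <= g p w.
  by rewrite /g; case: ifP => // _; rewrite mulr_ge0// mulr_ge0// exprn_ge0// ltW.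
have ig p : itg P (g p).
  rewrite /g; case: (boolP (Q p)) => Qp; last exact: itg_cst.
  by apply: itgZ; exact: (mom p Qp).1.
exists (fun w => \sum_(p : 'I_(NS n) * 'I_n.+1 | Q p) g p w); split.
- exact: itg_sum.
- by move=> w; apply: sumr_ge0.
- rewrite Ex_sum// mulr1; apply: (@le_trans _ _ (4 * D')); last by lra.
  apply: lag_sum_le => // p Qp; rewrite /g Qp.
  have [i1 i2] := mom p Qp; rewrite ExZ//.
  apply: (@le_trans _ _ (8 * r n ^+ (6 - k) * (D' / 8 * r n ^+ k))).
    by rewrite ler_wpM2l// mulr_ge0// exprn_ge0// ltW.
  rewrite -[in leRHS](subnK k6) exprD le_eqVlt; apply/orP; left; apply/eqP.
  by field.
- apply: Pout_sub HP; apply: subsetC => w /= [HX _ _]; rewrite mulr1.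
  rewrite ger0_norm; last by apply: sumr_ge0 => p _; rewrite mulr_ge0// exprn_ge0// ltW.
  apply: (@le_trans _ _ (\sum_(p | Q p) (g p w + 8 * r n ^+ (6 - k) * (dX p w - dJ J p w) ^+ k))).
    apply: ler_sum => p Qp; rewrite /g Qp.
    rewrite [8 * _]mulrC -!mulrA -mulrDr ler_wpM2l ?exprn_ge0 ?(ltW r0)//.
    by rewrite -[X in X ^+ k <= _](subrK (dJ J p w)) addrC; exact: cpow.
  rewrite big_split/= lerD2l; apply: (@le_trans _ _ (4 * D)); last by lra.
  apply: lag_sum_le => // p Qp; have h := dX_dJ K0 HK C0 n2 Qp HX.
  have h' : (dX p w - dJ J p w) ^+ k <= ((2 * C * K + 1) * r n ^+ 2) ^+ k.
    rewrite -[leLHS]ger0_norm// normrX lerXn2r ?nnegrE// (le_trans _ h)//.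
  apply: (@le_trans _ _ (8 * r n ^+ (6 - k) * ((2 * C * K + 1) * r n ^+ 2) ^+ k)).
    by rewrite ler_wpM2l// mulr_ge0// exprn_ge0// ltW.
  rewrite exprMn /D mulrACA -mulrA [leRHS]mulrA -!mulrA !ler_wpM2l//.
  rewrite -[leRHS]/(r n ^+ 6) -exprM -exprD; apply: ler_wiXn2l => //; first exact: ltW.
  by case/orP: hk => /eqP->.
Unshelve. all: by end_near. Qed.

Lemma weighted_squares_Op : Op P r (fun n w =>
  \sum_(p : 'I_(NS n) * 'I_n.+1 | Q p) lag_weight (R := R) n p.1.+1 * dX p w ^+ 2 - IV w).
Proof.
have [K K0 HK] := grid_step T0 t_grid t_regular.
apply: Op_majorant; first by near=> n; apply: rate_gt0; near: n; exact: nbhs_infty_gt.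
move=> e e0; have [C C0 H] := grid_approximation e0.
pose D := 64 * (2 * C * K + 1) ^+ 2.
pose D' := 64 * C ^+ 2 * K.
(* The bound of [quadratic_form_majorant] with kernel bound 8: since N r^2 is at most 2, 128 is 64 *
   2 and 36 is 2 * (8 + 1) * 2. *)
pose D'' := 2 + C ^+ 4 * K ^+ 2 * (194 + 128) + 36 * C ^+ 2 * K.
have K0' := ltW K0.
have D0 : 0 <= D by rewrite mulr_ge0// sqr_ge0.
have D'0 : 0 <= D' by rewrite !mulr_ge0.
have D''0 : 0 <= D'' by rewrite !addr_ge0 ?mulr_ge0 ?exprn_ge0.
exists (4 * D' + 4 * D + D'' + 1); first by apply: ltr_wpDl => //; rewrite (addr_ge0 _ D''0)// addr_ge0// mulr_ge0.
near=> n; have n2 : (2 < n)%N by near: n; exact: nbhs_infty_gt.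
have n0 : (0 < n)%N by lia.
have r0 := rate_gt0 (R := R) n0; have r1 := rate_le1 (R := R) n0; have r0' := ltW r0.
have [J [V [JV HP]]] := H n n0.
pose N := NS n; have [N1 Nn Nr rN] := nscales_rate (R := R) n2.
have N0 : (0 < N)%N by exact: ltnW.
have N2R : 0 < (N%:R : R) ^+ 2 by rewrite exprn_gt0// ltr0n.
have bb m : (0 < m <= N)%N -> `|lag_weight (R := R) n m| <= 8 / N%:R ^+ 2 by exact: lag_weight_bound.
have br m : (0 < m <= N)%N -> `|lag_weight (R := R) n m| <= 32 * r n ^+ 4.
  move=> /bb h; apply: le_trans h _; rewrite ler_pdivrMr//.
  have : 1 <= (2 * N%:R * r n ^+ 2) ^+ 2 by rewrite exprn_ege1.
  by rewrite (_ : (_ * _) ^+ 2 = 4 * (r n ^+ 4 * N%:R ^+ 2)); [lra|ring].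
have brp (p : 'I_(NS n) * 'I_n.+1) : `|lag_weight (R := R) n p.1.+1| <= 32 * r n ^+ 4.
  by apply: br; rewrite /= ltn_ord.
pose W := kernel n N (lag_weight (R := R) n).
have W8 i j : `|W i j| <= 8.
  apply: le_trans (kernel_bound _ N0 bb i j) _.
  by rewrite divfK// gt_eqF.
have Wd i : ~~ edge n N i -> W i i = 1.
  rewrite /edge negb_or -!leqNgt => /andP[h1 h2].
  by apply: (kernel_diag N0 Nn bb) => //; exact: sum_lag_weight1.
have tnd j : (j < n)%N -> t n j <= t n j.+1 by move=> jn; apply: (grid_mono t_grid).
have tst j : (j < n)%N -> t n j.+1 - t n j <= K * r n ^+ 4 by move=> jn; rewrite rate4; exact: HK.
have k0 : 0 <= K * r n ^+ 4 by rewrite mulr_ge0// exprn_ge0.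
(* The free parameter is the rate r: as the variation per step is of order r^4, n N r^8 / r is then
   of order r as well. *)
have [Zq [iZq Zq0 Zqb EZq]] := quadratic_form_majorant Ffilt JV
  (fun j (h : (j <= n)%N) => grid_in t_grid n0 h) tnd tst k0 W8
  (fun i j => kernel_far N0 Nn bb (i := i) (j := j)) Wd
  (edge_card N0 Nn bb (leqnSn n)) (kernelC n N _) r0.
pose g (p : 'I_(NS n) * 'I_n.+1) w := if Q p then 32 * r n ^+ 5 * dJ J p w ^+ 2 else 0.
have mom (p : 'I_(NS n) * 'I_n.+1) := dJ_moment2 K0 HK n2 JV (p := p).
have g0 p w : 0 <= g p w.
  by rewrite /g; case: ifP => // _; apply: mulr_ge0 (sqr_ge0 _); rewrite mulr_ge0// exprn_ge0.
have ig p : itg P (g p).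
  rewrite /g; case: (boolP (Q p)) => Qp; last exact: itg_cst.
  by apply: itgZ; exact: (mom p Qp).1.
exists (fun w => Zq w + \sum_(p : 'I_(NS n) * 'I_n.+1 | Q p) g p w); split.
- by apply: itgD => //; exact: itg_sum.
- by move=> w; apply: addr_ge0 => //; apply: sumr_ge0.
- rewrite ExD//; last exact: itg_sum.
  rewrite Ex_sum//; apply: (@le_trans _ _ (D'' * r n + 4 * (D' * r n))); last first.
    by have := mulr_ge0 D0 r0'; lra.
  apply: lerD.
    apply: le_trans EZq _; rewrite /D''.
    have nr : n%:R * r n ^+ 4 = 1 by rewrite rate4 divff// pnatr_eq0 -lt0n.
    rewrite (_ : n%:R * (C ^+ 2 * (K * r n ^+ 4)) ^+ 2 * (194 + N%:R * 8 ^+ 2) / r n =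
      C ^+ 4 * K ^+ 2 * (194 * r n ^+ 2 + 64 * (N%:R * r n ^+ 2)) * (n%:R * r n ^+ 4) * r n); last first.
      by field; rewrite gt_eqF.
    rewrite nr mulr1.
    rewrite (_ : 2 * N%:R * (8 + 1) * (C ^+ 2 * (K * r n ^+ 4)) =
      18 * (C ^+ 2 * K) * (N%:R * r n ^+ 2) * (r n * r n)); last by ring.
    have h1 : C ^+ 4 * K ^+ 2 * (194 * r n ^+ 2 + 64 * (N%:R * r n ^+ 2)) * r n <=
        C ^+ 4 * K ^+ 2 * (194 + 128) * r n.
      apply: ler_wpM2r => //; apply: ler_wpM2l; first by rewrite mulr_ge0 ?exprn_ge0.
      have : r n ^+ 2 <= 1 by rewrite exprn_ile1.
      by move: Nr; rewrite -/N; lra.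
    have CK0 : 0 <= C ^+ 2 * K by rewrite mulr_ge0 ?exprn_ge0.
    have h2 : 18 * (C ^+ 2 * K) * (N%:R * r n ^+ 2) * (r n * r n) <= 18 * (C ^+ 2 * K) * 2 * (1 * r n).
      apply: ler_pM.
      - by rewrite mulr_ge0 ?(mulr_ge0 (ler0n _ _) (sqr_ge0 _))// mulr_ge0.
      - exact: mulr_ge0.
      - by rewrite ler_wpM2l// mulr_ge0.
      - exact: ler_wpM2r.
    lra.
  apply: lag_sum_le => //; first exact: mulr_ge0.
  move=> p Qp; rewrite /g Qp; have [i1 i2] := mom p Qp; rewrite ExZ//.
  apply: (@le_trans _ _ (32 * r n ^+ 5 * (2 * C ^+ 2 * K * r n ^+ 2))).
    by rewrite ler_wpM2l// mulr_ge0// exprn_ge0.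
  by rewrite /D' le_eqVlt; apply/orP; left; apply/eqP; ring.
- apply: Pout_sub HP; apply: subsetC => w /= [HX HV _].
  have E1 : \sum_(p : 'I_(NS n) * 'I_n.+1 | Q p) lag_weight (R := R) n p.1.+1 * dX p w ^+ 2 - IV w =
      \sum_(p : 'I_(NS n) * 'I_n.+1 | Q p) lag_weight (R := R) n p.1.+1 * (dX p w ^+ 2 - dJ J p w ^+ 2)
      + (\sum_(p : 'I_(NS n) * 'I_n.+1 | Q p) lag_weight (R := R) n p.1.+1 * dJ J p w ^+ 2 - (V T w - V 0 w))
      + (V T w - V 0 w - IV w).
    under [X in _ = X + _ + _]eq_bigr do rewrite mulrBr.
    by rewrite sumrB; ring.
  rewrite E1; apply: le_trans (ler_normD _ _) _.
  apply: (le_trans (lerD (ler_normD _ _) (lexx _))).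
  have b3 : `|V T w - V 0 w - IV w| <= r n.
    by apply: le_trans HV _; rewrite -[leRHS]expr1; apply: ler_wiXn2l.
  have b2 : `|\sum_(p : 'I_(NS n) * 'I_n.+1 | Q p) lag_weight (R := R) n p.1.+1 * dJ J p w ^+ 2 - (V T w - V 0 w)| <= Zq w.
    have := Zqb w; have [-> -> _] := t_grid n0.
    by rewrite -(lag_quadratic_form n N (lag_weight (R := R) n) (fun i => J (t n i) w)).
  have b1 : `|\sum_(p : 'I_(NS n) * 'I_n.+1 | Q p) lag_weight (R := R) n p.1.+1 * (dX p w ^+ 2 - dJ J p w ^+ 2)|
      <= \sum_(p : 'I_(NS n) * 'I_n.+1 | Q p) g p w + 4 * (D * r n).
    apply: le_trans (ler_norm_sum _ _ _) _.
    apply: (@le_trans _ _ (\sum_(p : 'I_(NS n) * 'I_n.+1 | Q p)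
        (g p w + 32 * r n ^+ 4 * ((1 + (r n)^-1) * (dX p w - dJ J p w) ^+ 2)))).
      apply: ler_sum => p Qp; rewrite /g Qp normrM.
      apply: (@le_trans _ _ (32 * r n ^+ 4 * (r n * dJ J p w ^+ 2 + (1 + (r n)^-1) * (dX p w - dJ J p w) ^+ 2))).
        apply: ler_pM => //.
        set x := dX p w; set y := dJ J p w.
        (* The cross term is split with weight r: y^2 is of order r^2 and (x - y)^2 of order r^4, so
           both r y^2 and (x - y)^2 / r are of order r^3. Multiplied by weights r^4 and by r^(-6)
           pairs, this gives r. *)
        have -> : x ^+ 2 - y ^+ 2 = (x - y) ^+ 2 + 2 * y * (x - y) by ring.
        apply: le_trans (ler_normD _ _) _; rewrite [`|_ ^+ 2|]ger0_norm ?sqr_ge0//.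
        have : `|2 * y * (x - y)| <= r n * y ^+ 2 + (r n)^-1 * (x - y) ^+ 2.
          have ri : 0 < (r n)^-1 by rewrite invr_gt0.
          rewrite ler_norml; apply/andP; split; rewrite -subr_ge0.
            rewrite (_ : _ - _ = (r n)^-1 * (r n * y + (x - y)) ^+ 2); last by field; rewrite gt_eqF.
            exact: (mulr_ge0 (ltW ri) (sqr_ge0 _)).
          rewrite (_ : _ - _ = (r n)^-1 * (r n * y - (x - y)) ^+ 2); last by field; rewrite gt_eqF.
          exact: (mulr_ge0 (ltW ri) (sqr_ge0 _)).
        by rewrite mulrDl mul1r; lra.
      by rewrite le_eqVlt; apply/orP; left; apply/eqP; ring.
    rewrite big_split/= lerD2l; apply: lag_sum_le => //; first exact: mulr_ge0.
    move=> p Qp; have h := dX_dJ K0 HK C0 n2 Qp HX.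
    have h' : (dX p w - dJ J p w) ^+ 2 <= ((2 * C * K + 1) * r n ^+ 2) ^+ 2.
      by rewrite -[leLHS]real_normK ?num_real// lerXn2r ?nnegrE// (le_trans _ h).
    have ri : 1 + (r n)^-1 <= 2 / r n.
      rewrite (_ : 2 / r n = (r n)^-1 + (r n)^-1) ?lerD2r ?invf_ge1//.
      by ring.
    apply: (@le_trans _ _ (32 * r n ^+ 4 * (2 / r n * ((2 * C * K + 1) * r n ^+ 2) ^+ 2))).
      apply: ler_wpM2l; first by rewrite mulr_ge0// exprn_ge0.
      by apply: ler_pM => //; [rewrite addr_ge0// invr_ge0|exact: sqr_ge0].
    by rewrite /D le_eqVlt; apply/orP; left; apply/eqP; field; rewrite gt_eqF.
  have := mulr_ge0 D'0 r0'; have := mulr_ge0 D''0 r0'; lra.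
Unshelve. all: by end_near. Qed.

End efficient_price.

(** * Neighbouring pairs *)

Section neighbour_pairs.
Context {R : realType}.
Variables (n : nat) (t : nat -> R) (xi : R).

Definition neighbour_pair (p : 'I_n.+1 * 'I_n.+1) : bool := p.2 \in neighbours t xi p.1.
Local Notation Q := neighbour_pair.

Lemma neighbour_pair_sym i j : Q (i, j) = Q (j, i).
Proof. by rewrite /Q !inE/= distrC eq_sym. Qed.

Lemma sum_neighbours (V : nmodType) (f : 'I_n.+1 -> 'I_n.+1 -> V) :
  \sum_(j < n.+1) \sum_(l in neighbours t xi j) f j l = \sum_(p | Q p) f p.1 p.2.
Proof. by rewrite pair_big_dep. Qed.

Lemma sum_neighbour_pairs1 : \sum_(p | Q p) (1 : R) = (total_nb n t xi)%:R.
Proof.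
rewrite -(sum_neighbours (fun _ _ => 1)) /total_nb natr_sum; apply: eq_bigr => j _.
by rewrite sumr_const.
Qed.

Lemma neighbour_degree j :
  (#|[pred p | Q p && ((p.2 == j :> nat) || (p.1 == j :> nat))]| <= 2 * max_nb n t xi)%N.
Proof.
have [jn|jn] := ltnP j n.+1; last first.
  rewrite eq_card0// => p; rewrite !inE.
  by have h1 := ltn_ord p.1; have h2 := ltn_ord p.2; rewrite !ltn_eqF ?andbF// (leq_trans _ jn).
pose j' := Ordinal jn.
have img (f : 'I_n.+1 -> 'I_n.+1 * 'I_n.+1) (A : pred ('I_n.+1 * 'I_n.+1)) :
    (forall p, p \in A -> exists2 i, i \in neighbours t xi j' & p = f i) ->
    (#|A| <= max_nb n t xi)%N.
  move=> Af; apply: (@leq_trans #|neighbours t xi j'|); last exact: (leq_bigmax j').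
  apply: leq_trans (leq_imset_card f (mem (neighbours t xi j'))); apply/subset_leq_card/fintype.subsetP => p /Af[i h ->].
  by apply/imsetP; exists i.
rewrite mul2n -addnn.
apply: (@leq_trans (#|[pred p | Q p && (p.2 == j :> nat)]| + #|[pred p | Q p && (p.1 == j :> nat)]|)).
  rewrite -cardUI; apply: leq_trans (leq_addr _ _); apply/subset_leq_card/fintype.subsetP => p.
  by rewrite !inE => /andP[-> /orP[->|->]]; rewrite ?orbT.
apply: leq_add.
  apply: (img (fun i => (i, j'))) => -[i k]; rewrite inE/= => /andP[h /eqP kj].
  have -> : k = j' by apply: val_inj.
  exists i => //; have -> : j' = k by apply: val_inj.
  by move: h; rewrite neighbour_pair_sym.
apply: (img (fun i => (j', i))) => -[k i]; rewrite inE/= => /andP[h /eqP kj].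
have E : k = j' by apply: val_inj.
by exists i; rewrite -E.
Qed.

Lemma f_hat_pairs (Y : nat -> R) (s : R) : f_hat n t Y xi s =
  `|\sum_(p | Q p) (total_nb n t xi)%:R^-1 * cos (s * (Y p.2 - Y p.1))|.
Proof. by rewrite /f_hat sum_neighbours mulr_sumr. Qed.

Lemma total_nb_ge : (n.+1 * min_nb n t xi <= total_nb n t xi)%N.
Proof.
rewrite /total_nb -[n.+1 in leqLHS]card_ord -sum_nat_const; apply: leq_sum => j _.
by apply: bigminn_le; rewrite mem_index_enum.
Qed.

Hypothesis minnb : (0 < min_nb n t xi)%N.

Lemma total_nb_gt0 : (0 < total_nb n t xi)%N.
Proof. by apply: leq_trans total_nb_ge; rewrite muln_gt0. Qed.

Lemma neighbour_average_le (f : 'I_n.+1 * 'I_n.+1 -> R) (c : R) :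
  (forall p, Q p -> f p <= c) -> \sum_(p | Q p) (total_nb n t xi)%:R^-1 * f p <= c.
Proof.
move=> fc; rewrite -mulr_sumr.
apply: (@le_trans _ _ ((total_nb n t xi)%:R^-1 * \sum_(p | Q p) c)).
  by rewrite ler_wpM2l ?invr_ge0//; apply: ler_sum.
have -> : \sum_(p | Q p) c = \sum_(p | Q p) (1 * c) by apply: eq_bigr => p _; rewrite mul1r.
by rewrite -mulr_suml sum_neighbour_pairs1 mulrA mulVf ?mul1r// pnatr_eq0 -lt0n total_nb_gt0.
Qed.

End neighbour_pairs.

Section neighbour_increments.
Context (R : realType) (d : measure_display)
  (Omega : measurableType d) (P : probability Omega R)
  (T : R) (T0 : 0 < T) (F : R -> set_system Omega) (Ffilt : is_filtration T F)
  (B mu sigma X : R -> Omega -> R) (BB : brownian_motion P T F B)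
  (pmu : progressive T F mu) (lmu : locally_bounded P T F mu)
  (lsigma : locally_bounded P T F sigma) (Xito : ito_process P T F B mu sigma X)
  (t : nat -> nat -> R) (t_grid : forall n, (0 < n)%N -> is_grid T n (t n))
  (xi : nat -> R)
  (xi_max_min : asymp (R := R) (fun n => (max_nb n (t n) (xi n))%:R)
                        (fun n => (min_nb n (t n) (xi n))%:R))
  (xi_rate : xi =O_\oo (rate R)).

Local Notation r := (rate R).
Local Notation NT n := ((total_nb n (t n) (xi n))%:R : R).

Lemma min_nb_gt0 n : (0 < n)%N -> (0 < min_nb n (t n) (xi n))%N.
Proof.
move=> n0; have [c1 [c2 [c10 _ /(_ n n0)/andP[h _]]]] := xi_max_min.
rewrite lt0n; apply/eqP => h0; move: h; rewrite h0 invr0 mulr0 leNgt.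
by rewrite c10.
Qed.

Lemma max_nb_le : exists2 c : R, 0 < c & forall n, (0 < n)%N ->
  (max_nb n (t n) (xi n))%:R <= c * (min_nb n (t n) (xi n))%:R.
Proof.
have [c1 [c2 [_ c20 H]]] := xi_max_min; exists c2 => // n n0.
have /andP[_] := H n n0; rewrite ler_pdivrMr// ltr0n; exact: min_nb_gt0.
Qed.

Lemma neighbour_increments_Op : Op P r (fun n w =>
  \sum_(p : 'I_n.+1 * 'I_n.+1 | neighbour_pair (t n) (xi n) p)
     (NT n)^-1 * (X (t n p.2) w - X (t n p.1) w) ^+ 2).
Proof.
have /eqO_exP[k k0 Hk] := xi_rate.
apply: Op_majorant; first by near=> n; apply: rate_gt0; near: n; exact: nbhs_infty_gt.
move=> e e0; have [C C0 H] := grid_approximation T0 Ffilt BB pmu lmu lsigma Xito t_grid e0.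
pose D := 2 * (C * k + 1) ^+ 2; pose D' := 2 * (C ^+ 2 * k).
have D0 : 0 <= D by exact: (mulr_ge0 (ler0n _ _) (sqr_ge0 _)).
have D'0 : 0 <= D' by rewrite mulr_ge0// mulr_ge0 ?exprn_ge0// ltW.
exists (D + D' + 1); first by apply: ltr_wpDl => //; rewrite (addr_ge0 D0).
near=> n; have n0 : (0 < n)%N by near: n; exact: nbhs_infty_gt.
have r0 := rate_gt0 (R := R) n0; have r1 := rate_le1 (R := R) n0; have r0' := ltW r0.
have xik : xi n <= k * r n.
  apply: le_trans (ler_norm _) _; rewrite -[X in _ * X](ger0_norm r0').
  by near: n.
have [J [V [JV HP]]] := H n n0.
have m0 := min_nb_gt0 n0.
have jn (j : 'I_n.+1) : (j <= n)%N by rewrite -ltnS.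
pose g (p : 'I_n.+1 * 'I_n.+1) w :=
  if neighbour_pair (t n) (xi n) p then 2 * (J (t n p.2) w - J (t n p.1) w) ^+ 2 else 0.
have mom (p : 'I_n.+1 * 'I_n.+1) : neighbour_pair (t n) (xi n) p -> itg P (fun w => (J (t n p.2) w - J (t n p.1) w) ^+ 2) /\
    Ex P (fun w => (J (t n p.2) w - J (t n p.1) w) ^+ 2) <= C ^+ 2 * (k * r n).
  (* Neighbouring pairs occur in both orders, whereas moments are available for increasing times;
     the squared increment is symmetric. *)
  wlog le : p / t n p.1 <= t n p.2 => [hw|Qp].
    have [/hw//|/ltW h] := leP (t n p.1) (t n p.2).
    case: p h => i j h; rewrite neighbour_pair_sym => /(hw (j, i) h)/= [h1 h2].
    have E w : (J (t n i) w - J (t n j) w) ^+ 2 = (J (t n j) w - J (t n i) w) ^+ 2 by ring.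
    by split; [exact: eq_itg E h1|rewrite -(eq_Ex _ E)].
  have /andP[a0 _] := grid_in t_grid n0 (jn p.1).
  have /andP[_ b1] := grid_in t_grid n0 (jn p.2).
  have [h1 h2] := bounded_ito_moment2 Ffilt JV a0 le b1; split => //.
  apply: le_trans h2 _; apply: (ler_wpM2l (sqr_ge0 _)); apply: le_trans xik.
  by move: Qp; rewrite /neighbour_pair inE => /andP[+ _]; rewrite ger0_norm// subr_ge0.
have NT0 : 0 <= (NT n)^-1 by rewrite invr_ge0.
have g0 p w : 0 <= g p w.
  by rewrite /g; case: ifP => // _; exact: (mulr_ge0 (ler0n _ _) (sqr_ge0 _)).
have ig p : itg P (g p).
  rewrite /g; case: (boolP (neighbour_pair _ _ p)) => Qp; last exact: itg_cst.
  by apply: itgZ; exact: (mom p Qp).1.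
exists (fun w => \sum_(p | neighbour_pair (t n) (xi n) p) (NT n)^-1 * g p w); split.
- by apply: itg_sum => p; exact: itgZ.
- by move=> w; apply: sumr_ge0 => p _; rewrite mulr_ge0.
- rewrite Ex_sum; last by move=> p; exact: itgZ.
  under eq_bigr do rewrite ExZ//.
  apply: (@le_trans _ _ (D' * r n)).
    apply: neighbour_average_le => // p Qp; rewrite /g Qp; have [h1 h2] := mom p Qp.
    by rewrite ExZ// /D'; lra.
  by rewrite ler_wpM2r//; lra.
- apply: Pout_sub HP; apply: subsetC => w /= [HX _ _].
  rewrite ger0_norm; last by apply: sumr_ge0 => p _; exact: (mulr_ge0 NT0 (sqr_ge0 _)).
  apply: (@le_trans _ _ (\sum_(p | neighbour_pair (t n) (xi n) p)
     ((NT n)^-1 * g p w + (NT n)^-1 * (D * r n)))).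
    apply: ler_sum => p Qp; rewrite -mulrDr ler_wpM2l// /g Qp.
    set x := X _ _ - _; set y := J _ _ - _.
    have h : `|x - y| <= (C * k + 1) * r n.
      apply: le_trans (HX _ _ (jn p.1) (jn p.2)) _; rewrite mulrDl mul1r; apply: lerD.
        rewrite -mulrA ler_wpM2l//; apply: le_trans xik.
        by move: Qp; rewrite /neighbour_pair inE => /andP[+ _].
      by rewrite -[leRHS]expr1; apply: ler_wiXn2l.
    have h' : (x - y) ^+ 2 <= ((C * k + 1) * r n) ^+ 2.
      by rewrite -[leLHS]real_normK ?num_real// lerXn2r ?nnegrE// (le_trans _ h).
    have h2 : 2 * ((C * k + 1) * r n) ^+ 2 <= D * r n.
      rewrite exprMn mulrA -/D; apply: ler_wpM2l => //.
      by rewrite -[leRHS]expr1; apply: ler_wiXn2l.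
    (* The inequality x^2 <= 2 y^2 + 2 (x - y)^2, whose two sides differ by this square. *)
    by have := sqr_ge0 (x - 2 * y); nra.
  rewrite big_split/= lerD2l; apply: (@le_trans _ _ (D * r n)); first exact: neighbour_average_le.
  by rewrite ler_wpM2r//; lra.
Unshelve. all: by end_near. Qed.

End neighbour_increments.

(** * The estimator *)

Lemma Op_deterministic {R : realType} {d} {Omega : measurableType d} (P : probability Omega R)
    (K : R) (a b : nat -> R) : 0 < K -> (\forall n \near \oo, `|b n| <= K * a n) ->
  Op P a (fun n _ => b n).
Proof.
move=> K0 ba e e0; exists K => //.
near=> n; rewrite (_ : [set w | _] = set0); first by exists set0; split => //; rewrite measure0 lee_fin ltW.
by apply/seteqP; split => w //=; rewrite ltNge => /negP; apply; near: n.
Unshelve. all: by end_near. Qed.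

Section estimator.
Context (R : realType) (d : measure_display)
  (Omega : measurableType d) (P : probability Omega R)
  (T : R) (T0 : 0 < T) (F : R -> set_system Omega) (Ffilt : is_filtration T F)
  (B mu sigma X : R -> Omega -> R) (BB : brownian_motion P T F B)
  (pmu : progressive T F mu) (lmu : locally_bounded P T F mu)
  (lsigma : locally_bounded P T F sigma) (Xito : ito_process P T F B mu sigma X)
  (t : nat -> nat -> R) (t_grid : forall n, (0 < n)%N -> is_grid T n (t n))
  (t_regular : asymp (R := R) (fun n => min_step n (t n)) (fun n => max_step n (t n)))
  (fU : R -> R) (fU_density : is_density fU)
  (U : nat -> nat -> Omega -> R) (mU : forall n j, measurable_fun setT (U n j))
  (U_law : forall n j, (0 < n)%N -> (j <= n)%N -> has_density P (U n j) fU)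
  (U_indep : forall n, (0 < n)%N -> mutually_independent P n (U n))
  (U_indep_X : forall n, (0 < n)%N ->
     independent_systems P
       (sigma_generated [set j | (j <= n)%N] (U n))
       (sigma_generated `[0, T] X))
  (fU_real : forall s : R, complex.Im (fourier fU s) = 0)
  (fU_neq0 : forall s : R, fourier fU s <> 0)
  (xi : nat -> R)
  (xi_max_min : asymp (R := R) (fun n => (max_nb n (t n) (xi n))%:R)
                        (fun n => (min_nb n (t n) (xi n))%:R))
  (xi_rate : xi =O_\oo (rate R)).

Local Notation r := (rate R).
Local Notation IV := (integrated_volatility T sigma).
Local Notation NS n := (nscales R n).
Local Notation NT n := ((total_nb n (t n) (xi n))%:R : R).
Local Notation Y n w := (fun j => X (t n j) w + U n j w).

Definition cfU (s : R) : R := complex.Re (fourier fU s).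

Let mcos : measurable_fun setT (@cos R).
Proof. exact: continuous_measurable_fun (@continuous_cos R). Qed.
Let msin : measurable_fun setT (@sin R).
Proof. exact: continuous_measurable_fun (@continuous_sin R). Qed.
Let mscale (s : R) : measurable_fun setT (fun x : R => s * x). Proof. exact: measurable_funM. Qed.

Lemma cfU_neq0 s : cfU s != 0.
Proof.
apply/eqP => c0; apply: (@fU_neq0 s); have := fU_real s; move: c0; rewrite /cfU.
by case: (fourier fU s) => a b /= -> ->.
Qed.

Lemma Ex_cosU n j s : (0 < n)%N -> (j <= n)%N -> Ex P (fun w => cos (s * U n j w)) = cfU s.
Proof.
move=> n0 jn; rewrite (Ex_density (mU n j) fU_density (U_law n0 jn) (g := fun x => cos (s * x)))//.
  exact: (measurableT_comp mcos (mscale s)).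
by move=> x; exact: cos_max.
Qed.

(** This is where the real characteristic function enters: the sines of the errors are centred, and
    with them the sine terms of the expansions. *)
Lemma Ex_sinU n j s : (0 < n)%N -> (j <= n)%N -> Ex P (fun w => sin (s * U n j w)) = 0.
Proof.
move=> n0 jn; rewrite (Ex_density (mU n j) fU_density (U_law n0 jn) (g := fun x => sin (s * x)))//.
- exact: fU_real.
- exact: (measurableT_comp msin (mscale s)).
by move=> x; exact: sin_max.
Qed.

Lemma measurable_Xt n j : (0 < n)%N -> (j <= n)%N -> measurable_fun setT (X (t n j)).
Proof. by move=> n0 jn; apply: (measurable_X Ffilt Xito); exact: (grid_in t_grid). Qed.

Let GX := [set X i @^-1` A | i in `[0, T]%classic & A in (measurable : set_system R)].

Lemma adm_increment n i j (s : R) : (0 < n)%N -> (i <= n)%N -> (j <= n)%N ->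
  adm <<s GX>> (fun w => s * (X (t n i) w - X (t n j) w)).
Proof.
move=> n0 ni nj; apply/adm_generatedP; apply: measurable_funM => //.
by apply: measurable_funB; apply/adm_generatedP; apply: adm_X; exact: (grid_in t_grid).
Qed.

(** The limit is nonnegative, so the absolute value in [f_hat] does not increase the error. The
    average splits into the noise part [S], with variance of order 1/n, and the bias [S'] caused by
    the price, bounded by the mean squared increment. *)
Lemma f_hat_Op s : Op P r (fun n w => f_hat n (t n) (Y n w) (xi n) s - cfU s ^+ 2).
Proof.
have [c2 c20 Hc2] := max_nb_le xi_max_min.
pose c := cfU s.
pose dx n (p : 'I_n.+1 * 'I_n.+1) w := X (t n p.2) w - X (t n p.1) w.
pose S n w := \sum_(p : 'I_n.+1 * 'I_n.+1 | neighbour_pair (t n) (xi n) p) (NT n)^-1 *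
  (cos (s * dx n p w) * (cos (s * (U n p.2 w - U n p.1 w)) - c ^+ 2)
   - sin (s * dx n p w) * sin (s * (U n p.2 w - U n p.1 w))).
pose S' n w := \sum_(p : 'I_n.+1 * 'I_n.+1 | neighbour_pair (t n) (xi n) p)
   (NT n)^-1 * (cos (s * dx n p w) - 1).
have r0n : \forall n \near \oo, 0 <= r n.
  by near=> n; rewrite ltW// rate_gt0//; near: n; exact: nbhs_infty_gt.
have S'Op : Op P r S'.
  have := OpZ (s ^+ 2 / 2) (neighbour_increments_Op T0 Ffilt BB pmu lmu lsigma Xito t_grid xi_max_min xi_rate) r0n.
  move=> /Op_near; apply; near=> n => w.
  have NT0 : 0 <= (NT n)^-1 by rewrite invr_ge0.
  rewrite /S' [leRHS]ger0_norm; last first.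
    apply: mulr_ge0; first exact: (mulr_ge0 (sqr_ge0 _)).
    by apply: sumr_ge0 => p _; exact: (mulr_ge0 NT0 (sqr_ge0 _)).
  rewrite mulr_sumr; apply: le_trans (ler_norm_sum _ _ _) _; apply: ler_sum => p _.
  rewrite normrM ger0_norm// mulrCA; apply: ler_wpM2l => //.
  have /andP[h1 h2] := one_subr_cos_le (s * dx n p w).
  rewrite distrC ger0_norm//; apply: le_trans h2 _.
  by rewrite exprMn le_eqVlt; apply/orP; left; apply/eqP; rewrite /dx; ring.
have SOp : Op P r S.
  (* The bound of [noise_tail] at level [lam / 6], with degree [2 * max_nb]; the squared
     coefficients sum to 1 / N(xi). *)
  pose c0 n := 6 * (24 * (2 * max_nb n (t n) (xi n))%:R * (NT n)^-1) * 36.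
  have c00 n : 0 <= c0 n by rewrite !mulr_ge0 ?invr_ge0.
  apply: (@Op_tail _ _ _ P (6 * (24 * (2 * c2)) * 36) r c0) => //.
  - by rewrite !mulr_ge0// ltW.
  - near=> n; have n0 : (0 < n)%N by near: n; exact: nbhs_infty_gt.
    have rr0 := rate_gt0 (R := R) n0; split => //.
    have m0 := min_nb_gt0 xi_max_min n0.
    have h : (max_nb n (t n) (xi n))%:R * (NT n)^-1 <= c2 * r n ^+ 4.
      rewrite ler_pdivrMr ?ltr0n ?total_nb_gt0//; apply: le_trans (Hc2 n n0) _.
      rewrite -mulrA ler_wpM2l ?(ltW c20)// rate4 ler_pdivlMl ?ltr0n//.
      rewrite -natrM ler_nat; apply: leq_trans (total_nb_ge _ _ _).
      by rewrite leq_mul2r leqnSn orbT.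
    have h4 : r n ^+ 4 <= r n ^+ 2 by apply: ler_wiXn2l; rewrite ?rate_le1// ltW.
    have h5 : c2 * r n ^+ 4 <= c2 * r n ^+ 2 by rewrite ler_wpM2l// ltW.
    rewrite /c0 natrM.
    rewrite (_ : 6 * (24 * (2 * (max_nb n (t n) (xi n))%:R) * (NT n)^-1) * 36 =
      (144 * 72) * ((max_nb n (t n) (xi n))%:R * (NT n)^-1)); last by ring.
    by move: h h5; move: ((max_nb _ _ _)%:R / _) => y; lra.
  - near=> n => lam lam0; have n0 : (0 < n)%N by near: n; exact: nbhs_infty_gt.
    have m0 := min_nb_gt0 xi_max_min n0.
    have jn (j : 'I_n.+1) : (j <= n)%N by rewrite -ltnS.
    have l60 : 0 < lam / 6 by rewrite divr_gt0.
    have NT0 : 0 <= (NT n)^-1 by rewrite invr_ge0.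
    have TT := noise_tail (mU n) (U_indep n0) (U_indep_X n0)
      (Q := neighbour_pair (t n) (xi n)) (l := fun p => p.2) (k := fun p => p.1)
      (fun p _ => jn p.2) (fun p _ => jn p.1) (s := s) (c := c)
      (fun j h => Ex_cosU s n0 h) (fun j h => Ex_sinU s n0 h)
      (D := (2 * max_nb n (t n) (xi n))%N) _ (@neighbour_degree _ n (t n) (xi n))
      (fun=> (NT n)^-1) (x := fun p w => s * dx n p w) (f1 := @cos R) (f2 := @sin R)
      (fun p => adm_increment s n0 (jn p.2) (jn p.1)) _ mcos msin _ _ NT0 l60.
    have lk (p : 'I_n.+1 * 'I_n.+1) : neighbour_pair (t n) (xi n) p -> p.2 != p.1 :> nat.
      by rewrite /neighbour_pair inE => /andP[].
    have mx (p : 'I_n.+1 * 'I_n.+1) : measurable_fun setT (fun w => s * dx n p w).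
      by apply: measurable_funM => //; apply: measurable_funB; exact: measurable_Xt.
    have {TT} := TT lk mx (fun y => le_trans (cos_max y) (ler1n R 2)) (fun y => le_trans (sin_max y) (ler1n R 2)).
    rewrite (_ : 6 * (24 * _%:R * (NT n)^-1 / (lam / 6) ^+ 2) = c0 n / lam ^+ 2); last first.
      rewrite /c0; move: ((2 * max_nb n (t n) (xi n))%:R : R) ((NT n)^-1) => a b; field.
      by rewrite gt_eqF.
    apply: Pout_sub => w /= h; split; first by rewrite mulrCA divff ?mulr1.
    (* The price enters only through cos^2 + sin^2 = 1, so the bound on the squared coefficients is
       deterministic. *)
    under eq_bigr do rewrite cos2Dsin2 mulr1 expr2.
    exact: neighbour_average_le.
  - by near=> n.
have := OpD SOp (OpZ (c ^+ 2) S'Op r0n) => /Op_near; apply; near=> n => w.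
have n0 : (0 < n)%N by near: n; exact: nbhs_infty_gt.
have m0 := min_nb_gt0 xi_max_min n0.
rewrite f_hat_pairs.
have E : \sum_(p : 'I_n.+1 * 'I_n.+1 | neighbour_pair (t n) (xi n) p) (NT n)^-1 * cos (s * (Y n w p.2 - Y n w p.1)) - c ^+ 2 =
    S n w + c ^+ 2 * S' n w.
  transitivity (\sum_(p : 'I_n.+1 * 'I_n.+1 | neighbour_pair (t n) (xi n) p)
      (NT n)^-1 * (cos (s * (Y n w p.2 - Y n w p.1)) - c ^+ 2)).
    under [RHS]eq_bigr do rewrite mulrBr.
    rewrite sumrB; congr (_ - _).
    rewrite -[LHS]mul1r -mulr_suml; congr (_ * _).
    under eq_bigr do rewrite -[_^-1]mulr1.
    by rewrite -mulr_sumr sum_neighbour_pairs1 mulVf// pnatr_eq0 -lt0n total_nb_gt0.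
  rewrite /S /S' mulr_sumr -big_split/=; apply: eq_bigr => p _.
  have -> : s * (Y n w p.2 - Y n w p.1) = s * dx n p w + s * (U n p.2 w - U n p.1 w) by rewrite /dx; ring.
  by rewrite cosD; ring.
have c20' : 0 <= c ^+ 2 by exact: sqr_ge0.
rewrite -E -[X in `|_ - X|](ger0_norm c20'); exact: ler_dist_dist.
Unshelve. all: by end_near. Qed.

Lemma Re_G_Op s : Op P r (fun n w =>
  complex.Re (G n (Y n w) s) + s ^+ 2 / 2 * cfU s ^+ 2 * IV w).
Proof.
pose c := cfU s.
pose b n m := lag_weight (R := R) n m.
pose x n (p : 'I_(NS n) * 'I_n.+1) w := s * dX X t p w.
pose u n (p : 'I_(NS n) * 'I_n.+1) w := s * (U n (hi p) w - U n (lo p) w).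
(* With 1 subtracted, the coefficients in [M1] are as small as the increments of the price; the
   constant goes to [M2], where the sharper bounds for deterministic coefficients apply. *)
pose f (y : R) := cos y - 1.
pose M1 n w := \sum_(p : 'I_(NS n) * 'I_n.+1 | lag_pair p) b n p.1.+1 *
  (f (x n p w) * (cos (u n p w) - c ^+ 2) - sin (x n p w) * sin (u n p w)).
pose M2 n w := \sum_(p : 'I_(NS n) * 'I_n.+1 | lag_pair p) b n p.1.+1 * (cos (u n p w) - c ^+ 2).
pose M3 n w := \sum_(p : 'I_(NS n) * 'I_n.+1 | lag_pair p) b n p.1.+1 * (f (x n p w) + x n p w ^+ 2 / 2).
(* Conditional variance of [M1] up to the degree: weights r^8, squared increments r^2 and r^(-6)
   pairs give r^4. *)
pose V n w := \sum_(p : 'I_(NS n) * 'I_n.+1 | lag_pair p) b n p.1.+1 ^+ 2 *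
  (f (x n p w) ^+ 2 + sin (x n p w) ^+ 2).
have r0n : \forall n \near \oo, 0 <= r n.
  by near=> n; rewrite ltW// rate_gt0//; near: n; exact: nbhs_infty_gt.
have r40n : \forall n \near \oo, 0 <= r n ^+ 4.
  by near=> n; rewrite exprn_ge0//; near: n.
have facts n : (2 < n)%N -> [/\ (0 < n)%N, 0 < r n, r n <= 1, r n ^+ 4 <= r n ^+ 2 &
    forall m, (0 < m <= NS n)%N -> `|b n m| <= 32 * r n ^+ 4].
  move=> n2; have n0 : (0 < n)%N by exact: ltn_trans n2.
  have r0 := rate_gt0 (R := R) n0; have r1 := rate_le1 (R := R) n0.
  split => //; first by apply: ler_wiXn2l => //; exact: ltW.
  move=> m mN; have [N1 _ _ rN] := nscales_rate (R := R) n2.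
  apply: (le_trans (lag_weight_bound N1 mN)).
  rewrite ler_pdivrMr; last by rewrite exprn_gt0// ltr0n ltnW.
  have : 1 <= (2 * (NS n)%:R * r n ^+ 2) ^+ 2 by rewrite exprn_ege1.
  by rewrite (_ : (_ * _) ^+ 2 = 4 * (r n ^+ 4 * (NS n)%:R ^+ 2)); [lra|ring].
have bp n (p : 'I_(NS n) * 'I_n.+1) : (2 < n)%N -> `|b n p.1.+1| <= 32 * r n ^+ 4.
  by move=> /facts[_ _ _ _]; apply; rewrite /= ltn_ord.
have bp2 n (p : 'I_(NS n) * 'I_n.+1) : (2 < n)%N -> b n p.1.+1 ^+ 2 <= (32 * 32) * r n ^+ 8.
  move=> n2; rewrite -[leLHS]real_normK ?num_real//.
  apply: (@le_trans _ _ ((32 * r n ^+ 4) ^+ 2)).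
    by rewrite lerXn2r ?nnegrE ?bp// (le_trans _ (bp n p n2)).
  by rewrite le_eqVlt; apply/orP; left; apply/eqP; ring.
have Op2 := lag_powers_Op T0 Ffilt BB pmu lmu lsigma Xito t_grid t_regular (k := 2%N) isT.
have Op4 := lag_powers_Op T0 Ffilt BB pmu lmu lsigma Xito t_grid t_regular (k := 4%N) isT.
have Opr : Op P r (fun n _ => r n).
  apply: (@Op_deterministic _ _ _ P 1) => //; near=> n.
  by rewrite mul1r ger0_norm//; near: n.
have Opr4 : Op P (fun n => r n ^+ 4) (fun n _ => r n ^+ 4).
  apply: (@Op_deterministic _ _ _ P 1) => //; near=> n.
  by rewrite mul1r ger0_norm//; near: n.
have M3Op : Op P r M3.
  have := OpZ (32 * s ^+ 4) (Op_bounded_mul Op4 Opr r0n) r0n => /Op_near; apply; near=> n => w.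
  have n2 : (2 < n)%N by near: n; exact: nbhs_infty_gt.
  have [n0 rr0 r1 _ _] := facts n n2.
  have k0 (p : 'I_(NS n) * 'I_n.+1) : 0 <= r n ^+ (6 - 4) * dX X t p w ^+ 4.
    by apply: mulr_ge0; rewrite exprn_even_ge0.
  rewrite [leRHS]ger0_norm; last first.
    apply: mulr_ge0; first by rewrite mulr_ge0// exprn_even_ge0.
    by apply: mulr_ge0 (ltW rr0); exact: sumr_ge0.
  rewrite mulr_suml mulr_sumr; apply: le_trans (ler_norm_sum _ _ _) _; apply: ler_sum => p _.
  rewrite normrM; apply: (@le_trans _ _ (32 * r n ^+ 4 * x n p w ^+ 4)).
    by apply: ler_pM => //; [exact: bp|exact: cos_taylor2].
  rewrite /x exprMn.
  have h : r n ^+ 4 <= r n ^+ 3 by apply: ler_wiXn2l => //; exact: ltW.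
  have s4 : 0 <= s ^+ 4 * dX X t p w ^+ 4 by apply: mulr_ge0; rewrite exprn_even_ge0.
  rewrite (_ : 32 * s ^+ 4 * _ = 32 * r n ^+ 3 * (s ^+ 4 * dX X t p w ^+ 4)); last first.
    by rewrite (_ : (6 - 4 = 2)%N)//; ring.
  by apply: ler_wpM2r => //; rewrite ler_wpM2l.
have VOp : Op P (fun n => r n ^+ 4) V.
  have := OpZ ((32 * 32) * s ^+ 2) (Op_bounded_mul Op2 Opr4 r40n) r40n => /Op_near; apply; near=> n => w.
  have n2 : (2 < n)%N by near: n; exact: nbhs_infty_gt.
  have [n0 rr0 r1 _ _] := facts n n2.
  have k0 (p : 'I_(NS n) * 'I_n.+1) : 0 <= r n ^+ (6 - 2) * dX X t p w ^+ 2.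
    by apply: mulr_ge0; rewrite exprn_even_ge0.
  rewrite [leRHS]ger0_norm; last first.
    apply: mulr_ge0; first by apply: mulr_ge0 (sqr_ge0 _); rewrite mulr_ge0.
    by apply: mulr_ge0; [exact: sumr_ge0|rewrite exprn_even_ge0].
  rewrite /V ger0_norm; last by apply: sumr_ge0 => p _; apply: mulr_ge0 (sqr_ge0 _) (addr_ge0 (sqr_ge0 _) (sqr_ge0 _)).
  rewrite mulr_suml mulr_sumr; apply: ler_sum => p _.
  apply: (@le_trans _ _ ((32 * 32) * r n ^+ 8 * x n p w ^+ 2)).
    apply: ler_pM; [exact: sqr_ge0|exact: (addr_ge0 (sqr_ge0 _) (sqr_ge0 _))|exact: bp2|].
    (* (cos x - 1)^2 + sin(x)^2 = 2 (1 - cos x), which is at most x^2. *)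
    have /andP[_ h] := one_subr_cos_le (x n p w).
    by have := cos2Dsin2 (x n p w); rewrite /f; move: h; nra.
  by rewrite /x (_ : (6 - 2 = 4)%N)// le_eqVlt; apply/orP; left; apply/eqP; ring.
have jU n (p : 'I_(NS n) * 'I_n.+1) : lag_pair p -> hi p != lo p.
  by move=> /lo_lt_hi; rewrite neq_ltn orbC => ->.
have M1Op : Op P r M1.
  (* The degree 2 N, of order r^(-2), times [V] of order r^4 gives a conditional variance of order
     r^2. *)
  pose c0 (n : nat) : R := 6 * (24 * (2 * NS n)%:R) * 36.
  have c00 n : 0 <= c0 n by rewrite !mulr_ge0.
  apply: (@Op_conditional _ _ _ P (144 * 144) r (fun n => r n ^+ 4) c0 M1 V _ VOp) => //.
  - near=> n; have n2 : (2 < n)%N by near: n; exact: nbhs_infty_gt.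
    have [n0 rr0 r1 _ _] := facts n n2; have [_ _ Nr _] := nscales_rate (R := R) n2.
    split => //; first by rewrite exprn_ge0// ltW.
    rewrite /c0 natrM (_ : 6 * _ * 36 * r n ^+ 4 = (144 * 72) * r n ^+ 2 * ((NS n)%:R * r n ^+ 2)); last by ring.
    rewrite (_ : (144 * 144) * _ = (144 * 72) * r n ^+ 2 * 2); last by ring.
    by rewrite ler_wpM2l// mulr_ge0// exprn_ge0// ltW.
  - near=> n => M lam Mp lam0.
    have n2 : (2 < n)%N by near: n; exact: nbhs_infty_gt.
    have [n0 rr0 r1 _ _] := facts n n2; have [N1 Nn _ _] := nscales_rate (R := R) n2.
    have l60 : 0 < lam / 6 by rewrite divr_gt0.
    have mx (p : 'I_(NS n) * 'I_n.+1) : measurable_fun setT (x n p).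
      by apply: measurable_funM => //; apply: measurable_funB; apply: measurable_Xt => //; rewrite ?hi_le ?lo_le.
    have mf : measurable_fun setT f by exact: measurable_funB.
    have f2 y : `|f y| <= 2.
      by rewrite /f ler_norml; have := cos_geN1 y; have := cos_le1 y; lra.
    have TT := noise_tail (mU n) (U_indep n0) (U_indep_X n0)
      (Q := @lag_pair n (NS n)) (l := @hi n (NS n)) (k := @lo n (NS n))
      (fun p _ => hi_le p) (fun p _ => lo_le p) (s := s) (c := c)
      (fun j h => Ex_cosU s n0 h) (fun j h => Ex_sinU s n0 h)
      (D := (2 * NS n)%N) (jU n) (@lag_degree n (NS n))
      (fun p => b n p.1.+1) (x := x n) (f1 := f) (f2 := @sin R)
      (fun p => adm_increment s n0 (hi_le p) (lo_le p)) mx mf msin f2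
      (fun y => le_trans (sin_max y) (ler1n R 2)) Mp l60.
    rewrite (_ : c0 n * M / lam ^+ 2 = 6 * (24 * (2 * NS n)%:R * M / (lam / 6) ^+ 2)); last first.
      rewrite /c0; move: ((2 * NS n)%:R : R) => a; field.
      by rewrite gt_eqF.
    apply: Pout_sub TT => w /= [h1 h2]; split; first by rewrite mulrCA divff ?mulr1.
    by apply: le_trans h2; exact: ler_norm.
have M2Op : Op P r M2.
  pose S2 n := 32 * \sum_(p : 'I_(NS n) * 'I_n.+1 | lag_pair p) b n p.1.+1 ^+ 2 +
               4 * \sum_(j < n.+1) linear_weight n (NS n) (b n) j ^+ 2.
  have S20 n : 0 <= S2 n.
    by apply: addr_ge0; apply: mulr_ge0 => //; apply: sumr_ge0 => i _; exact: sqr_ge0.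
  apply: (@Op_tail _ _ _ P (9 * (32 * (64 * 64) + 4 * (40 * 40))) r (fun n => 9 * S2 n)).
  - by rewrite mulr_ge0// addr_ge0.
  - near=> n; have n2 : (2 < n)%N by near: n; exact: nbhs_infty_gt.
    have [n0 rr0 r1 r42 _] := facts n n2; have [N1 Nn _ rN] := nscales_rate (R := R) n2.
    have r2 : 0 <= r n ^+ 2 by rewrite exprn_ge0// ltW.
    split => //; rewrite -[leRHS]mulrA; apply: ler_wpM2l => //; rewrite mulrDl; apply: lerD.
      rewrite -[leRHS]mulrA; apply: ler_wpM2l => //.
      rewrite (_ : (64 * 64) * r n ^+ 2 = 4 * ((32 * 32) * r n ^+ 2)); last by ring.
      apply: lag_sum_le => //; first exact: mulr_ge0.
      by move=> p _; apply: le_trans (bp2 n p n2) _; rewrite le_eqVlt; apply/orP; left; apply/eqP; ring.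
    rewrite -[leRHS]mulrA; apply: ler_wpM2l => //.
    have := sum_linear_weight_sqr (ltnW N1) Nn (lag_weight_bound N1) (sum_lag_weight N1).
    move=> /le_trans; apply.
    have NR0 : 0 < (NS n)%:R :> R by rewrite ltr0n ltnW.
    have h1 : n.+1%:R^-1 <= r n ^+ 2.
      apply: le_trans r42; rewrite rate4 lef_pV2 ?posrE ?ltr0n// ler_nat//.
    have h2 : (NS n)%:R^-1 <= 2 * r n ^+ 2.
      by rewrite invf_ple ?posrE// ?mulr_gt0 ?exprn_gt0//; rewrite -[leLHS]mul1r ler_pdivrMr ?mulr_gt0 ?exprn_gt0// mulrA [_ * 2]mulrC.
    rewrite natrM (_ : 3 * (NS n)%:R * (2 * (8 / (NS n)%:R ^+ 2 * (NS n)%:R)) ^+ 2 = (3 * 256) * (NS n)%:R^-1).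
      by move: h1 h2; move: (n.+1%:R^-1) ((NS n)%:R^-1) (r n ^+ 2) r2 => u1 u2 u3 u30 h1 h2; lra.
    by field; rewrite gt_eqF.
  - near=> n => lam lam0.
    have n2 : (2 < n)%N by near: n; exact: nbhs_infty_gt.
    have [n0 rr0 r1 _ _] := facts n n2; have [N1 Nn _ _] := nscales_rate (R := R) n2.
    have l30 : 0 < lam / 3 by rewrite divr_gt0.
    have TT := pure_noise_tail (mU n) (U_indep n0)
      (Q := @lag_pair n (NS n)) (l := @hi n (NS n)) (k := @lo n (NS n))
      (fun p _ => hi_le p) (fun p _ => lo_le p) (s := s) (c := c)
      (fun j h => Ex_cosU s n0 h) (fun j h => Ex_sinU s n0 h)
      (b := fun p => b n p.1.+1) (v := fun j => linear_weight n (NS n) (b n) j)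
      (@lo_lt_hi n (NS n)) (@lag_pair_inj n (NS n))
      (fun w => lag_linear_form (ltnW N1) Nn (lag_weight_bound N1) (fun j => cos (s * U n j w) - c)) l30.
    rewrite (_ : 9 * S2 n / lam ^+ 2 = S2 n / (lam / 3) ^+ 2); last first.
      by move: (S2 n) => a; field; rewrite gt_eqF.
    by apply: Pout_sub TT => w /= h; rewrite mulrCA divff ?mulr1.
  - by near=> n; rewrite mulr_ge0.
have W := weighted_squares_Op T0 Ffilt BB pmu lmu lsigma Xito t_grid t_regular.
have := OpD (OpD M1Op M2Op) (OpD (OpZ (c ^+ 2) M3Op r0n) (OpZ (- (c ^+ 2 * (s ^+ 2 / 2))) W r0n)).
move=> /Op_near; apply; near=> n => w.
have n2 : (2 < n)%N by near: n; exact: nbhs_infty_gt.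
have [N1 _ _ _] := nscales_rate (R := R) n2.
rewrite Re_G// le_eqVlt; apply/orP; left; apply/eqP; congr `|_|.
pose A := \sum_(p : 'I_(NS n) * 'I_n.+1 | lag_pair p) b n p.1.+1 * dX X t p w ^+ 2.
rewrite -/A.
suff E : \sum_(p : 'I_(NS n) * 'I_n.+1 | lag_pair p) b n p.1.+1 * cos (s * (Y n w (hi p) - Y n w (lo p))) =
    M1 n w + M2 n w + c ^+ 2 * M3 n w - c ^+ 2 * (s ^+ 2 / 2) * A.
  by rewrite -/(b n) E -/c; ring.
(* The vanishing total weight allows [c ^+ 2] to be subtracted from every cosine of the errors. *)
have Z : c ^+ 2 * \sum_(p : 'I_(NS n) * 'I_n.+1 | lag_pair p) b n p.1.+1 = 0.
  by rewrite sum_lag_pairs// mulr0.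
rewrite -[RHS]addr0 -[X in _ = _ + X]Z /M1 /M2 /M3 /A !mulr_sumr -!big_split/= -sumrB -big_split/=.
apply: eq_bigr => p _.
have -> : s * (Y n w (hi p) - Y n w (lo p)) = x n p w + u n p w by rewrite /x /u /dX; ring.
have E2 : x n p w ^+ 2 = s ^+ 2 * dX X t p w ^+ 2 by rewrite /x exprMn.
by rewrite cosD /f E2; field.
Unshelve. all: by end_near. Qed.

Section regression.
Variables (m : nat) (s : 'I_m -> R).
Hypotheses (m_gt0 : (0 < m)%N) (s_neq0 : forall j, s j != 0).

Let b_hat n w := beta_hat n (t n) (Y n w) (xi n) s.

(** The error is the quotient of sum x_j (y_j - x_j IV) by sum x_j^2. The residuals are of the order
    of the rate by [Re_G_Op] and [f_hat_Op], so only a lower bound on the denominator is missing. *)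
Lemma beta_hat_Op : Op P r (fun n w => b_hat n w - IV w).
Proof.
pose th j := cfU (s j) ^+ 2.
pose fh j n w := f_hat n (t n) (Y n w) (xi n) (s j).
pose x j n w := - (s j ^+ 2 / 2) * fh j n w.
pose y j n w := complex.Re (G n (Y n w) (s j)).
have r0n : \forall n \near \oo, 0 <= r n.
  by near=> n; rewrite ltW// rate_gt0//; near: n; exact: nbhs_infty_gt.
have eOp j : Op P r (fun n w => fh j n w - th j) by exact: f_hat_Op.
have xOp j : Op P (fun=> 1) (x j).
  have e1 : Op P (fun=> 1) (fun n w => fh j n w - th j).
    apply: (@Op_rate _ _ _ P 1 _ _ _ _ (eOp j)) => //; near=> n; rewrite mulr1 rate_le1//.
    by near: n; exact: nbhs_infty_gt.
  have thOp : Op P (fun=> 1) (fun _ _ => th j).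
    apply: (@Op_deterministic _ _ _ P (`|th j| + 1) (fun=> 1) (fun=> th j)); first by rewrite ltr_wpDl.
    by near=> n; rewrite mulr1 lerDl.
  have := OpZ (- (s j ^+ 2 / 2)) (OpD e1 thOp); move=> /(_ _)/Op_near; apply; first by near=> n.
  by near=> n => w; rewrite subrK.
have resOp j : Op P r (fun n w => y j n w - x j n w * IV w).
  have iv := integrated_volatility_Op T0 Ffilt BB pmu lmu lsigma Xito t_grid.
  have := OpD (Re_G_Op (s j)) (OpZ (s j ^+ 2 / 2) (Op_bounded_mul iv (eOp j) r0n) r0n).
  move=> /Op_near; apply; near=> n => w.
  by rewrite le_eqVlt; apply/orP; left; apply/eqP; congr `|_|; rewrite /y /x /th; ring.
pose S n w := \sum_j x j n w * (y j n w - x j n w * IV w).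
have SOp : Op P r S by apply: Op_sum => // j; exact: Op_bounded_mul.
pose j0 := Ordinal m_gt0.
have th0 : 0 < th j0 by rewrite exprn_even_gt0//= cfU_neq0.
have th20 : 0 < th j0 / 2 by rewrite divr_gt0.
have s20 : 0 < s j0 ^+ 2 / 2 by rewrite divr_gt0// exprn_even_gt0//= s_neq0.
(* One frequency bounds the denominator from below: its [f_hat] is eventually at least half its
   limit, which is positive because the characteristic function does not vanish. *)
pose q := (s j0 ^+ 2 / 2 * (th j0 / 2)) ^+ 2.
have q0 : 0 < q by rewrite exprn_gt0// mulr_gt0.
move=> e e0; have e20 : 0 < e / 2 by rewrite divr_gt0.
have [M M0 HM] := SOp _ e20; have [M' M'0 HM'] := eOp j0 _ e20.
exists (M / q); first by rewrite divr_gt0.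
near=> n.
have H : Pout P [set w | M * r n < `|S n w|] (e / 2) by near: n.
have H' : Pout P [set w | M' * r n < `|fh j0 n w - th j0|] (e / 2) by near: n.
have rs : r n <= th j0 / 2 / M' by near: n; apply: rate_small; rewrite divr_gt0.
rewrite ler_pdivlMr// in rs.
have := PoutU H H'; rewrite -splitr; apply: Pout_sub => w /= h.
apply: contrapT => /not_orP[/negP h1 /negP h2].
rewrite -leNgt in h1; rewrite -leNgt in h2; move: h; apply/negP; rewrite -leNgt.
pose D := \sum_j x j n w ^+ 2.
have qD : q <= D.
  rewrite /D (bigD1 j0)//=; apply: ler_wpDr; first by apply: sumr_ge0 => j _; exact: sqr_ge0.
  have fq : th j0 / 2 <= fh j0 n w.
    have := le_trans h2 _; rewrite mulrC in rs; move=> /(_ _ rs); rewrite ler_norml => /andP[+ _].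
    by move: (fh j0 n w) (th j0) => a b; lra.
  have sq := ler_wpM2l (ltW s20) fq.
  have sth0 := mulr_gt0 s20 th20.
  rewrite /q /x mulNr sqrrN; apply: lerXn2r => //; rewrite nnegrE; first exact: ltW.
  exact: le_trans (ltW sth0) sq.
have D0 : 0 < D by exact: lt_le_trans qD.
have -> : b_hat n w - IV w = S n w / D.
  have -> : S n w = \sum_j x j n w * y j n w - D * IV w.
    by rewrite /S /D mulr_suml -sumrB; apply: eq_bigr => j _; ring.
  by rewrite mulrBl mulrAC divff ?mul1r// gt_eqF.
rewrite normrM normfV (gtr0_norm D0) ler_pdivrMr//; apply: (le_trans h1).
rewrite (_ : M / q * r n * D = M * r n * (D / q)); last by ring.
have rn0 : 0 <= r n by near: n.
by rewrite ler_peMr ?ler_pdivlMr ?mul1r// mulr_ge0// ltW.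
Unshelve. all: by end_near. Qed.

Lemma measurable_beta_hat n : (2 < n)%N -> measurable_fun setT (b_hat n).
Proof.
move=> n2; have n0 : (0 < n)%N by exact: ltn_trans n2.
have [N1 _ _ _] := nscales_rate (R := R) n2.
have mY j : (j <= n)%N -> measurable_fun setT (fun w => Y n w j).
  by move=> jn; apply: measurable_funD => //; exact: measurable_Xt.
have mc (a : R) l k : (l <= n)%N -> (k <= n)%N ->
    measurable_fun setT (fun w => cos (a * (Y n w l - Y n w k))).
  move=> ln kn; apply: (measurableT_comp mcos); apply: measurable_funM => //.
  by apply: measurable_funB; exact: mY.
have jn (j : 'I_n.+1) : (j <= n)%N by rewrite -ltnS.
have mx j : measurable_fun setT (fun w => - (s j ^+ 2 / 2) * f_hat n (t n) (Y n w) (xi n) (s j)).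
  apply: measurable_funM => //; under eq_fun do rewrite f_hat_pairs.
  apply: measurableT_comp; first exact: normr_measurable.
  by apply: measurable_sum_cond => p; apply: measurable_funM => //; exact: mc.
have my j : measurable_fun setT (fun w => complex.Re (G n (Y n w) (s j))).
  under eq_fun do rewrite Re_G//.
  apply: measurable_sum_cond => p; apply: measurable_funM => //.
  by apply: mc; rewrite ?hi_le ?lo_le.
apply: measurable_funM.
  by apply: measurable_sum_cond => j; exact: measurable_funM.
(* The inverse of a nonnegative quantity is a real power with exponent -1, the value at zero
   included, and real powers are measurable. *)
have -> : (fun w => (\sum_j (- (s j ^+ 2 / 2) * f_hat n (t n) (Y n w) (xi n) (s j)) ^+ 2)^-1) =
    (@powR R ^~ (-1)) \o (fun w => \sum_j (- (s j ^+ 2 / 2) * f_hat n (t n) (Y n w) (xi n) (s j)) ^+ 2).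
  by apply/funext => w /=; rewrite powR_inv1//; apply: sumr_ge0 => j _; exact: sqr_ge0.
apply: measurableT_comp; first exact: measurable_powR.
by apply: measurable_sum_cond => j; exact: measurable_funX.
Qed.

End regression.

End estimator.

Unset Implicit Arguments.

Theorem theorem5 (R : realType) (d : measure_display)
    (Omega : measurableType d) (P : probability Omega R)
    (T : R) (T_gt0 : 0 < T)
    (* the efficient process *)
    (F : R -> set_system Omega) (F_filtration : is_filtration T F)
    (B mu sigma X : R -> Omega -> R)
    (B_brownian : brownian_motion P T F B)
    (mu_progressive : progressive T F mu)
    (mu_locally_bounded : locally_bounded P T F mu)
    (sigma_gt0 : forall (u : R) (w : Omega), 0 <= u <= T -> 0 < sigma u w)
    (sigma_locally_bounded : locally_bounded P T F sigma)
    (sigma_ito : ito_semimartingale P T F sigma)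
    (X_ito : ito_process P T F B mu sigma X)
    (* the grids *)
    (t : nat -> nat -> R)
    (t_grid : forall n, (0 < n)%N -> is_grid T n (t n))
    (t_mesh : max_step n (t n) @[n --> \oo] --> 0)
    (t_regular : asymp (R := R) (fun n => min_step n (t n)) (fun n => max_step n (t n)))
    (* the errors *)
    (fU : R -> R) (fU_density : is_density fU)
    (U : nat -> nat -> {RV P >-> R})
    (U_law : forall n j, (0 < n)%N -> (j <= n)%N -> has_density P (U n j) fU)
    (U_indep : forall n, (0 < n)%N -> mutually_independent P n (U n))
    (U_indep_X : forall n, (0 < n)%N ->
       independent_systems P
         (sigma_generated [set j | (j <= n)%N] (U n))
         (sigma_generated `[0, T] X))
    (fU_real : forall s : R, complex.Im (fourier fU s) = 0)
    (fU_neq0 : forall s : R, fourier fU s <> 0)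
    (U_square : forall n j, (0 < n)%N -> (j <= n)%N ->
       ('E_P[fun w => (U n j w ^+ 2)%R] < +oo)%E)
    (* the bandwidth *)
    (xi : nat -> R) (xi_gt0 : forall n, (0 < n)%N -> 0 < xi n)
    (xi_max_min : asymp (R := R) (fun n => (max_nb n (t n) (xi n))%:R)
                        (fun n => (min_nb n (t n) (xi n))%:R))
    (xi_min : asymp (R := R) (fun n => (min_nb n (t n) (xi n))%:R)
                    (fun n => n%:R * xi n))
    (xi_rate : xi =O_\oo (rate R))
    (* the frequencies *)
    (m : nat) (m_gt0 : (0 < m)%N) (s : 'I_m -> R) (s_neq0 : forall j, s j != 0) :
  bigOp P
    (fun n w =>
       beta_hat n (t n) (fun j => X (t n j) w + U n j w) (xi n) s
       - \int[lebesgue_measure]_(u in `[0, T]) sigma u w ^+ 2)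
    (rate R).
Proof.
have mU n j : measurable_fun setT (U n j : Omega -> R) by exact: measurable_funPT.
have beta_Op := beta_hat_Op T_gt0 F_filtration B_brownian mu_progressive mu_locally_bounded
  sigma_locally_bounded X_ito t_grid t_regular fU_density mU U_law U_indep U_indep_X
  fU_real fU_neq0 xi_max_min xi_rate m_gt0 s_neq0.
move=> e e0; have [M M0 HM] := beta_Op e e0; exists M => //; near=> n.
have n2 : (2 < n)%N by near: n; exact: nbhs_infty_gt.
(* Back from a measurable superset to the event itself, which is measurable once [n] exceeds 2. *)
apply: Pout_meas; last by near: n.
rewrite -[X in measurable X]setTI; apply: measurable_fun_ltr => //.
apply: measurableT_comp; first exact: normr_measurable.
apply: measurable_funB; last first.
  exact: (measurable_integrated_volatility T_gt0 F_filtration X_ito).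
exact: (measurable_beta_hat F_filtration X_ito t_grid mU).
Unshelve. all: by end_near. Qed.
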